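(* Let $p_\eta$ be a distribution over $S\subseteq\mathbb{R}^d$ belonging to an exponential family $\mathcal{E}(T,h)$ with natural parameter $\eta\in\mathcal{H}\subseteq\mathbb{R}^k$. Let $\eta^{(1)},\eta^{(2)}\in\mathcal{H}$ with $\eta^{(1)}\le\eta^{(2)}$ coordinatewise, $I_j=[\eta^{(1)}_j,\eta^{(2)}_j]$ for $j\in[k]$, $R=\eta^{(2)}-\eta^{(1)}$, $m=\frac{\eta^{(1)}+\eta^{(2)}}{2}$, and assume $\prod_{j\in[k]}I_j\subseteq\mathcal{H}$. Let $\eta\sim\mathcal{U}\left(\prod_{j}I_j\right)$, let $X=(X_1,\dots,X_n)\sim p_\eta^{\otimes n}$, let $X_i'\sim p_\eta$ be an independent sample, and let $X_{\sim i}$ denote $X$ with $X_i$ replaced by $X_i'$. Let $M:S^n\to\prod_{j\in[k]}[-\frac{R_j}{2},\frac{R_j}{2}]$ be an $(\varepsilon,\delta)$-differentially private mechanism with $\varepsilon\in[0,1]$, $\delta\ge0$, such that $\mathbb{E}_{X,M}\left[\|M(X)-(\eta-m)\|_2^2\right]\le\alpha^2\le\frac{\|R\|_2^2}{24}$ for every $\eta\in\prod_j I_j$. Define $s\in\mathbb{R}^k$ by $s_j=\left[\frac{R_j^2}{4}-(\eta_j-m_j)^2\right]\left[M_j(X_{\sim i})-(\eta_j-m_j)\right]$. Then for every $t_0>0$ there is an index $i\in[n]$ such that $$n\left\{2\delta t_0+2\varepsilon\,\mathbb{E}_{\eta}\left[\sqrt{\mathbb{E}_{X_{\sim i},M}\left[s^\top\Sigma_T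 s\right]}\right]+2\,\mathbb{E}_\eta\left[\int_{t_0}^\infty\Pr_{X_i}\left[\|T(X_i)-\mu_T\|_2>\frac{4t}{\|R\|_\infty^3\sqrt{k}}\right]dt\right]\right\}\ge\frac{\|R\|_2^2}{24}.$$
   Context: Exponential family: given $S\subseteq\mathbb{R}^d$, $h:S\to\mathbb{R}_{\ge0}$ and $T:S\to\mathbb{R}^k$, the family $\mathcal{E}(T,h)$ consists of the densities (or probability mass functions) $p_\eta(x)=h(x)\exp(\eta^\top T(x)-Z(\eta))$, $x\in S$, where $Z(\eta)=\ln\int_S h(x)\exp(\eta^\top T(x))\,dx$ and $\eta$ ranges over the natural parameter range $\mathcal{H}=\{\eta: Z(\eta)<\infty\}$. For a given $\eta$, $\mu_T=\mathbb{E}_{X\sim p_\eta}[T(X)]$ and $\Sigma_T=\mathbb{E}_{X\sim p_\eta}[(T(X)-\mu_T)(T(X)-\mu_T)^\top]$ (both depend on $\eta$). $\mathcal{U}(A)$ is the uniform distribution on $A$. A randomized algorithm $M:\mathcal{X}^n\to\mathcal{Y}$ is $(\varepsilon,\delta)$-differentially private if for every pair of datasets differing in exactly one entry and every measurable $Y$, $\Pr[M(X)\in Y]\le e^{\varepsilon}\Pr[M(X')\in Y]+\delta$. *)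

(* Defs.v *)
From HB Require Import structures.
From mathcomp Require Import all_boot all_order all_algebra.
From mathcomp Require Import all_classical all_reals all_analysis.

Set Implicit Arguments.
Unset Strict Implicit.
Unset Printing Implicit Defensive.

Import Order.TTheory GRing.Theory Num.Theory.
Import numFieldNormedType.Exports.

Local Open Scope classical_set_scope.
Local Open Scope ring_scope.

(* R^d is d.-tuple (measurableTypeR R), whose sigma-algebra is generated by the
   coordinate maps, i.e. the Borel sets; vectors that enter matrix expressions
   are converted by [vec]. *)
Notation euclid R d := (d.-tuple (measurableTypeR R)).

Section tuple_measures.
Context (R : realType).

Definition tuple_cons (d : measure_display) (T : measurableType d) (n : nat)
    (p : T * n.-tuple T) : n.+1.-tuple T := cons_tuple p.1 p.2.

Lemma measurable_tuple_cons (d : measure_display) (T : measurableType d) n :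
  measurable_fun [set: T * n.-tuple T] (@tuple_cons d T n).
Proof. exact: (measurable_cons measurable_fst measurable_snd). Qed.

HB.instance Definition _ (d : measure_display) (T : measurableType d) n :=
  isMeasurableFun.Build _ _ _ _ (@tuple_cons d T n)
    (@measurable_tuple_cons d T n).

Fixpoint product_prob (d : measure_display) (T : measurableType d) (n : nat) :
    ('I_n -> probability T R) -> probability (n.-tuple T) R :=
  match n with
  | 0 => fun=> \d_([tuple] : 0.-tuple T)
  | n'.+1 => fun P =>
      distribution (P ord0 \x product_prob (fun i => P (lift ord0 i)))%E
        (@tuple_cons d T n')
  end.

Definition iid (d : measure_display) (T : measurableType d) (n : nat)
    (P : probability T R) : probability (n.-tuple T) R :=
  product_prob (fun _ : 'I_n => P).

Definition cons_measure (d : measure_display) (T : measurableType d) (n : nat)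
    (m : {measure set (T * n.-tuple T) -> \bar R}) :=
  pushforward m (@tuple_cons d T n).

HB.instance Definition _ (d : measure_display) (T : measurableType d) n
    (m : {measure set (T * n.-tuple T) -> \bar R}) :=
  Measure.copy (cons_measure m)
    (measure_function_pushforward__canonical__measure_function_Measure
       m (@measurable_tuple_cons d T n)).

(* The variant [\x^] of the binary product only asks its first factor to be
   sigma-finite. *)
Fixpoint lebesgue_space (d : nat) : {measure set (euclid R d) -> \bar R} :=
  match d with
  | 0 => \d_([tuple] : euclid R 0)
  | d'.+1 => cons_measure (@lebesgue_measure R \x^ lebesgue_space d')%E
  end.

(* The degenerate interval [a, a] carries the point mass at a. *)
Definition uniform_itv (a b : R) : probability (measurableTypeR R) R :=
  match pselect (a < b) with
  | left ab => uniform_prob ab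
  | right _ => \d_(a : measurableTypeR R)
  end.

Definition box (k : nat) (a b : euclid R k) : set (euclid R k) :=
  [set y | forall j, tnth a j <= tnth y j <= tnth b j].

(* The uniform distribution on a box is the product of the uniform
   distributions on its sides. *)
Definition uniform_box (k : nat) (a b : euclid R k) : probability (euclid R k) R :=
  product_prob (fun j => uniform_itv (tnth a j) (tnth b j)).

End tuple_measures.

Section vectors.
Context (R : realType) (k : nat).

Definition vec (x : euclid R k) : 'cV[R]_k := \col_j tnth x j.

Definition dot (u v : 'cV[R]_k) : R := (u^T *m v) ord0 ord0.

Definition norm2 (v : 'cV[R]_k) : R := Num.sqrt (\sum_j v j ord0 ^+ 2).

Definition normoo (v : 'cV[R]_k) : R := \big[Num.max/0]_j `|v j ord0|.

End vectors.

Variant family_kind := Continuous | Discrete.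

Section exponential_family.
Context (R : realType) (d k : nat).

(* Densities are taken with respect to Lebesgue measure and probability mass
   functions with respect to counting measure. *)
Definition base_measure (K : family_kind) : {measure set (euclid R d) -> \bar R} :=
  match K with
  | Continuous => lebesgue_space R d
  | Discrete => @counting (euclid R d) R
  end.

Variables (K : family_kind) (S : set (euclid R d)) (h : euclid R d -> R)
  (T : euclid R d -> euclid R k).

Definition log_partition (eta : euclid R k) : \bar R :=
  lne (\int[base_measure K]_(x in S)
    (h x * expR (dot (vec eta) (vec (T x))))%:E).

Definition natural_range : set (euclid R k) :=
  [set eta | (log_partition eta < +oo)%E].

Definition expfam_density (eta : euclid R k) (x : euclid R d) : R :=
  h x * expR (dot (vec eta) (vec (T x)) - fine (log_partition eta)).

(* [p eta] is the law p_eta of E(T, h).  It exists for every eta in the natural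
   range unless h vanishes almost everywhere on S, in which case the family is
   empty. *)
Definition is_expfam (p : euclid R k -> probability (euclid R d) R) :=
  forall eta, natural_range eta -> forall A, measurable A ->
    p eta A = (\int[base_measure K]_(x in S `&` A) (expfam_density eta x)%:E)%E.

Definition mean_stat (P : probability (euclid R d) R) : 'cV[R]_k :=
  \col_j \int[P]_(x in S) tnth (T x) j.

Definition cov_stat (P : probability (euclid R d) R) : 'M[R]_k :=
  \matrix_(i, j) \int[P]_(x in S)
    ((vec (T x) - mean_stat P) *m (vec (T x) - mean_stat P)^T) i j.

End exponential_family.

Section differential_privacy.
Context (R : realType) (d d' : measure_display).
Context (X : measurableType d) (Y : measurableType d') (n : nat).

Definition datasets (S : set X) : set (n.-tuple X) :=
  [set x | forall i, S (tnth x i)].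

Definition neighbours (x x' : n.-tuple X) :=
  exists i, tnth x i <> tnth x' i /\
    forall j, j != i -> tnth x j = tnth x' j.

(* A randomized algorithm on S^n is a probability kernel on the ambient space,
   of which only the restriction to S^n is constrained or used. *)
Definition dp (eps delta : R) (S : set X) (M : R.-pker (n.-tuple X) ~> Y) :=
  forall x x', datasets S x -> datasets S x' -> neighbours x x' ->
    forall A, measurable A ->
      (M x A <= (expR eps)%:E * M x' A + delta%:E)%E.

Definition replace (x : n.-tuple X) (i : 'I_n) (x' : X) : n.-tuple X :=
  [tuple if j == i then x' else tnth x j | j < n].

End differential_privacy.

Section fingerprint.
Context (R : realType) (d k n : nat) (eta1 eta2 : euclid R k).

Definition range_vec : 'cV[R]_k := vec eta2 - vec eta1.

Definition midpoint : 'cV[R]_k := 2^-1 *: (vec eta1 + vec eta2).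

Definition centered_box : set (euclid R k) :=
  [set y | forall j, - (range_vec j ord0 / 2) <= tnth y j <= range_vec j ord0 / 2].

(* s, for the parameter eta and the output y of the mechanism. *)
Definition svec (eta y : euclid R k) : 'cV[R]_k :=
  \col_j ((range_vec j ord0 ^+ 2 / 4 - (tnth eta j - midpoint j ord0) ^+ 2) *
          (tnth y j - (tnth eta j - midpoint j ord0))).

Variables (S : set (euclid R d)) (T : euclid R d -> euclid R k)
  (p : euclid R k -> probability (euclid R d) R)
  (M : R.-pker (n.-tuple (euclid R d)) ~> (euclid R k)).

Definition mean_sq_error (eta : euclid R k) : \bar R :=
  (\int[iid n (p eta)]_x \int[M x]_y
     (norm2 (vec y - (vec eta - midpoint)) ^+ 2)%:E)%E.

(* E_{X_{~i}, M}[s^T Sigma_T s], where X_{~i} is built from X ~ p_eta^n and an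
   independent X_i' ~ p_eta. *)
Definition quad_form_mean (i : 'I_n) (eta : euclid R k) : \bar R :=
  (\int[(iid n (p eta) \x p eta)]_xx' \int[M (replace xx'.1 i xx'.2)]_y
     (((svec eta y)^T *m cov_stat S T (p eta) *m svec eta y) ord0 ord0)%:E)%E.

Definition tail_prob (i : 'I_n) (eta : euclid R k) (t : R) : \bar R :=
  iid n (p eta) [set x | datasets S x /\
    norm2 (vec (T (tnth x i)) - mean_stat S T (p eta)) >
      4 * t / (normoo range_vec ^+ 3 * Num.sqrt k%:R)].

End fingerprint.

(* Main.v *)
(* On the box, p_eta is the law at the centre m reweighted by exp(<eta - m, T>)
   up to a constant, so the derivative of E_eta[M_j] in eta_j is the covariance
   of M_j with sum_i T_j(X_i).  Weighting it by R_j^2/4 - (eta_j - m_j)^2, which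
   vanishes at the ends of I_j, and integrating by parts over eta_j turns it into
   E[2 (eta_j - m_j) M_j]; by accuracy these add up to at least
   |R|^2/12 - alpha^2 >= |R|^2/24.  Conversely the weighted covariance is the
   sum over i of E<s(M(X)), T(X_i) - mu>.  Privacy allows M(X) to be replaced by
   M(X_{~i}), which is independent of X_i, so that the main term vanishes; the
   cost is 2 eps times the first absolute moment, at most
   sqrt(E[s^T Sigma s]) by Jensen's inequality, plus 2 delta t0 and a tail above
   t0.

   Integrability of T and T^2 and differentiability in eta hold only inside the
   box, so the correlation is estimated on a box shrunk by a factor 1 - tau, and
   tau tends to 0 at the end. *)

From HB Require Import structures.
Require Import Defs.
From mathcomp Require Import all_boot all_order all_algebra.
From mathcomp Require Import all_classical all_reals all_analysis.
From mathcomp Require Import measurable_realfun ring lra.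

Set Implicit Arguments.
Unset Strict Implicit.
Unset Printing Implicit Defensive.

Import Order.TTheory GRing.Theory Num.Theory.
Import numFieldNormedType.Exports.

Local Open Scope classical_set_scope.
Local Open Scope ring_scope.

(** * Integrals *)

Section nonmeasurable_integrands.
Local Open Scope ereal_scope.
Context (R : realType) (d : measure_display) (T : measurableType d).
Variable mu : {measure set T -> \bar R}.
Import HBNNSimple.

Lemma ge0_le_integral_subset (D E : set T) (f g : T -> \bar R) : D `<=` E ->
  (forall x, D x -> 0 <= f x) -> (forall x, E x -> 0 <= g x) ->
  (forall x, D x -> f x <= g x) ->
  \int[mu]_(x in D) f x <= \int[mu]_(x in E) g x.
Proof.
move=> DE f0 g0 fg; rewrite !ge0_integralE//; apply: ub_ereal_sup => _ [/= h hf <-].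
apply: ereal_sup_ubound => /=; exists h => // x.
apply: le_trans (hf x) _; rewrite !patchE.
case: ifPn => [/set_mem Dx|_]; first by rewrite mem_set ?fg//; exact: DE.
by case: ifPn => // /set_mem; exact: g0.
Qed.

(* [g] need not be measurable: it dominates the measurable function
   [(f - h)^+ / a]. *)
Lemma ge0_le_integralD_nonmeasurable (D : set T) (f h : T -> R) (g : T -> \bar R)
    (a : R) : (0 <= a)%R -> measurable D ->
  measurable_fun D f -> measurable_fun D h ->
  (forall x, D x -> 0 <= h x)%R -> (forall x, D x -> 0 <= g x) ->
  (forall x, D x -> (f x)%:E <= (h x)%:E + a%:E * g x) ->
  \int[mu]_(x in D) (f x)%:E <=
    \int[mu]_(x in D) (h x)%:E + a%:E * \int[mu]_(x in D) g x.
Proof.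
move=> a0 mD mf mh h0 g0 fhg; pose e x := Num.max (f x - h x)%R 0%R.
have e0 x : (0 <= e x)%R by rewrite le_max lexx orbT.
have me : measurable_fun D e by apply: measurable_maxr => //; exact: measurable_funB.
have eg x : D x -> (e x)%:E <= a%:E * g x.
  move=> Dx; rewrite EFin_max ge_max EFinB leeBlDr//.
  by rewrite addeC fhg//= mule_ge0 ?lee_fin ?g0.
have fhe x : D x -> (f x)%:E <= (h x)%:E + (e x)%:E.
  by move=> _; rewrite -EFinD lee_fin -lerBlDl /e le_max lexx.
have he0 x : D x -> 0 <= (h x)%:E + (e x)%:E.
  by move=> Dx; rewrite adde_ge0 ?lee_fin ?h0.
apply: (@le_trans _ _ (\int[mu]_(x in D) ((h x)%:E + (e x)%:E))).
  rewrite integralE; apply: (@le_trans _ _ (\int[mu]_(x in D) ((EFin \o f)^\+ x))%E).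
    by rewrite -[leRHS]adde0 leeD2l// oppe_le0 integral_ge0.
  apply: ge0_le_integral_subset => // x Dx.
  by rewrite funeposE ge_max fhe//= he0.
rewrite ge0_integralD//; last 3 first.
- exact/measurable_EFinP.
- by move=> x _; rewrite lee_fin.
- exact/measurable_EFinP.
apply: leeD2l; have [a00|an0] := eqVneq a 0%R.
  rewrite a00 mul0e integral0_eq// => x Dx; apply/le_anti.
  by have := eg _ Dx; rewrite a00 mul0e !lee_fin e0 andbT.
have a_gt0 : (0 < a)%R by rewrite lt_neqAle eq_sym an0.
rewrite -lee_pdivrMl// -ge0_integralZl//; last 3 first.
- exact/measurable_EFinP.
- by move=> x _; rewrite lee_fin.
- by rewrite lee_fin invr_ge0.
apply: ge0_le_integral_subset => // x Dx.
  by rewrite mule_ge0// lee_fin ?invr_ge0.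
by rewrite lee_pdivrMl// eg.
Qed.

End nonmeasurable_integrands.

Section density.
Local Open Scope ereal_scope.
Context (R : realType) (d : measure_display) (T : measurableType d).
Variables (mu P : {measure set T -> \bar R}) (rho : T -> R).
Hypotheses (mrho : measurable_fun setT rho) (rho_ge0 : forall x, (0 <= rho x)%R)
  (PE : forall A, measurable A -> P A = \int[mu]_(x in A) (rho x)%:E).
Import HBNNSimple.

Let mrhoE : measurable_fun setT (EFin \o rho).
Proof. exact/measurable_EFinP. Qed.

Lemma integral_density_nnsfun (h : {nnsfun T >-> R}) :
  \int[P]_x (h x)%:E = \int[mu]_x ((h x)%:E * (rho x)%:E).
Proof.
have mterm r : measurable_fun setT (fun x => (r * \1_(h @^-1` [set r]) x)%:E).
  by apply/measurable_EFinP; exact: measurableT_comp.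
have term_ge0 r x : 0 <= (r * \1_(h @^-1` [set r]) x)%:E.
  by rewrite EFinM nnfun_muleindic_ge0.
under [LHS]eq_integral do rewrite fimfunE -fsumEFin//.
under [RHS]eq_integral do rewrite fimfunE -fsumEFin// muleC ge0_mule_fsumr//.
rewrite [LHS]ge0_integral_fsum// [RHS]ge0_integral_fsum//; last 2 first.
- by move=> r; exact: emeasurable_funM.
- by move=> r x _; rewrite mule_ge0// lee_fin.
apply: eq_fsbigr => r _; rewrite integralZl_indic_nnsfun//.
have [r0|r0] := ltP r 0%R.
  by rewrite preimage_nnfun0// integral0_eq ?mule0 ?integral0_eq// => x _;
    rewrite indicE in_set0 ?mulr0 ?mule0.
rewrite integral_indic// setIT PE//.
under [RHS]eq_integral do rewrite EFinM muleCA.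
rewrite ge0_integralZl//; last 2 first.
- by apply: emeasurable_funM => //; exact/measurable_EFinP.
- by move=> x _; rewrite mule_ge0// lee_fin.
congr (_ * _); rewrite integral_mkcond; apply: eq_integral => x _.
by rewrite patchE indicE; case: ifPn => _; rewrite ?mule1 ?mule0.
Qed.

Lemma ge0_integral_density (f : T -> \bar R) :
  measurable_fun setT f -> (forall x, 0 <= f x) ->
  \int[P]_x f x = \int[mu]_x (f x * (rho x)%:E).
Proof.
move=> mf f0; pose f_ := nnsfun_approx measurableT mf.
have f_cvg x : (f_ n x)%:E @[n --> \oo] --> f x by exact: cvg_nnsfun_approx.
have f_nd x : {homo (fun n => f_ n x) : n m / (n <= m)%N >-> (n <= m)%R}.
  by move=> n m nm; exact/lefP/nd_nnsfun_approx.
transitivity (lim (\int[P]_x (f_ n x)%:E @[n --> \oo])).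
  rewrite -monotone_convergence//=.
  - by apply: eq_integral => x _; apply/esym/cvg_lim.
  - by move=> n; exact/measurable_EFinP/measurable_funTS.
  - by move=> n ? _; rewrite lee_fin.
  - by move=> x _ n m nm; rewrite lee_fin f_nd.
under eq_fun do rewrite integral_density_nnsfun.
rewrite -monotone_convergence//=.
- by apply: eq_integral => x _; apply/cvg_lim => //; exact: cvgeZr.
- move=> n; apply: emeasurable_funM => //.
  exact/measurable_EFinP/measurable_funTS.
- by move=> n ? _; rewrite mule_ge0// lee_fin.
- by move=> x _ n m nm; rewrite lee_wpmul2r ?lee_fin// f_nd.
Qed.

End density.

Section real_integrals.
Context (R : realType) (d : measure_display) (T : measurableType d)
  (mu : {measure set T -> \bar R}).
Implicit Types f g : T -> R.

Lemma le_integrableR f g : measurable_fun setT f -> (forall x, `|f x| <= g x) ->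
  mu.-integrable setT (EFin \o g) -> mu.-integrable setT (EFin \o f).
Proof.
move=> mf fg; apply: le_integrable => //; first exact/measurable_EFinP.
by move=> x _ /=; rewrite lee_fin (le_trans (fg x))// ler_norm.
Qed.

Lemma integrableZR (c : R) f : mu.-integrable setT (EFin \o f) ->
  mu.-integrable setT (EFin \o (fun x => c * f x)).
Proof. by move=> fi; exact: (integrableZl measurableT c fi). Qed.

Lemma integrableDR f g : mu.-integrable setT (EFin \o f) ->
  mu.-integrable setT (EFin \o g) ->
  mu.-integrable setT (EFin \o (fun x => f x + g x)).
Proof. by move=> fi gi; exact: (integrableD measurableT fi gi). Qed.

Lemma integrableBR f g : mu.-integrable setT (EFin \o f) ->
  mu.-integrable setT (EFin \o g) ->
  mu.-integrable setT (EFin \o (fun x => f x - g x)).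
Proof. by move=> fi gi; exact: (integrableB measurableT fi gi). Qed.

Lemma integrableMR_bounded f g (c : R) : measurable_fun setT g ->
  (forall x, `|g x| <= c) -> mu.-integrable setT (EFin \o f) ->
  mu.-integrable setT (EFin \o (fun x => g x * f x)).
Proof.
move=> mg gc fi; apply: le_integrableR (integrableZR c (integrable_norm fi)).
  by apply: measurable_funM => //; apply/measurable_EFinP; exact: measurable_int fi.
by move=> x; rewrite normrM ler_wpM2r.
Qed.

Lemma integrable_sumR (I : finType) (D : set T) (f : I -> T -> R) : measurable D ->
  (forall j, mu.-integrable D (EFin \o f j)) ->
  mu.-integrable D (EFin \o (fun x => \sum_j f j x)).
Proof.
move=> mD fi; have := integrable_sum mD (P := xpredT) (index_enum I) (fun j _ => fi j).
by apply: eq_integrable => // x _; rewrite /= sumEFin.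
Qed.

Lemma Rintegral_sum (I : finType) (D : set T) (f : I -> T -> R) : measurable D ->
  (forall j, mu.-integrable D (EFin \o f j)) ->
  \int[mu]_(x in D) (\sum_j f j x) = \sum_j \int[mu]_(x in D) f j x.
Proof.
move=> mD fi; rewrite /Rintegral.
under eq_integral do rewrite -sumEFin.
rewrite integral_sum// [RHS]sum_fine// => j _.
exact: (integrable_fin_num _ (fi j)).
Qed.

Lemma Rintegral_sumMr (I : finType) (f : I -> T -> R) (c : I -> R) :
  (forall j, mu.-integrable setT (EFin \o f j)) ->
  \int[mu]_x (\sum_j f j x * c j) = \sum_j (\int[mu]_x f j x) * c j.
Proof.
move=> fi; rewrite Rintegral_sum// => [|j].
  by apply: eq_bigr => j _; rewrite RintegralZr.
by apply: eq_integrable (integrableZR (c j) (fi j)) => // x _ /=; rewrite mulrC.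
Qed.

Lemma EFin_Rintegral f : mu.-integrable setT (EFin \o f) ->
  (\int[mu]_x f x)%:E = (\int[mu]_x (f x)%:E)%E.
Proof. by move=> fi; rewrite /Rintegral fineK//; exact: (integrable_fin_num _ fi). Qed.

Lemma eq_integral_conull (D : set T) (f g : T -> \bar R) :
  measurable D -> mu (~` D) = 0%E -> measurable_fun setT f ->
  measurable_fun setT g -> (forall x, D x -> f x = g x) ->
  (\int[mu]_x f x = \int[mu]_x g x)%E.
Proof.
move=> mD D0 mf mg fg; apply: ae_eq_integral => //.
exists (~` D); split => //; first exact: measurableC.
by move=> x /= + Dx; apply => _; exact: fg.
Qed.

Lemma le_Rintegral_conull (D : set T) f g : measurable D -> mu (~` D) = 0%E ->
  mu.-integrable setT (EFin \o f) -> mu.-integrable setT (EFin \o g) ->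
  (forall x, D x -> f x <= g x) -> \int[mu]_x f x <= \int[mu]_x g x.
Proof.
move=> mD D0 fi gi fg; have mCD : measurable (~` D) by exact: measurableC.
rewrite /Rintegral (negligible_integral mCD measurableT fi D0).
rewrite (negligible_integral mCD measurableT gi D0) setTD setCK.
by apply: le_Rintegral => //; [exact: integrableS fi|exact: integrableS gi].
Qed.

End real_integrals.

Lemma bounded_integrableR (R : realType) (d : measure_display) (T : measurableType d)
    (mu : {measure set T -> \bar R}) (D : set T) (f : T -> R) (c : R) :
  measurable D -> (mu D < +oo)%E -> measurable_fun D f ->
  (forall x, D x -> `|f x| <= c) -> mu.-integrable D (EFin \o f).
Proof.
move=> mD muD mf fc; apply: measurable_bounded_integrable => //.
exists c; split; first exact: num_real.
by move=> M cM x Dx; exact: le_trans (fc x Dx) (ltW cM).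
Qed.

Lemma measurable_sqrt (R : realType) : measurable_fun setT (@Num.sqrt R).
Proof. by apply: continuous_measurable_fun; exact: sqrt_continuous. Qed.

Section probability_integrals.
Context (R : realType) (d : measure_display) (T : measurableType d).
Variable P : probability T R.
Implicit Types f : T -> R.

Lemma integral_prob_cst (c : \bar R) : (\int[P]_x c = c)%E.
Proof. by rewrite integral_cst// [X in (_ * X)%E]probability_setT mule1. Qed.

Lemma prob_Rintegral_cst (c : R) : \int[P]_x c = c.
Proof. by rewrite /Rintegral integral_prob_cst. Qed.

Lemma prob_integrable_cst (c : R) : P.-integrable setT (EFin \o cst c).
Proof. exact: finite_measure_integrable_cst. Qed.

Lemma prob_Rintegral_affine (a b : R) f : P.-integrable setT (EFin \o f) ->
  \int[P]_x (a + b * f x) = a + b * \int[P]_x f x.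
Proof.
move=> fi; have bfi := integrableZR b fi.
rewrite (RintegralD measurableT (prob_integrable_cst a) bfi).
by rewrite prob_Rintegral_cst RintegralZl.
Qed.

Lemma prob_lty (A : set T) : measurable A -> (P A < +oo)%E.
Proof. by move=> mA; rewrite (le_lt_trans (probability_le1 P mA))// ltry. Qed.

Lemma prob_integral_affine_le (D : set T) f (a b : R) : measurable D ->
  measurable_fun setT f -> (forall x, 0 <= f x) -> 0 <= a -> 0 <= b ->
  (\int[P]_(x in D) (a + b * f x)%:E <= a%:E + b%:E * \int[P]_(x in D) (f x)%:E)%E.
Proof.
move=> mD mf f0 a0 b0.
have mfE : measurable_fun D (EFin \o f) by apply: measurable_funTS; exact/measurable_EFinP.
under eq_integral do rewrite EFinD EFinM.
rewrite ge0_integralD//; last 2 first.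
- by move=> x _; rewrite mule_ge0// lee_fin.
- exact: emeasurable_funM.
rewrite ge0_integralZl//; last by move=> x _; rewrite lee_fin.
rewrite leeD2r// integral_cst// -[leRHS]mule1 lee_wpmul2l ?lee_fin//.
exact: probability_le1.
Qed.

Lemma prob_bounded_integrable f (c : R) : measurable_fun setT f ->
  (forall x, `|f x| <= c) -> P.-integrable setT (EFin \o f).
Proof. by move=> mf fc; apply: (bounded_integrableR (c := c)) => //; exact: prob_lty. Qed.

Lemma prob_bounded_Rintegral f (c : R) : measurable_fun setT f ->
  (forall x, `|f x| <= c) -> `|\int[P]_x f x| <= c.
Proof.
move=> mf fc; have fi := prob_bounded_integrable mf fc.
apply: le_trans (le_normr_Rintegral measurableT fi) _.
rewrite -[leRHS]prob_Rintegral_cst; apply: le_Rintegral => //.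
- exact: integrable_norm.
- exact: prob_integrable_cst.
Qed.

Lemma prob_conull (A : set T) : measurable A -> P (~` A) = 0%E <-> P A = 1%E.
Proof.
move=> mA; rewrite probability_setC//; split=> [|->]; last by rewrite subee.
by move=> /eqP; rewrite sube_eq ?add0e// => /eqP <-.
Qed.

Lemma prob_Rintegral_le_sqrt f : P.-integrable setT (EFin \o f) ->
  P.-integrable setT (EFin \o (fun x => f x ^+ 2)) ->
  \int[P]_x f x <= Num.sqrt (\int[P]_x f x ^+ 2).
Proof.
move=> fi f2i; set c := \int[P]_x f x.
have cfi := integrableZR (2 * c) fi.
suff c2 : c ^+ 2 <= \int[P]_x f x ^+ 2.
  by rewrite (le_trans (ler_norm c))// -sqrtr_sqr ler_wsqrtr.
have : 0 <= \int[P]_x (f x - c) ^+ 2 by apply: Rintegral_ge0 => x _; exact: sqr_ge0.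
have -> : \int[P]_x (f x - c) ^+ 2 = \int[P]_x (f x ^+ 2 - 2 * c * f x + c ^+ 2).
  by apply: eq_Rintegral => x _; ring.
rewrite RintegralD//; [|exact: integrableBR|exact: prob_integrable_cst].
by rewrite RintegralB// RintegralZl// prob_Rintegral_cst -/c; lra.
Qed.

Lemma prob_integrable_sqrt f : (forall x, 0 <= f x) ->
  P.-integrable setT (EFin \o f) ->
  P.-integrable setT (EFin \o (fun x => Num.sqrt (f x))).
Proof.
move=> f0 fi; apply: le_integrableR (integrableDR (prob_integrable_cst 1) fi).
  apply: (measurableT_comp (@measurable_sqrt R)).
  by apply/measurable_EFinP; exact: measurable_int fi.
move=> x /=; rewrite ger0_norm ?sqrtr_ge0//.
have := sqr_sqrtr (f0 x); have := sqr_ge0 (Num.sqrt (f x) - 2^-1); lra.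
Qed.

Lemma prob_Rintegral_sqrt_le f : (forall x, 0 <= f x) ->
  P.-integrable setT (EFin \o f) ->
  \int[P]_x Num.sqrt (f x) <= Num.sqrt (\int[P]_x f x).
Proof.
move=> f0 fi; have sqrE x : Num.sqrt (f x) ^+ 2 = f x by exact: sqr_sqrtr.
apply: le_trans (prob_Rintegral_le_sqrt (prob_integrable_sqrt f0 fi) _) _.
  by apply: (eq_integrable measurableT) fi => x _ /=; rewrite sqrE.
by under eq_Rintegral do rewrite sqrE.
Qed.

Lemma Rintegral_centered_mul (f g : T -> R) (a : R) : P.-integrable setT (EFin \o f) ->
  P.-integrable setT (EFin \o g) -> P.-integrable setT (EFin \o (fun x => f x * g x)) ->
  \int[P]_x ((f x - a) * (g x - \int[P]_y g y)) =
  \int[P]_x (f x * g x) - (\int[P]_x f x) * \int[P]_x g x.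
Proof.
move=> fi gi fgi; set b := \int[P]_y g y.
have -> : \int[P]_x ((f x - a) * (g x - b)) =
    \int[P]_x (f x * g x - b * f x - (a * g x - a * b)).
  by apply: eq_Rintegral => x _; ring.
have bfi := integrableZR b fi; have agi := integrableZR a gi.
have ci := prob_integrable_cst (a * b).
rewrite RintegralB//; [|exact: integrableBR..].
by rewrite RintegralB// RintegralB// prob_Rintegral_cst !RintegralZl// -/b; ring.
Qed.

End probability_integrals.

(** * Laws and densities *)

Section laws.
Local Open Scope ereal_scope.
Context (R : realType) (d d' : measure_display) (T : measurableType d)
  (T' : measurableType d').

Definition has_law (P : {measure set T -> \bar R}) (Q : {measure set T' -> \bar R})
    (phi : T' -> T) :=
  measurable_fun setT phi /\
  forall f : T -> \bar R, measurable_fun setT f -> (forall x, 0 <= f x) ->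
    \int[P]_x f x = \int[Q]_x f (phi x).

Definition has_density (P Q : {measure set T -> \bar R}) (q : T -> R) :=
  [/\ measurable_fun setT q, forall x, (0 <= q x)%R &
  forall f : T -> \bar R, measurable_fun setT f -> (forall x, 0 <= f x) ->
    \int[P]_x f x = \int[Q]_x (f x * (q x)%:E)].

End laws.

Section weighted_transfer.
Local Open Scope ereal_scope.
Context (R : realType) (d d' : measure_display) (T : measurableType d)
  (T' : measurableType d').
Variables (P : {measure set T -> \bar R}) (Q : {measure set T' -> \bar R})
  (phi : T' -> T) (q : T' -> R).
Hypotheses (mphi : measurable_fun setT phi) (mq : measurable_fun setT q)
  (q0 : forall x, (0 <= q x)%R).
Hypothesis PQ : forall f : T -> \bar R, measurable_fun setT f ->
  (forall x, 0 <= f x) -> \int[P]_x f x = \int[Q]_x (f (phi x) * (q x)%:E).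

Let integral_transfer (f : T -> \bar R) : measurable_fun setT f ->
  \int[P]_x f x = \int[Q]_x (f (phi x) * (q x)%:E).
Proof.
move=> mf; rewrite integralE [RHS]integralE; congr (_ - _).
- rewrite PQ//; last exact: measurable_funepos.
  by apply: eq_integral => x _; rewrite !funeposE maxe_pMl ?lee_fin// mul0e.
- rewrite PQ//; last exact: measurable_funeneg.
  by apply: eq_integral => x _; rewrite !funenegE maxe_pMl ?lee_fin// mul0e mulNe.
Qed.

Lemma Rintegral_transfer (f : T -> R) : measurable_fun setT f ->
  (\int[P]_x f x = \int[Q]_x (f (phi x) * q x))%R.
Proof.
by move=> mf; rewrite /Rintegral integral_transfer//; exact/measurable_EFinP.
Qed.

Lemma integrable_transfer (f : T -> R) : measurable_fun setT f ->
  P.-integrable setT (EFin \o f) <->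
  Q.-integrable setT (EFin \o (fun x => f (phi x) * q x)%R).
Proof.
move=> mf.
have absE : \int[P]_x `|(f x)%:E| = \int[Q]_x `|(f (phi x) * q x)%:E|.
  rewrite PQ//; last by apply: measurableT_comp => //; exact/measurable_EFinP.
  by apply: eq_integral => x _; rewrite EFinM abseM [X in _ = _ * X]gee0_abs ?lee_fin.
split=> /integrableP[_ fi]; apply/integrableP; split.
- apply/measurable_EFinP; apply: measurable_funM => //.
  exact: measurableT_comp.
- by rewrite -absE.
- exact/measurable_EFinP.
- by rewrite absE.
Qed.

End weighted_transfer.

Section density_integrals.
Context (R : realType) (d : measure_display) (T : measurableType d).
Variables (P Q : {measure set T -> \bar R}) (q : T -> R).
Hypothesis Pq : has_density P Q q.

Lemma density_integrable (f : T -> R) : measurable_fun setT f ->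
  P.-integrable setT (EFin \o f) <->
  Q.-integrable setT (EFin \o (fun x => f x * q x)).
Proof. by case: Pq => mq q0 PQ; exact: (integrable_transfer (phi := id)). Qed.

Lemma density_Rintegral (f : T -> R) : measurable_fun setT f ->
  \int[P]_x f x = \int[Q]_x (f x * q x).
Proof. by case: Pq => mq q0 PQ; exact: (Rintegral_transfer (phi := id)). Qed.

End density_integrals.

Section probability_density.
Context (R : realType) (d : measure_display) (T : measurableType d).
Variables (P : probability T R) (Q : {measure set T -> \bar R}) (q : T -> R).
Hypothesis Pq : has_density P Q q.

Lemma density_total_integrable : Q.-integrable setT (EFin \o q).
Proof.
have := (density_integrable Pq (measurable_cst (1 : R))).1 (prob_integrable_cst P 1).
by apply: eq_integrable => // x _; rewrite /= mul1r.
Qed.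

Lemma density_total : \int[Q]_x q x = 1.
Proof.
have := density_Rintegral Pq (measurable_cst (1 : R)).
by rewrite (prob_Rintegral_cst P) => ->; apply: eq_Rintegral => x _; rewrite mul1r.
Qed.

End probability_density.

Lemma density_ratio (R : realType) (d : measure_display) (T : measurableType d)
    (P Q mu : {measure set T -> \bar R}) (rho w : T -> R) :
  measurable_fun setT w -> (forall x, 0 <= w x) -> has_density Q mu rho ->
  has_density P mu (fun x => w x * rho x) -> has_density P Q w.
Proof.
move=> mw w0 [mrho rho0 QE] [_ _ PE]; split=> // f mf f0.
rewrite PE// QE => [||x].
- by apply: eq_integral => x _; rewrite EFinM muleA.
- by apply: emeasurable_funM => //; exact/measurable_EFinP.
- by rewrite mule_ge0// lee_fin.
Qed.

Section law_integrals.
Context (R : realType) (d d' : measure_display) (T : measurableType d)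
  (T' : measurableType d').
Variables (P : {measure set T -> \bar R}) (Q : {measure set T' -> \bar R})
  (phi : T' -> T).
Hypothesis Pphi : has_law P Q phi.

Lemma law_ge0_integral (f : T -> \bar R) : measurable_fun setT f ->
  (forall x, 0 <= f x)%E -> (\int[P]_x f x = \int[Q]_x f (phi x))%E.
Proof. by case: Pphi => _; apply. Qed.

Let weighted (f : T -> \bar R) : measurable_fun setT f -> (forall x, 0 <= f x)%E ->
  (\int[P]_x f x = \int[Q]_x (f (phi x) * (cst (1 : R) x)%:E))%E.
Proof.
move=> mf f0; rewrite law_ge0_integral//.
by apply: eq_integral => x _; rewrite mule1.
Qed.

Lemma law_integrable (f : T -> R) : measurable_fun setT f ->
  P.-integrable setT (EFin \o f) <->
  Q.-integrable setT (EFin \o (fun x => f (phi x))).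
Proof.
case: Pphi => mphi _ mf.
have -> : (fun x => f (phi x)) = (fun x => f (phi x) * cst 1 x).
  by apply/funext => x; rewrite mulr1.
exact: integrable_transfer.
Qed.

Lemma law_Rintegral (f : T -> R) : measurable_fun setT f ->
  \int[P]_x f x = \int[Q]_x f (phi x).
Proof.
move=> mf; rewrite (Rintegral_transfer (q := cst 1) (fun=> ler01) weighted)//.
by apply: eq_Rintegral => x _; rewrite mulr1.
Qed.

Lemma law_preimage (A : set T) : measurable A -> P A = Q (phi @^-1` A).
Proof.
case: Pphi => mphi _ mA.
have mpA : measurable (phi @^-1` A) by rewrite -[X in measurable X]setTI; exact: mphi.
transitivity (\int[P]_x (\1_A x)%:E)%E; first by rewrite integral_indic// setIT.
rewrite law_ge0_integral => [||x]; last by rewrite lee_fin.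
  by rewrite (integral_indic Q measurableT mpA) setIT.
by apply/measurable_EFinP; exact: measurable_indic.
Qed.

End law_integrals.

Lemma measure_bigsetU_le (R : realType) (d : measure_display)
    (T : measurableType d) (mu : {measure set T -> \bar R}) (I : finType)
    (A : I -> set T) : (forall i, measurable (A i)) ->
  (mu (\big[setU/set0]_i A i) <= \sum_i mu (A i))%E.
Proof.
move=> mA; suff [] : measurable (\big[setU/set0]_i A i) /\
  (mu (\big[setU/set0]_i A i) <= \sum_i mu (A i))%E by [].
elim/big_rec2: _ => [|i a U _ [mU Ua]]; first by rewrite measure0.
split; first exact: measurableU.
by rewrite (le_trans (measureU2 _ _ _))// leeD2l.
Qed.

(** * Product probabilities *)

Section product_with_probability.
Context (R : realType) (d d' : measure_display) (X : measurableType d)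
  (Y : measurableType d') (P : probability X R) (Q : probability Y R).

Lemma law_fst : has_law P (P \x Q)%E fst.
Proof.
split=> // f mf f0; rewrite fubini_tonelli1//; last exact: measurableT_comp.
by apply: eq_integral => x _; rewrite /fubini_F/= integral_prob_cst.
Qed.

Lemma law_snd : has_law Q (P \x Q)%E snd.
Proof.
split=> // f mf f0; rewrite fubini_tonelli1//; last exact: measurableT_comp.
by rewrite /fubini_F/= integral_prob_cst.
Qed.

Lemma product_conull A B : measurable A -> measurable B ->
  P (~` A) = 0%E -> Q (~` B) = 0%E -> (P \x Q)%E (~` (A `*` B)) = 0%E.
Proof.
move=> mA mB /(prob_conull P mA) PA /(prob_conull Q mB) QB.
apply/(prob_conull (P \x Q)%E); first exact: measurableX.
by rewrite [LHS]product_measure1E// [X in (X * _)%E]PA [X in (_ * X)%E]QB mule1.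
Qed.

Lemma integrable_productM (u : X -> R) (v : Y -> R) (c : R) :
  measurable_fun setT u -> (forall x, `|u x| <= c) ->
  Q.-integrable setT (EFin \o v) ->
  (P \x Q)%E.-integrable setT (EFin \o (fun z => u z.1 * v z.2)).
Proof.
move=> mu_ uc vi; apply: integrableMR_bounded => [|z|].
- exact: measurableT_comp.
- exact: uc.
- by apply/(law_integrable law_snd) => //; apply/measurable_EFinP; exact: measurable_int vi.
Qed.

Lemma Rintegral_productM (u : X -> R) (v : Y -> R) (c : R) :
  measurable_fun setT u -> (forall x, `|u x| <= c) ->
  Q.-integrable setT (EFin \o v) ->
  \int[(P \x Q)%E]_z (u z.1 * v z.2) = (\int[P]_x u x) * \int[Q]_y v y.
Proof.
move=> mu_ uc vi; rewrite /Rintegral.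
rewrite -(integral12_prod_meas1 (integrable_productM mu_ uc vi)).
rewrite -[RHS]RintegralZr//; last exact: prob_bounded_integrable uc.
rewrite /Rintegral; congr fine; apply: eq_integral => x _; rewrite /fubini_F/=.
under eq_integral do rewrite EFinM.
by rewrite integralZl// EFinM EFin_Rintegral.
Qed.

Section separable_sum.
Variables (I : finType) (u : I -> X -> R) (v : I -> Y -> R) (c : R).
Hypotheses (mu : forall j, measurable_fun setT (u j))
  (uc : forall j x, `|u j x| <= c)
  (vi : forall j, Q.-integrable setT (EFin \o v j)).

Lemma integrable_product_sumM :
  (P \x Q)%E.-integrable setT (EFin \o (fun z => \sum_j u j z.1 * v j z.2)).
Proof.
by apply: integrable_sumR => // j; exact: integrable_productM (mu j) (uc j) (vi j).
Qed.

Lemma Rintegral_product_sumM : \int[(P \x Q)%E]_z (\sum_j u j z.1 * v j z.2) =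
  \sum_j (\int[P]_x u j x) * \int[Q]_y v j y.
Proof.
rewrite Rintegral_sum// => [|j]; last exact: integrable_productM (mu j) (uc j) (vi j).
by apply: eq_bigr => j _; exact: Rintegral_productM (mu j) (uc j) (vi j).
Qed.

End separable_sum.

End product_with_probability.

Section replace_entry.
Context (d : measure_display) (T : measurableType d).

Lemma measurable_replace n (i : 'I_n) :
  measurable_fun setT (fun z : n.-tuple T * T => replace z.1 i z.2).
Proof.
apply/measurable_fun_tnthP => j.
rewrite [X in measurable_fun _ X](_ : _ =
   (fun z : n.-tuple T * T => if j == i then z.2 else tnth z.1 j)); last first.
  by apply/funext => z /=; rewrite tnth_mktuple.
case: (j == i); first exact: measurable_snd.
exact: (measurableT_comp (measurable_tnth j) measurable_fst).
Qed.

Lemma measurable_replace_entry n (i : 'I_n) (x : n.-tuple T) :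
  measurable_fun setT (replace x i).
Proof. exact: (measurableT_comp (measurable_replace i) (pair1_measurable x)). Qed.

Lemma tnth_replace n (x : n.-tuple T) i y j :
  tnth (replace x i y) j = if j == i then y else tnth x j.
Proof. exact: tnth_mktuple. Qed.

Lemma tnth_replace_same n (x : n.-tuple T) i y : tnth (replace x i y) i = y.
Proof. by rewrite tnth_replace eqxx. Qed.

Lemma replace_tnth n (x : n.-tuple T) i : replace x i (tnth x i) = x.
Proof.
by apply: eq_from_tnth => j; rewrite tnth_replace; case: eqVneq => // ->.
Qed.

Lemma replace_replace n (x : n.-tuple T) i y z :
  replace (replace x i y) i z = replace x i z.
Proof.
by apply: eq_from_tnth => j; rewrite !tnth_replace; case: eqP.
Qed.

Lemma replace_cons0 n (x : T) (xs : n.-tuple T) y :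
  replace (cons_tuple x xs) ord0 y = cons_tuple y xs.
Proof.
apply: eq_from_tnth => j; rewrite tnth_replace.
by case: (unliftP ord0 j) => [l ->|->]//=; rewrite !tnthS.
Qed.

Lemma replace_consS n (x : T) (xs : n.-tuple T) i y :
  replace (cons_tuple x xs) (lift ord0 i) y = cons_tuple x (replace xs i y).
Proof.
apply: eq_from_tnth => j; rewrite tnth_replace.
case: (unliftP ord0 j) => [l ->|->]//=.
by rewrite !tnthS tnth_replace (inj_eq lift_inj).
Qed.

Lemma datasets_replace n (S : set T) (x : n.-tuple T) i y :
  datasets S x -> S y -> datasets S (replace x i y).
Proof. by move=> Sx Sy j; rewrite tnth_replace; case: ifP. Qed.

Definition swap_entry n (i : 'I_n) (z : n.-tuple T * T) :=
  (replace z.1 i z.2, tnth z.1 i).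

Lemma measurable_swap_entry n (i : 'I_n) : measurable_fun setT (swap_entry i).
Proof.
apply: measurable_fun_pair; first exact: measurable_replace.
exact: (measurableT_comp (measurable_tnth i) measurable_fst).
Qed.

Lemma measurable_cons_tuple n (x : T) : measurable_fun setT (@cons_tuple n T x).
Proof. exact: (measurableT_comp (@measurable_tuple_cons _ T n) (pair1_measurable x)). Qed.

Lemma measurable_cons_tail n (x : T) :
  measurable_fun setT (fun z : n.-tuple T * T => (cons_tuple x z.1, z.2)).
Proof.
apply: measurable_fun_pair => //.
exact: (measurableT_comp (measurable_cons_tuple x) measurable_fst).
Qed.

Lemma measurable_entrywise n (S : 'I_n -> set T) : (forall j, measurable (S j)) ->
  measurable [set x : n.-tuple T | forall j, S j (tnth x j)].
Proof.
move=> mS; rewrite (_ : [set x | _] = \bigcap_(j in [set: 'I_n])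
    ((fun x : n.-tuple T => tnth x j) @^-1` S j)).
  apply: fin_bigcap_measurable => // j _.
  by rewrite -[X in measurable X]setTI; exact: (measurable_tnth j).
by apply/seteqP; split=> x /= H j; have := H j; [move=> ? _|exact].
Qed.

Lemma measurable_datasets n (S : set T) : measurable S ->
  measurable (datasets (n := n) S).
Proof. by move=> mS; exact: (measurable_entrywise (S := fun=> S)). Qed.

End replace_entry.

Section product_probabilities.
Local Open Scope ereal_scope.
Context (R : realType) (d : measure_display) (T : measurableType d).

Lemma ge0_integral_product_prob_cons n (P : 'I_n.+1 -> probability T R)
    (f : n.+1.-tuple T -> \bar R) :
  measurable_fun setT f -> (forall x, 0 <= f x) ->
  \int[product_prob P]_x f x =
  \int[P ord0]_x \int[product_prob (fun i => P (lift ord0 i))]_xs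
     f (cons_tuple x xs).
Proof.
move=> mf f0 /=; rewrite ge0_integral_distribution// fubini_tonelli1//.
- by apply: measurableT_comp => //; exact: measurable_tuple_cons.
- by move=> x; exact: f0.
Qed.

Lemma ge0_integral_swap_head n (P : probability T R) (Q : probability (n.-tuple T) R)
    (F : n.+1.-tuple T * T -> \bar R) :
  measurable_fun setT F -> (forall z, 0 <= F z) ->
  \int[P]_x \int[Q]_xs \int[P]_y F (cons_tuple y xs, x) =
  \int[P]_x \int[Q]_xs \int[P]_y F (cons_tuple x xs, y).
Proof.
move=> mF F0.
have mG : measurable_fun setT (fun z : (T * T) * n.-tuple T =>
    F (cons_tuple z.1.2 z.2, z.1.1)).
  apply: measurableT_comp => //; apply: measurable_fun_pair.
    apply: (measurableT_comp (@measurable_tuple_cons _ T n)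
      (g := fun z : (T * T) * n.-tuple T => (z.1.2, z.2))).
    apply: measurable_fun_pair => //.
    exact: measurableT_comp measurable_snd measurable_fst.
  exact: measurableT_comp measurable_fst measurable_fst.
transitivity (\int[P]_x \int[P]_y \int[Q]_xs F (cons_tuple y xs, x)).
  apply: eq_integral => x _.
  rewrite (fubini_tonelli (fun z => F (cons_tuple z.2 z.1, x)))//.
  apply: (measurableT_comp mG (g := fun z : n.-tuple T * T => ((x, z.2), z.1))).
  by apply: measurable_fun_pair => //; apply: measurable_fun_pair.
rewrite (fubini_tonelli (fun z => \int[Q]_xs F (cons_tuple z.2 xs, z.1))); last 2 first.
- exact: (measurable_fun_fubini_tonelli_F (m2 := Q) _ mG).
- by move=> z; exact: integral_ge0.
apply: eq_integral => y _.
rewrite (fubini_tonelli (fun z => F (cons_tuple y z.2, z.1)))//.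
apply: (measurableT_comp mG (g := fun z : T * n.-tuple T => ((z.1, y), z.2))).
by apply: measurable_fun_pair => //; apply: measurable_fun_pair.
Qed.

Lemma ge0_integral_swap_entry n (P : 'I_n -> probability T R) (i : 'I_n)
    (F : n.-tuple T * T -> \bar R) :
  measurable_fun setT F -> (forall z, 0 <= F z) ->
  \int[product_prob P]_x \int[P i]_y F (swap_entry i (x, y)) =
  \int[product_prob P]_x \int[P i]_y F (x, y).
Proof.
rewrite /swap_entry; elim: n P i F => [P []//|n IH P i F mF F0].
have mFswap := measurableT_comp mF (measurable_swap_entry (T := T) i).
rewrite ge0_integral_product_prob_cons; last 2 first.
- apply: (measurable_fun_fubini_tonelli_F (m2 := P i) _ mFswap) => z.
  exact: F0.
- by move=> x; exact: integral_ge0.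
rewrite [RHS]ge0_integral_product_prob_cons; last 2 first.
- exact: (measurable_fun_fubini_tonelli_F (m2 := P i) _ mF).
- by move=> x; exact: integral_ge0.
case: (unliftP ord0 i) => [j|] ij; subst i.
  apply: eq_integral => x _.
  under eq_integral do under eq_integral do rewrite replace_consS tnthS.
  apply: (IH (fun i => P (lift ord0 i)) j (fun z => F (cons_tuple x z.1, z.2))) => //.
  exact: measurableT_comp mF (measurable_cons_tail x).
under eq_integral do under eq_integral do under eq_integral do
  rewrite replace_cons0 tnth0.
exact: ge0_integral_swap_head.
Qed.

Section laws_of_entries.
Variables (n : nat) (P : 'I_n -> probability T R) (i : 'I_n).

Let J : {measure set (n.-tuple T * T) -> \bar R} := product_prob P \x P i.

Lemma law_swap_entry : has_law J J (swap_entry i).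
Proof.
split=> [|f mf f0]; first exact: measurable_swap_entry.
rewrite fubini_tonelli1// fubini_tonelli1//; last first.
  by apply: measurableT_comp => //; exact: measurable_swap_entry.
exact: (esym (ge0_integral_swap_entry P i mf f0)).
Qed.

Lemma law_replace : has_law (product_prob P) J (fun z => replace z.1 i z.2).
Proof.
split=> [|f mf f0]; first exact: measurable_replace.
rewrite (law_ge0_integral (law_fst (product_prob P) (P i)))//.
apply: (law_ge0_integral law_swap_entry (f := f \o fst)) => [|z]; last exact: f0.
exact: measurableT_comp.
Qed.

Lemma law_tnth : has_law (P i) (product_prob P) (fun x => tnth x i).
Proof.
split=> [|f mf f0]; first exact: measurable_tnth.
have mft : measurable_fun setT (fun x : n.-tuple T => f (tnth x i)).
  exact: (measurableT_comp mf (measurable_tnth i)).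
rewrite (law_ge0_integral (law_snd (product_prob P) (P i)))//.
rewrite (law_ge0_integral (law_fst (product_prob P) (P i)) mft)//.
apply: (law_ge0_integral law_swap_entry (f := f \o snd)) => [|z]; last exact: f0.
exact: measurableT_comp.
Qed.

Lemma Rintegral_replace (F : n.-tuple T -> R) (c : R) :
  measurable_fun setT F -> (forall x, (`|F x| <= c)%R) ->
  (\int[product_prob P]_x F x =
   \int[product_prob P]_x \int[P i]_y F (replace x i y))%R.
Proof.
move=> mF Fc; rewrite (law_Rintegral law_replace)//.
have Fi : J.-integrable setT (EFin \o (fun z => F (replace z.1 i z.2))).
  apply: prob_bounded_integrable (fun z => Fc (replace z.1 i z.2)).
  by apply: measurableT_comp => //; exact: measurable_replace.
rewrite /Rintegral -(integral12_prod_meas1 Fi); congr fine.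
apply: eq_integral => x _; rewrite [RHS]EFin_Rintegral//.
apply: prob_bounded_integrable (fun y => Fc (replace x i y)).
by apply: measurableT_comp => //; exact: measurable_replace_entry.
Qed.

End laws_of_entries.

Lemma product_prob_setC_le n (Q : 'I_n -> probability T R) (S : 'I_n -> set T) :
  (forall j, measurable (S j)) ->
  product_prob Q (~` [set x | forall j, S j (tnth x j)]) <= \sum_j Q j (~` S j).
Proof.
move=> mS; have mSC j : measurable (~` S j) by exact: measurableC.
have mpre j : measurable ((fun x : n.-tuple T => tnth x j) @^-1` (~` S j)).
  by rewrite -[X in measurable X]setTI; exact: (measurable_tnth j).
under eq_bigr do rewrite (law_preimage (law_tnth Q _))//.
rewrite (_ : ~` _ = \big[setU/set0]_j ((fun x : n.-tuple T => tnth x j) @^-1` (~` S j))).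
  exact: measure_bigsetU_le.
rewrite -bigcup_seq; apply/seteqP; split=> x /=.
  by move=> /existsNP[j Sj]; exists j => //=; rewrite mem_index_enum.
by move=> [j _ Sj] Sx; exact: Sj (Sx j).
Qed.

Lemma product_prob_conull n (Q : 'I_n -> probability T R) (S : 'I_n -> set T) :
  (forall j, measurable (S j)) -> (forall j, Q j (~` S j) = 0) ->
  product_prob Q (~` [set x | forall j, S j (tnth x j)]) = 0.
Proof.
move=> mS Q0; apply/le_anti; rewrite measure_ge0 andbT.
by rewrite (le_trans (product_prob_setC_le Q mS))// big1.
Qed.

Lemma iid_datasets_conull n (P : probability T R) (S : set T) : measurable S ->
  P (~` S) = 0 -> iid n P (~` datasets S) = 0.
Proof. by move=> mS P0; exact: (product_prob_conull (S := fun=> S)). Qed.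

Lemma measurable_prod_tnth n (q : 'I_n -> T -> R) :
  (forall i, measurable_fun setT (q i)) ->
  measurable_fun setT (fun x : n.-tuple T => \prod_(i < n) q i (tnth x i))%R.
Proof.
move=> mq; apply: measurable_prod => i _.
by apply: measurableT_comp => //; exact: measurable_tnth.
Qed.

Lemma product_prob_density n (P Q : 'I_n -> probability T R) (q : 'I_n -> T -> R) :
  (forall i, has_density (P i) (Q i) (q i)) ->
  has_density (product_prob P) (product_prob Q)
    (fun x => \prod_(i < n) q i (tnth x i))%R.
Proof.
elim: n P Q q => [|n IH] P Q q Pq; split.
- by apply: measurable_prod_tnth => i; case: (Pq i).
- by move=> x; apply: prodr_ge0 => i _; case: (Pq i).
- by move=> f mf f0; apply: eq_integral => x _; rewrite big_ord0 mule1.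
- by apply: measurable_prod_tnth => i; case: (Pq i).
- by move=> x; apply: prodr_ge0 => i _; case: (Pq i).
move=> f mf f0.
have [mtail tail_ge0 IHE] := IH _ _ _ (fun i => Pq (lift ord0 i)).
have [mq0 q0 PQ0] := Pq ord0.
have mfc x : measurable_fun setT (fun xs : n.-tuple T => f (cons_tuple x xs)).
  exact: measurableT_comp mf (measurable_cons_tuple x).
have mprod : measurable_fun setT
    (fun x : n.+1.-tuple T => \prod_(i < n.+1) q i (tnth x i))%R.
  by apply: measurable_prod_tnth => i; case: (Pq i).
rewrite ge0_integral_product_prob_cons// PQ0; last 2 first.
- apply: (measurable_fun_fubini_tonelli_F (fun z => f (cons_tuple z.1 z.2))) => //.
  exact: (measurableT_comp mf (@measurable_tuple_cons _ T n)).
- by move=> x; apply: integral_ge0.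
rewrite ge0_integral_product_prob_cons; last 2 first.
- by apply: emeasurable_funM => //; exact/measurable_EFinP.
- by move=> x; rewrite mule_ge0// lee_fin prodr_ge0// => i _; case: (Pq i).
apply: eq_integral => x _; rewrite [X in X * _](IHE _ (mfc x))//.
rewrite -ge0_integralZr ?lee_fin//.
- apply: eq_integral => xs _; rewrite big_ord_recl tnth0 -muleA -EFinM mulrC.
  by congr (_ * (_ * _)%:E); apply: eq_bigr => i _; rewrite tnthS.
- by apply: emeasurable_funM => //; exact/measurable_EFinP.
- by move=> xs _; rewrite mule_ge0// lee_fin.
Qed.

End product_probabilities.

(** * Exponential tilting along one coordinate *)

Section twocosh.
Context (R : realType).
Implicit Types (r a v t : R).

Definition twocosh r t : R := expR (r * t) + expR (- r * t).

Lemma twocosh_ge0 r t : 0 <= twocosh r t.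
Proof. by rewrite addr_ge0 ?expR_ge0. Qed.

Lemma measurable_twocosh r : measurable_fun setT (twocosh r).
Proof.
by apply: measurable_funD; apply: (measurableT_comp (@measurable_expR R));
  exact: measurable_funM.
Qed.

Lemma expR_normM_le_twocosh r t : expR (r * `|t|) <= twocosh r t.
Proof.
rewrite /twocosh; have [t0|t0] := leP 0 t.
  by rewrite ger0_norm// lerDl expR_ge0.
by rewrite ltr0_norm// mulNr -mulrN lerDr expR_ge0.
Qed.

Lemma expR_le_normM r v t : `|v| <= r -> expR (v * t) <= expR (r * `|t|).
Proof.
by move=> vr; rewrite ler_expR (le_trans (ler_norm _))// normrM ler_wpM2r.
Qed.

Lemma expR_le_twocosh r v t : `|v| <= r -> expR (v * t) <= twocosh r t.
Proof. by move=> vr; rewrite (le_trans (expR_le_normM t vr))// expR_normM_le_twocosh. Qed.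

Lemma norm_expR_le_twocosh r a v t : `|v| <= a -> a < r ->
  `|t| * expR (v * t) <= twocosh r t / (r - a).
Proof.
move=> va ar; have ra : 0 < r - a by rewrite subr_gt0.
rewrite ler_pdivlMr// mulrC; apply: le_trans (expR_normM_le_twocosh _ _).
have -> : expR (r * `|t|) = expR ((r - a) * `|t|) * expR (a * `|t|).
  by rewrite -expRD -mulrDl subrK.
rewrite mulrA; apply: ler_pM; rewrite ?expR_ge0 ?mulr_ge0 ?(ltW ra)//.
  by apply: le_trans (expR_ge1Dx _); rewrite lerDr.
exact: expR_le_normM.
Qed.

Lemma norm_twocosh_le r a t : 0 <= a -> a < r ->
  `|t| * twocosh a t <= 2 / (r - a) * twocosh r t.
Proof.
move=> a0 ar; rewrite mulrDr mulrAC -mulrA mulr2n mulrDl mul1r.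
by apply: lerD; apply: norm_expR_le_twocosh; rewrite ?normrN ?ger0_norm.
Qed.

Lemma sqr_expR_le_twocosh r a v t : `|v| <= a -> a < r ->
  t ^+ 2 * expR (v * t) <= (2 / (r - a)) ^+ 2 * (2 * twocosh r t).
Proof.
move=> va ar; have [ab br] := midf_lt ar; set b := (a + r) / 2 in ab br.
have a0 : 0 <= a := le_trans (normr_ge0 _) va.
have ra : r - a != 0 by rewrite gt_eqF ?subr_gt0.
rewrite -(real_normK (num_real t)) expr2 -mulrA.
apply: (@le_trans _ _ (`|t| * (twocosh b t / (b - a)))).
  by rewrite ler_wpM2l// norm_expR_le_twocosh.
rewrite mulrA ler_pdivrMr ?subr_gt0//.
rewrite (le_trans (norm_twocosh_le t (le_trans a0 (ltW ab)) br))//.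
by rewrite le_eqVlt; apply/orP; left; apply/eqP; rewrite /b; field; rewrite ra; lra.
Qed.

End twocosh.

Section parabola_by_parts.
Context (R : realType).
Variables (c r a : R) (G G' : R -> R).
Hypotheses (a_gt0 : 0 < a)
  (dG : forall v : R, `|v - c| <= a -> is_derive v (1 : R) G (G' v))
  (cG' : forall v : R, `|v - c| <= a -> {for v, continuous G'}).

Let derive_continuous (F F' : R -> R) (v : R) :
  is_derive v (1 : R) F (F' v) -> {for v, continuous F}.
Proof. by move=> [+ _] => /derivable1_diffP/differentiable_continuous. Qed.

Let in_ball v : v \in `[c - a, c + a] -> `|v - c| <= a.
Proof. by rewrite in_itv/= -ler_distl. Qed.

Lemma parabola_by_parts :
  \int[lebesgue_measure]_(v in `[c - a, c + a]) ((r ^+ 2 - (v - c) ^+ 2) * G' v) =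
  (r ^+ 2 - a ^+ 2) * (G (c + a) - G (c - a)) +
  \int[lebesgue_measure]_(v in `[c - a, c + a]) (2 * (v - c) * G v).
Proof.
pose F (v : R) := r ^+ 2 - (v - c) ^+ 2; pose F' (v : R) := - (2 * (v - c)).
have dF (v : R) : is_derive v (1 : R) F (F' v).
  have -> : F = cst (r ^+ 2) - (id - cst c) * (id - cst c).
    by apply/funext => w; rewrite /F /= expr2.
  by apply: is_derive_eq; rewrite /GRing.scale/= !fctE /F'; ring.
have cF' (v : R) : {for v, continuous F'}.
  apply: cvgN; apply: cvgM; first exact: cvg_cst.
  by apply: cvgB; [exact: cvg_id|exact: cvg_cst].
have cG v : `|v - c| <= a -> {for v, continuous G}.
  by move=> va; apply: (derive_continuous (dG va)).
have caE : c + a - c = a by ring.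
have cNaE : c - a - c = - a by ring.
have ends : `|c + a - c| <= a /\ `|c - a - c| <= a.
  by rewrite caE cNaE normrN gtr0_norm.
rewrite [LHS](@Rintegration_by_parts _ F G F' G')//.
- rewrite /F caE cNaE sqrrN -mulrBr; congr (_ + _).
  rewrite -[LHS]mulN1r -RintegralZl//.
    by apply: eq_Rintegral => v _; rewrite mulN1r mulNr opprK.
  apply: continuous_compact_integrable; first exact: segment_compact.
  apply: continuous_in_subspaceT => v /set_mem/in_ball va.
  by apply: cvgM; [exact: cF'|exact: cG].
- by rewrite ltrD2l gtrN.
- by apply: continuous_in_subspaceT => v _; exact: cF'.
- split.
  + by move=> v _; have [] := dF v.
  + by apply: cvg_at_right_filter; exact: (derive_continuous (dF _)).
  + by apply: cvg_at_left_filter; exact: (derive_continuous (dF _)).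
- by move=> v _; rewrite derive1E; apply: derive_val.
- by apply: continuous_in_subspaceT => v /set_mem/in_ball; exact: cG'.
- split.
  + by move=> v /subset_itv_oo_cc/in_ball/dG[].
  + by apply: cvg_at_right_filter; apply: cG; exact: ends.2.
  + by apply: cvg_at_left_filter; apply: cG; exact: ends.1.
- by move=> v /subset_itv_oo_cc/in_ball/dG[_ dGv]; rewrite derive1E.
Qed.

End parabola_by_parts.

Section tilt.
Context (R : realType) (d : measure_display) (X : measurableType d)
  (nu : {measure set X -> \bar R}).
Variables (t : X -> R) (m : R).
Hypothesis mt : measurable_fun setT t.
Implicit Types (f g : X -> R) (r a c v : R).

Definition exp_integrable (r : R) (f : X -> R) : Prop :=
  measurable_fun setT f /\
  nu.-integrable setT (EFin \o (fun x => f x * twocosh r (t x))).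

Definition tilt_integral (f : X -> R) (v : R) : R :=
  \int[nu]_x (f x * expR ((v - m) * t x)).

Lemma measurable_tilt v : measurable_fun setT (fun x => expR ((v - m) * t x)).
Proof. by apply: (measurableT_comp (@measurable_expR R)); exact: measurable_funM. Qed.

Lemma exp_integrableM r f g c : measurable_fun setT g ->
  (forall x, `|g x| <= c) -> exp_integrable r f ->
  exp_integrable r (fun x => g x * f x).
Proof.
move=> mg gc [mf fi]; split; first exact: measurable_funM.
apply: (eq_integrable measurableT) (integrableMR_bounded mg gc fi) => // x _ /=.
by rewrite mulrA.
Qed.

Lemma exp_integrable_stat r a f : 0 <= a -> a < r ->
  exp_integrable r f -> exp_integrable a (fun x => t x * f x).
Proof.
move=> a0 ar [mf fi]; split; first exact: measurable_funM.
apply: le_integrableR (integrableZR (2 / (r - a)) (integrable_norm fi)).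
  apply: measurable_funM; first exact: measurable_funM.
  exact: (measurableT_comp (measurable_twocosh a)).
move=> x /=; rewrite !normrM !(ger0_norm (twocosh_ge0 _ _)) mulrAC.
by rewrite [leRHS]mulrCA mulrC ler_wpM2l// norm_twocosh_le.
Qed.

Lemma tilt_integrable r f v : `|v - m| <= r -> exp_integrable r f ->
  nu.-integrable setT (EFin \o (fun x => f x * expR ((v - m) * t x))).
Proof.
move=> vr [mf fi]; apply: le_integrableR (integrable_norm fi).
  by apply: measurable_funM => //; exact: measurable_tilt.
move=> x /=; rewrite !normrM (ger0_norm (expR_ge0 _)) ler_wpM2l//.
by rewrite ger0_norm ?twocosh_ge0// expR_le_twocosh.
Qed.

Lemma is_derive_tilt_integral r f (v : R) : `|v - m| < r -> exp_integrable r f ->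
  is_derive v (1 : R) (tilt_integral f) (tilt_integral (fun x => t x * f x) v).
Proof.
move=> vr fr; have [va ar] := midf_lt vr; set a := (_ + r) / 2 in va ar.
have a0 : 0 <= a by rewrite (le_trans _ (ltW va)).
pose F w x := f x * expR ((w - m) * t x).
pose dom x := `|t x * f x * twocosh a (t x)|.
have Iv : `](m - a), (m + a)[%classic v by rewrite /= in_itv/= -ltr_distl.
have Ia w : `](m - a), (m + a)[%classic w -> `|w - m| <= a.
  by rewrite /= in_itv/= -ltr_distl => /ltW.
have dF (w : R) (x : X) : is_derive w (1 : R) (F ^~ x)
    (t x * f x * expR ((w - m) * t x)).
  have -> : (F ^~ x) = (f x) \*: (expR \o (fun w => (w - m) * t x)).
    by apply/funext => z; rewrite /F /=.
  by apply: is_derive_eq; rewrite /GRing.scale/=; ring.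
have FE w x : partial1of2 F w x = t x * f x * expR ((w - m) * t x).
  by rewrite partial1of2E; apply: derive_val.
have Fi w : `](m - a), (m + a)[%classic w -> nu.-integrable setT (EFin \o F w).
  by move=> /Ia wa; apply: tilt_integrable fr; rewrite (le_trans wa)// ltW.
have dFw (w : R) y : `](m - a), (m + a)[%classic w -> [set: X] y ->
    derivable (F ^~ y) w (1 : R) by move=> _ _; have [] := dF w y.
have F_le w y : `](m - a), (m + a)[%classic w -> [set: X] y ->
    `|partial1of2 F w y| <= dom y.
  move=> /Ia wa _; rewrite FE /dom !normrM (ger0_norm (expR_ge0 _)) ler_wpM2l//.
  by rewrite ger0_norm ?twocosh_ge0// expR_le_twocosh.
have dom0 y : 0 <= dom y by exact: normr_ge0.
have domi : nu.-integrable setT (EFin \o dom).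
  exact: integrable_norm (exp_integrable_stat a0 ar fr).2.
apply: DeriveDef.
  exact: (derivable_under_integral measurableT Iv Fi dFw dom0 domi F_le).
rewrite -derive1E.
rewrite (differentiation_under_integral measurableT Iv Fi dFw dom0 domi F_le).
by apply: eq_Rintegral => x _; rewrite FE.
Qed.

Lemma continuous_tilt_integral r f (v : R) : `|v - m| < r -> exp_integrable r f ->
  {for v, continuous (tilt_integral f)}.
Proof.
move=> vr fr; apply: differentiable_continuous; apply/derivable1_diffP.
by have [] := is_derive_tilt_integral vr fr.
Qed.

Definition tilt_average (b g : X -> R) (v : R) : R :=
  tilt_integral (fun x => g x * b x) v / tilt_integral b v.

Definition tilt_covariance (b g : X -> R) (v : R) : R :=
  tilt_average b (fun x => g x * t x) v - tilt_average b g v * tilt_average b t v.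

Section covariance_by_parts.
Variables (r a c : R) (b g : X -> R).
Hypotheses (a_gt0 : 0 < a) (ar : a < r) (mg : measurable_fun setT g)
  (gc : forall x, `|g x| <= c) (br : exp_integrable r b)
  (b_gt0 : forall v, `|v - m| < r -> 0 < tilt_integral b v).

Let gbr : exp_integrable r (fun x => g x * b x) := exp_integrableM mg gc br.

Lemma is_derive_tilt_average (v : R) : `|v - m| < r ->
  is_derive v (1 : R) (tilt_average b g) (tilt_covariance b g v).
Proof.
move=> vr; have bv0 : tilt_integral b v != 0 by rewrite gt_eqF ?b_gt0.
have db := is_derive_tilt_integral vr br.
have dgb := is_derive_tilt_integral vr gbr.
have dbV := is_deriveV bv0 db.
apply: is_derive_eq (is_deriveM dgb dbV) _.
rewrite /tilt_covariance /tilt_average /GRing.scale/=.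
rewrite (_ : (fun x => g x * t x * b x) = (fun x => t x * (g x * b x))); last first.
  by apply/funext => x; ring.
by field.
Qed.

Lemma continuous_tilt_covariance (v : R) : `|v - m| <= a ->
  {for v, continuous (tilt_covariance b g)}.
Proof.
move=> va; have vr := le_lt_trans va ar.
have [va' a'r] := midf_lt vr; set a' := (_ + r) / 2 in va' a'r.
have a'0 : 0 <= a' by rewrite (le_trans _ (ltW va')).
have cV : {for v, continuous (fun w => (tilt_integral b w)^-1)}.
  apply: cvgV; first by rewrite gt_eqF ?b_gt0.
  exact: continuous_tilt_integral br.
have c_avg f : {for v, continuous (tilt_integral f)} ->
    {for v, continuous (fun w => tilt_integral f w / tilt_integral b w)}.
  by move=> cf; exact: cvgM.
apply: cvgB.
  rewrite /tilt_average (_ : (fun x => g x * t x * b x) = (fun x => t x * (g x * b x))).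
    apply: c_avg; apply: continuous_tilt_integral va' _.
    exact: exp_integrable_stat gbr.
  by apply/funext => x; ring.
apply: cvgM; apply: c_avg; first exact: continuous_tilt_integral gbr.
exact: continuous_tilt_integral va' (exp_integrable_stat a'0 a'r br).
Qed.

Lemma tilt_covariance_by_parts :
  \int[lebesgue_measure]_(v in `[m - a, m + a])
    ((r ^+ 2 - (v - m) ^+ 2) * tilt_covariance b g v) =
  (r ^+ 2 - a ^+ 2) * (tilt_average b g (m + a) - tilt_average b g (m - a)) +
  \int[lebesgue_measure]_(v in `[m - a, m + a]) (2 * (v - m) * tilt_average b g v).
Proof.
apply: parabola_by_parts => // v va; last exact: continuous_tilt_covariance.
exact: is_derive_tilt_average (le_lt_trans va ar).
Qed.

End covariance_by_parts.
End tilt.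

(** * Differential privacy *)

Section exponential_bound.
Context (R : realType).

Lemma expR1_le3 : expR (1 : R) <= 3.
Proof.
have e6 : expR (6^-1 : R) <= 6 / 5.
  rewrite -[leLHS]invrK -expRN invf_ple ?posrE ?expR_gt0//.
  by apply: le_trans (expR_ge1Dx _); lra.
have -> : expR (1 : R) = expR 6^-1 ^+ 6 by rewrite -expRM_natl mulfV.
apply: (@le_trans _ _ ((6 / 5) ^+ 6)); last by lra.
by rewrite ler_pXn2r ?nnegrE ?expR_ge0.
Qed.

Lemma expR_le1D2x (e : R) : 0 <= e -> e <= 1 -> expR e <= 1 + 2 * e.
Proof.
move=> e0 e1; have e01 : 0 <= e <= 1 by rewrite e0.
have := convex_expR (Itv01 e0 e1) 1 0; rewrite !convRE/= mulr1 mulr0 addr0 expR0.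
move=> /le_trans; apply; have := ler_wpM2l e0 expR1_le3; rewrite /unstable.onem.
lra.
Qed.

End exponential_bound.

Lemma measurable_superlevel (R : realType) (d : measure_display)
    (T : measurableType d) (f : T -> R) (t : R) : measurable_fun setT f ->
  measurable [set x | t < f x].
Proof.
move=> mf; have -> : [set x | t < f x] = f @^-1` `]t, +oo[.
  by apply/seteqP; split => x /=; rewrite in_itv/= andbT.
by rewrite -[X in measurable X]setTI; exact: mf.
Qed.

Section layer_cake.
Local Open Scope ereal_scope.
Context (R : realType) (d : measure_display) (T : measurableType d).
Variables (P : probability T R) (f : T -> R).
Hypothesis mf : measurable_fun setT f.

Let X : {RV P >-> R} := mfun_Sub (mem_set mf).

Let ccdfE t : ccdf X t = P [set x | (t < f x)%R].
Proof.
rewrite /ccdf /distribution /pushforward; congr (P _).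
by apply/seteqP; split => x /=; rewrite in_itv/= andbT.
Qed.

Lemma measurable_tail : measurable_fun setT (fun t : R => P [set x | (t < f x)%R]).
Proof. by apply: eq_measurable_fun (ccdf_measurable X) => t _; rewrite ccdfE. Qed.

Lemma ge0_integral_layer_cake : (forall x, (0 <= f x)%R) ->
  \int[P]_x (f x)%:E =
  \int[@lebesgue_measure R]_(t in `[0%R, +oo[) P [set x | (t < f x)%R].
Proof.
move=> f0; have := @ge0_expectation_ccdf _ _ _ P X f0.
rewrite expectation_def /= => ->.
by apply: eq_integral => t _; rewrite ccdfE.
Qed.

Lemma bounded_integral_layer_cake (c : R) : (forall x, 0 <= f x <= c)%R ->
  \int[P]_x (f x)%:E =
  \int[@lebesgue_measure R]_(t in `[0%R, c]) P [set x | (t < f x)%R].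
Proof.
move=> f0c; rewrite ge0_integral_layer_cake; last by move=> x; have /andP[] := f0c x.
rewrite integral_mkcond [RHS]integral_mkcond; apply: eq_integral => t _.
rewrite !patchE !mem_setE !in_itv/= andbT.
case: (leP 0%R t) => //= t0; case: leP => // ct.
rewrite (_ : [set x | _] = set0) ?measure0//; apply/seteqP; split=> x //=.
by have /andP[_ fc] := f0c x; rewrite ltNge (le_trans fc)// ltW.
Qed.

End layer_cake.

Lemma integral_excess_le (R : realType) (d : measure_display) (T : measurableType d)
    (P : probability T R) (f : T -> R) (t0 : R) :
  measurable_fun setT f -> 0 <= t0 ->
  (\int[P]_x (Num.max (f x - t0) 0)%:E <=
   \int[@lebesgue_measure R]_(t in `]t0, +oo[) P [set x | (t < f x)%R])%E.
Proof.
move=> mf t00; pose g x := Num.max (f x) t0.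
have g0 x : 0 <= g x by rewrite le_max t00 orbT.
have mg : measurable_fun setT g by exact: measurable_maxr.
have excessE x : t0 + Num.max (f x - t0) 0 = g x by rewrite addr_maxr addr0 addrC subrK.
rewrite -(leeD2lE (x := t0%:E))//.
have -> : (t0%:E + \int[P]_x (Num.max (f x - t0) 0)%:E = \int[P]_x (g x)%:E)%E.
  under [RHS]eq_integral do rewrite -excessE EFinD.
  rewrite ge0_integralD// ?integral_prob_cst//.
  - by move=> x _; rewrite lee_fin le_max lexx orbT.
  - by apply/measurable_EFinP; apply: measurable_maxr => //; exact: measurable_funB.
rewrite ge0_integral_layer_cake//.
have -> : `[0%R, +oo[%classic = `[0, t0] `|` `]t0, +oo[ :> set R.
  by rewrite -itv_bndbnd_setU// bnd_simp.
have mtail := measurable_tail P mg.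
rewrite ge0_integral_setU//=; last 2 first.
- by apply: measurable_funTS.
- apply/disj_setPRL => t /=; rewrite !in_itv/= andbT => t0t.
  by apply/negP; rewrite negb_and -!ltNge t0t orbT.
apply: leeD.
  apply: (@le_trans _ _ (\int[@lebesgue_measure R]_(t in `[0%R, t0]) 1)%E).
    apply: ge0_le_integral_subset => // t _.
    by apply: probability_le1; exact: measurable_superlevel.
  rewrite integral_cst//= mul1e [leLHS](_ : _ = @lebesgue_measure R `[0, t0]%classic)//.
  by rewrite lebesgue_measure_itv/= lte_fin; case: ifP => // _; rewrite oppr0 adde0.
apply: ge0_le_integral_subset => // t /=; rewrite in_itv/= andbT => t0t.
rewrite le_eqVlt; apply/orP; left; apply/eqP; congr (P _).
by apply/seteqP; split=> x /=; rewrite lt_max ?[t < t0]ltNge ?(ltW t0t) ?orbF.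
Qed.

Definition dp_close (R : realType) (d : measure_display) (Y : measurableType d)
    (eps delta : R) (P Q : set Y -> \bar R) :=
  forall A, measurable A -> (P A <= (expR eps)%:E * Q A + delta%:E)%E.

Section dp_close_integrals.
Context (R : realType) (d : measure_display) (Y : measurableType d).
Variables (eps delta t0 : R).
Hypotheses (eps_ge0 : 0 <= eps) (eps_le1 : eps <= 1) (delta_ge0 : 0 <= delta)
  (t0_ge0 : 0 <= t0).
Implicit Types P Q : probability Y R.

Lemma dp_close_refl P : dp_close eps delta P P.
Proof.
move=> A mA; apply: (@le_trans _ _ ((expR eps)%:E * P A)%E); last by rewrite leeDl ?lee_fin.
rewrite -{1}[P A]mul1e; apply: lee_wpmul2r => //.
by rewrite lee_fin -expR0 ler_expR.
Qed.

Lemma dp_close_integral_le P Q (f : Y -> R) : dp_close eps delta P Q ->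
  measurable_fun setT f -> (forall y, 0 <= f y <= t0) ->
  \int[P]_y f y <= expR eps * \int[Q]_y f y + delta * t0.
Proof.
move=> PQ mf f0t.
have fi (P' : probability Y R) : P'.-integrable setT (EFin \o f).
  apply: (prob_bounded_integrable P' (c := t0)) => // y.
  by have /andP[f0 ft] := f0t y; rewrite ger0_norm.
rewrite -lee_fin EFinD EFinM (EFin_Rintegral (fi P)) (EFin_Rintegral (fi Q)).
rewrite (bounded_integral_layer_cake P mf f0t) (bounded_integral_layer_cake Q mf f0t).
have mtail P' := measurable_funTS (D := `[0, t0]%classic) (measurable_tail P' mf).
have deltaE : (\int[@lebesgue_measure R]_(t in `[0%R, t0]) delta%:E = (delta * t0)%:E)%E.
  rewrite integral_cst//= [X in (_ * X)%E](_ : _ = @lebesgue_measure R `[0, t0]%classic)//.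
  rewrite lebesgue_measure_itv/= lte_fin; case: ltP => [_|t00]; first by rewrite oppr0 adde0.
  have -> : t0 = 0 by apply/le_anti; rewrite t00.
  by rewrite mulr0 mule0.
apply: (@le_trans _ _ (\int[@lebesgue_measure R]_(t in `[0%R, t0])
    ((expR eps)%:E * Q [set y | (t < f y)%R] + delta%:E))%E); last first.
  rewrite ge0_integralD//; last 2 first.
  - by move=> t _; rewrite mule_ge0// lee_fin expR_ge0.
  - by apply: emeasurable_funM => //; exact: mtail.
  by rewrite ge0_integralZl ?lee_fin ?expR_ge0 -?deltaE//; exact: mtail.
apply: ge0_le_integral_subset => // t _.
  by rewrite adde_ge0 ?mule_ge0 ?lee_fin ?expR_ge0.
by apply: PQ; exact: measurable_superlevel.
Qed.

Lemma dp_close_ge0_Rintegral_le P Q (B : R) (f : Y -> R) : dp_close eps delta P Q ->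
  measurable_fun setT f -> (forall y, 0 <= f y <= B) ->
  \int[P]_y f y <= (1 + 2 * eps) * \int[Q]_y f y + delta * t0 + Num.max (B - t0) 0.
Proof.
move=> PQ mf f0B; set K := Num.max _ _; pose u y := Num.min (f y) t0.
have mu_ : measurable_fun setT u by exact: measurable_minr.
have u0t y : 0 <= u y <= t0.
  by have /andP[f0 _] := f0B y; rewrite /u le_min f0 t0_ge0 ge_min lexx orbT.
have fi (P' : probability Y R) : P'.-integrable setT (EFin \o f).
  apply: (prob_bounded_integrable P' (c := B)) => // y.
  by have /andP[f0 fB] := f0B y; rewrite ger0_norm.
have ui (P' : probability Y R) : P'.-integrable setT (EFin \o u).
  apply: (prob_bounded_integrable P' (c := t0)) => // y.
  by have /andP[u0 ut] := u0t y; rewrite ger0_norm.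
have fu : \int[P]_y f y <= \int[P]_y u y + K.
  have Ki := prob_integrable_cst P K.
  rewrite -[K](prob_Rintegral_cst P) -(RintegralD measurableT (ui P) Ki).
  apply: (le_Rintegral measurableT (fi P) (integrableDR (ui P) Ki)) => y _ /=.
  have /andP[_ fB] := f0B y; have K0 : 0 <= K by rewrite le_max lexx orbT.
  have BK : B - t0 <= K by rewrite le_max lexx.
  by rewrite /u; case: (leP (f y) t0) => _; lra.
have uf : \int[Q]_y u y <= \int[Q]_y f y.
  by apply: (le_Rintegral measurableT (ui Q) (fi Q)) => y _; rewrite ge_min lexx.
have u_ge0 : 0 <= \int[Q]_y u y.
  by apply: Rintegral_ge0 => y _; have /andP[] := u0t y.
rewrite (le_trans fu)// lerD2r (le_trans (dp_close_integral_le PQ mu_ u0t))// lerD2r.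
by apply: ler_pM; rewrite ?expR_ge0// expR_le1D2x.
Qed.

Lemma dp_close_Rintegral_le P Q (B : R) (f : Y -> R) :
  dp_close eps delta P Q -> dp_close eps delta Q P ->
  measurable_fun setT f -> (forall y, `|f y| <= B) ->
  \int[P]_y f y <= \int[Q]_y f y + 2 * eps * \int[Q]_y `|f y| +
    2 * delta * t0 + 2 * Num.max (B - t0) 0.
Proof.
move=> PQ QP mf fB; set K := Num.max _ _.
have fi (P' : probability Y R) := prob_bounded_integrable P' mf fB.
have pos_B y : 0 <= f^\+ y <= B.
  by rewrite funrpos_ge0 ge_max (le_trans (ler_norm _) (fB y)) (le_trans _ (fB y)).
have neg_B y : 0 <= f^\- y <= B.
  rewrite funrneg_ge0 ge_max (le_trans _ (fB y)) ?(le_trans _ (fB y))//.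
  by rewrite -normrN ler_norm.
have posi (P' : probability Y R) := integrable_funrpos measurableT (fi P').
have negi (P' : probability Y R) := integrable_funrneg measurableT (fi P').
have diffE (P' : probability Y R) :
    \int[P']_y f y = \int[P']_y f^\+ y - \int[P']_y f^\- y.
  by rewrite -RintegralB//; apply: eq_Rintegral => y _; rewrite -{1}(funrposBneg f).
have normE : \int[Q]_y `|f y| = \int[Q]_y f^\+ y + \int[Q]_y f^\- y.
  rewrite -RintegralD//; apply: eq_Rintegral => y _.
  by rewrite -[LHS]/((Num.norm \o f) y) -funrposDneg.
have pos_le := dp_close_ge0_Rintegral_le PQ (measurable_funrpos mf) pos_B.
have neg_le := dp_close_ge0_Rintegral_le QP (measurable_funrneg mf) neg_B.
have int_ge0 (P' : probability Y R) (u : Y -> R) : (forall y, 0 <= u y) -> 0 <= \int[P']_y u y.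
  by move=> u0; apply: Rintegral_ge0.
have := int_ge0 Q _ (funrpos_ge0 f); have := int_ge0 Q _ (funrneg_ge0 f).
rewrite !diffE normE; move: pos_le neg_le; rewrite -/K.
move: (\int[P]_y f^\+ y) (\int[P]_y f^\- y) (\int[Q]_y f^\+ y) (\int[Q]_y f^\- y).
move=> p p' q q' pos_le neg_le q'0 q0.
have eps_q : 0 <= eps * q by exact: mulr_ge0.
have [qp'|p'q] := leP q' p'.
  have : 0 <= eps * q' by exact: mulr_ge0.
  have : 0 <= delta * t0 by exact: mulr_ge0.
  have : 0 <= K by rewrite le_max lexx orbT.
  lra.
have : eps * p' <= eps * q' by rewrite ler_wpM2l// ltW.
lra.
Qed.

End dp_close_integrals.

Section kernel_mean.
Context (R : realType) (d d' : measure_display).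
Context (X : measurableType d) (Y : measurableType d').

Lemma measurable_kernel_integral (l : R.-sfker X ~> Y) (f : X * Y -> R) :
  measurable_fun setT f ->
  measurable_fun setT (fun x => \int[l x]_y (f (x, y))%:E)%E.
Proof.
move=> mf; have mfE : measurable_fun setT (EFin \o f) by exact/measurable_EFinP.
under eq_fun do rewrite integralE.
apply: emeasurable_funB.
- apply: eq_measurable_fun (measurable_fun_integral_sfinite_kernel _ l
    (funepos_ge0 _) (measurable_funepos mfE)) => x _.
  by apply: eq_integral => y _; rewrite !funeposE.
- apply: eq_measurable_fun (measurable_fun_integral_sfinite_kernel _ l
    (funeneg_ge0 _) (measurable_funeneg mfE)) => x _.
  by apply: eq_integral => y _; rewrite !funenegE.
Qed.

Lemma measurable_Rintegral_param (Q : probability Y R) (f : X * Y -> R) :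
  measurable_fun setT f -> measurable_fun setT (fun x => \int[Q]_y f (x, y)).
Proof.
move=> mf; rewrite /Rintegral; apply: measurableT_comp => //.
have mQ : measurable_fun [set: X] (fun=> Q : pprobability Y R) by exact: measurable_cst.
exact: (measurable_kernel_integral (kprobability mQ) mf).
Qed.

Variable M : R.-pker X ~> Y.

Definition kernel_prob (x : X) : set Y -> \bar R := M x.

HB.instance Definition _ (x : X) := Measure.on (kernel_prob x).

HB.instance Definition _ (x : X) :=
  Measure_isProbability.Build _ _ _ (kernel_prob x) (prob_kernel x).

Definition kernel_mean (f : Y -> R) (x : X) : R := \int[kernel_prob x]_y f y.

Section bounded_observable.
Variables (f : Y -> R) (c : R).
Hypotheses (mf : measurable_fun setT f) (fc : forall y, `|f y| <= c).

Lemma kernel_mean_bounded x : `|kernel_mean f x| <= c.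
Proof. exact: prob_bounded_Rintegral. Qed.

Lemma measurable_kernel_mean : measurable_fun setT (kernel_mean f).
Proof.
rewrite /kernel_mean /Rintegral; apply: measurableT_comp => //.
exact: (measurable_kernel_integral M (measurableT_comp mf measurable_snd)).
Qed.

Lemma kernel_mean_integrable (P : probability X R) :
  P.-integrable setT (EFin \o kernel_mean f).
Proof. exact: prob_bounded_integrable measurable_kernel_mean kernel_mean_bounded. Qed.

End bounded_observable.

(* [f] itself may be unbounded, hence not a priori integrable. *)
Lemma integral_kernel_conull (d0 : measure_display) (Z : measurableType d0)
    (Q : probability Z R) (phi : Z -> X) (D : set Z) (E : set Y)
    (f g : Y -> R) (c : R) :
  measurable_fun setT phi -> measurable D -> Q (~` D) = 0%E -> measurable E ->
  (forall z, D z -> M (phi z) E = 1%E) ->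
  measurable_fun setT f -> measurable_fun setT g -> (forall y, `|g y| <= c) ->
  (forall y, E y -> f y = g y) ->
  (\int[Q]_z \int[M (phi z)]_y (f y)%:E =
   (\int[Q]_z kernel_mean g (phi z))%:E)%E.
Proof.
move=> mphi mD D0 mE ME mf mg gc fg.
have mk : measurable_fun setT (fun z => kernel_mean g (phi z)).
  exact: measurableT_comp (measurable_kernel_mean mg) mphi.
rewrite EFin_Rintegral; last first.
  exact: prob_bounded_integrable mk (fun z => kernel_mean_bounded mg gc (phi z)).
apply: (eq_integral_conull mD D0) => [||z Dz]; last 1 first.
- rewrite /kernel_mean EFin_Rintegral; last exact: prob_bounded_integrable gc.
  apply: (@eq_integral_conull _ _ _ (kernel_prob (phi z)) E) => //.
  + exact/(prob_conull (kernel_prob (phi z)) mE)/ME.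
  + exact/measurable_EFinP.
  + exact/measurable_EFinP.
  + by move=> y Ey; rewrite fg.
- apply: (measurableT_comp (f := fun x => (\int[M x]_y (f y)%:E)%E) _ mphi).
  exact: (measurable_kernel_integral M (measurableT_comp mf measurable_snd)).
- exact/measurable_EFinP.
Qed.

Lemma integral_kernel_sum_conull (d0 : measure_display) (Z : measurableType d0)
    (Q : probability Z R) (phi : Z -> X) (D : set Z) (E : set Y) (I : finType)
    (f g : I -> Y -> R) (c : I -> R) :
  measurable_fun setT phi -> measurable D -> Q (~` D) = 0%E -> measurable E ->
  (forall z, D z -> M (phi z) E = 1%E) ->
  (forall i, measurable_fun setT (f i)) -> (forall i, measurable_fun setT (g i)) ->
  (forall i y, `|g i y| <= c i) -> (forall i y, E y -> f i y = g i y) ->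
  (\int[Q]_z \int[M (phi z)]_y (\sum_i f i y)%:E =
   (\sum_i \int[Q]_z kernel_mean (g i) (phi z))%:E)%E.
Proof.
move=> mphi mD D0 mE ME mf mg gc fg.
have sum_le y : `|\sum_i g i y| <= \sum_i c i.
  by apply: le_trans (ler_norm_sum _ _ _) _; exact: ler_sum.
rewrite (integral_kernel_conull mphi mD D0 mE ME (g := fun y => \sum_i g i y) _ _ sum_le).
- congr EFin; rewrite -Rintegral_sum// => [|i]; last first.
    apply: (prob_bounded_integrable Q (c := c i)) => [|z].
      exact: measurableT_comp (measurable_kernel_mean (mg i)) mphi.
    exact: kernel_mean_bounded.
  apply: eq_Rintegral => z _; rewrite /kernel_mean Rintegral_sum// => i.
  exact: prob_bounded_integrable (mg i) (gc i).
- exact: measurable_sum.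
- exact: measurable_sum.
- by move=> y Ey; apply: eq_bigr => i _; exact: fg.
Qed.

End kernel_mean.

(** * Fingerprinting a private mechanism *)

Section fingerprint.
Context (R : realType) (d d' : measure_display) (X : measurableType d)
  (Y : measurableType d') (n : nat) (I : finType).
Variables (S : set X) (M : R.-pker (n.-tuple X) ~> Y) (eps delta t0 : R).
Hypotheses (mS : measurable S) (eps_ge0 : 0 <= eps) (eps_le1 : eps <= 1)
  (delta_ge0 : 0 <= delta) (t0_ge0 : 0 <= t0) (M_dp : dp eps delta S M).

Lemma dp_replace x (i : 'I_n) z : datasets S x -> S z ->
  dp_close eps delta (kernel_prob M x) (kernel_prob M (replace x i z)).
Proof.
move=> Sx Sz; have [xz|xz] := pselect (tnth x i = z).
  by rewrite -xz replace_tnth; exact: dp_close_refl.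
apply: M_dp; [exact: Sx|exact: datasets_replace|exists i].
rewrite tnth_replace_same; split=> // j ji.
by rewrite tnth_replace (negbTE ji).
Qed.

Variables (P : probability X R) (s : I -> Y -> R) (tau : I -> X -> R) (C : R)
  (B : X -> R).
Hypotheses (P_S : P (~` S) = 0%E)
  (ms : forall j, measurable_fun setT (s j)) (sC : forall j y, `|s j y| <= C)
  (tau_int : forall j, P.-integrable setT (EFin \o tau j))
  (tau2_int : forall j l, P.-integrable setT (EFin \o (fun x => tau j x * tau l x)))
  (tau_mean : forall j, \int[P]_x tau j x = 0)
  (mB : measurable_fun setT B) (B_int : P.-integrable setT (EFin \o B))
  (s_tau_le : forall x y, `|\sum_j s j y * tau j x| <= B x).

Definition score_correlation (x : n.-tuple X) (w : X) : R :=
  \sum_j kernel_mean M (s j) x * tau j w.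

Definition score_second_moment (jl : I * I) : n.-tuple X -> R :=
  kernel_mean M (fun y => s jl.1 y * s jl.2 y).

Definition score_square_correlation (x : n.-tuple X) (w : X) : R :=
  \sum_jl score_second_moment jl x * (tau jl.1 w * tau jl.2 w).

Let excess x : R := Num.max (B x - t0) 0.

Let ss_measurable jl : measurable_fun setT (fun y => s jl.1 y * s jl.2 y).
Proof. exact: measurable_funM. Qed.

Let ss_bounded jl y : `|s jl.1 y * s jl.2 y| <= C * C.
Proof. by rewrite normrM ler_pM. Qed.

Lemma kernel_mean_inner x w :
  kernel_mean M (fun y => \sum_j s j y * tau j w) x = score_correlation x w.
Proof.
rewrite /kernel_mean Rintegral_sumMr// => j.
exact: prob_bounded_integrable (sC j).
Qed.

Lemma kernel_mean_inner_sqr x w :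
  kernel_mean M (fun y => (\sum_j s j y * tau j w) ^+ 2) x =
  score_square_correlation x w.
Proof.
rewrite /score_square_correlation /score_second_moment /kernel_mean.
rewrite -(Rintegral_sumMr (f := fun jl y => s jl.1 y * s jl.2 y)) => [|jl].
  apply: eq_Rintegral => y _; rewrite expr2 big_distrlr/= pair_big/=.
  by apply: eq_bigr => jl _; rewrite mulrACA.
exact: prob_bounded_integrable (ss_bounded jl).
Qed.

Lemma score_square_correlation_ge0 x w : 0 <= score_square_correlation x w.
Proof.
rewrite -kernel_mean_inner_sqr; apply: Rintegral_ge0 => y _.
exact: sqr_ge0.
Qed.

Lemma score_correlation_replace_le (i : 'I_n) x z : datasets S x -> S z ->
  score_correlation x (tnth x i) <=
  score_correlation (replace x i z) (tnth x i) +
  2 * eps * Num.sqrt (score_square_correlation (replace x i z) (tnth x i)) +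
  2 * delta * t0 + 2 * excess (tnth x i).
Proof.
move=> Sx Sz; set x' := replace x i z; set w := tnth x i; pose f y := \sum_j s j y * tau j w.
have mf : measurable_fun setT f.
  by apply: measurable_sum => j; exact: measurable_funM.
have fB y : `|f y| <= B w := s_tau_le w y.
have MxMx' : dp_close eps delta (kernel_prob M x) (kernel_prob M x').
  exact: dp_replace.
have Mx'Mx : dp_close eps delta (kernel_prob M x') (kernel_prob M x).
  rewrite -[x in X in dp_close _ _ _ X](replace_tnth x i) -(replace_replace x i z).
  by apply: dp_replace; [exact: datasets_replace|exact: Sx].
have nf_int : (kernel_prob M x').-integrable setT (EFin \o (fun y => `|f y|)).
  exact: integrable_norm (prob_bounded_integrable _ mf fB).
have nf2_int : (kernel_prob M x').-integrable setT (EFin \o (fun y => `|f y| ^+ 2)).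
  apply: (prob_bounded_integrable _ (c := B w ^+ 2)) => [|y].
    by apply: measurable_funX; exact: measurableT_comp.
  by rewrite normrX normr_id ler_pXn2r ?nnegrE// (le_trans _ (fB y)).
rewrite -!kernel_mean_inner.
apply: le_trans (dp_close_Rintegral_le eps_ge0 eps_le1 delta_ge0 t0_ge0
  MxMx' Mx'Mx mf fB) _.
rewrite !lerD2r lerD2l ler_wpM2l ?mulr_ge0//.
apply: le_trans (prob_Rintegral_le_sqrt nf_int nf2_int) _.
rewrite -kernel_mean_inner_sqr ler_wsqrtr// le_eqVlt; apply/orP; left; apply/eqP.
by apply: eq_Rintegral => y _; rewrite real_normK ?num_real.
Qed.

Let sigma_measurable j : measurable_fun setT (kernel_mean M (s j)).
Proof. exact: measurable_kernel_mean. Qed.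

Let sigma_bounded j x : `|kernel_mean M (s j) x| <= C.
Proof. exact: kernel_mean_bounded. Qed.

Let sigma2_measurable jl : measurable_fun setT (score_second_moment jl).
Proof. exact: measurable_kernel_mean. Qed.

Let sigma2_bounded jl x : `|score_second_moment jl x| <= C * C.
Proof. exact: kernel_mean_bounded (ss_measurable jl) (ss_bounded jl) x. Qed.

Let tau_measurable j : measurable_fun setT (tau j).
Proof. by apply/measurable_EFinP; exact: measurable_int (tau_int j). Qed.

Lemma score_correlation_entry_integrable (i : 'I_n) : (iid n P).-integrable setT
  (EFin \o (fun x => score_correlation x (tnth x i))).
Proof.
apply: integrable_sumR => // j.
apply: (integrableMR_bounded (sigma_measurable j) (sigma_bounded j)).
exact/(law_integrable (law_tnth (fun=> P) i) (tau_measurable j)).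
Qed.

Let J := (iid n P \x P)%E.

Let correlation_integrable :
  J.-integrable setT (EFin \o (fun z => score_correlation z.1 z.2)).
Proof. exact: integrable_product_sumM sigma_measurable sigma_bounded tau_int. Qed.

Let square_correlation_integrable :
  J.-integrable setT (EFin \o (fun z => score_square_correlation z.1 z.2)).
Proof.
exact: (integrable_product_sumM (v := fun jl x => tau jl.1 x * tau jl.2 x)
  (iid n P) sigma2_measurable sigma2_bounded (fun jl => tau2_int jl.1 jl.2)).
Qed.

Let excess_integrable : P.-integrable setT (EFin \o excess).
Proof.
apply: le_integrableR (integrableDR (integrable_norm B_int) (prob_integrable_cst P t0)).
  by apply: measurable_maxr => //; exact: measurable_funB.
move=> x /=; rewrite /excess ger0_norm ?le_max ?lexx ?orbT// ge_max.
rewrite addr_ge0// andbT lerD ?ler_norm//.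
by rewrite (le_trans _ t0_ge0)// oppr_le0.
Qed.

Let sqrt_square_correlation_integrable : J.-integrable setT
  (EFin \o (fun z => Num.sqrt (score_square_correlation z.1 z.2))) :=
  prob_integrable_sqrt (fun z => score_square_correlation_ge0 z.1 z.2)
    square_correlation_integrable.

Let mexcess : measurable_fun setT excess.
Proof. by apply/measurable_EFinP; exact: measurable_int excess_integrable. Qed.

Let replaced_excess_integrable : J.-integrable setT (EFin \o (fun z => excess z.2)).
Proof. exact/(law_integrable (law_snd (iid n P) P) mexcess). Qed.

Definition replaced_correlation_bound (z : n.-tuple X * X) : R :=
  score_correlation z.1 z.2 + 2 * eps * Num.sqrt (score_square_correlation z.1 z.2) +
  2 * delta * t0 + 2 * excess z.2.

Lemma replaced_correlation_bound_integrable :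
  J.-integrable setT (EFin \o replaced_correlation_bound).
Proof.
apply: integrableDR; last exact: integrableZR replaced_excess_integrable.
apply: integrableDR; last exact: prob_integrable_cst.
apply: integrableDR correlation_integrable _.
exact: integrableZR sqrt_square_correlation_integrable.
Qed.

Lemma Rintegral_score_correlation_le (i : 'I_n) :
  \int[iid n P]_x score_correlation x (tnth x i) <=
  \int[J]_z replaced_correlation_bound z.
Proof.
have bound_int := replaced_correlation_bound_integrable.
have mbound : measurable_fun setT replaced_correlation_bound.
  by apply/measurable_EFinP; exact: measurable_int bound_int.
have entry_int := score_correlation_entry_integrable i.
have mentry : measurable_fun setT (fun x => score_correlation x (tnth x i)).
  by apply/measurable_EFinP; exact: measurable_int entry_int.
rewrite (law_Rintegral (law_swap_entry (fun=> P) i) mbound).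
rewrite (law_Rintegral (law_fst (iid n P) P) mentry).
have mD := measurable_datasets (n := n) mS.
apply: (le_Rintegral_conull (D := datasets S `*` S)).
- exact: measurableX.
- by apply: product_conull => //; exact: iid_datasets_conull.
- exact/(law_integrable (law_fst (iid n P) P) mentry).
- exact/(law_integrable (law_swap_entry (fun=> P) i) mbound).
- by move=> [x z] [/= Sx Sz]; exact: score_correlation_replace_le.
Qed.

Lemma Rintegral_replaced_correlation : \int[J]_z score_correlation z.1 z.2 = 0.
Proof.
rewrite (Rintegral_product_sumM (iid n P) sigma_measurable sigma_bounded tau_int).
by apply: big1 => j _; rewrite tau_mean mulr0.
Qed.

Lemma Rintegral_replaced_correlation_boundE :
  \int[J]_z replaced_correlation_bound z =
  2 * eps * \int[J]_z Num.sqrt (score_square_correlation z.1 z.2) +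
  2 * delta * t0 + 2 * \int[P]_x excess x.
Proof.
have sqrt_int := integrableZR (2 * eps) sqrt_square_correlation_integrable.
have c_int := prob_integrable_cst J (2 * delta * t0).
have excess_int := integrableZR 2 replaced_excess_integrable.
have corr_sqrt_int := integrableDR correlation_integrable sqrt_int.
have corr_sqrt_cst_int := integrableDR corr_sqrt_int c_int.
rewrite (RintegralD measurableT corr_sqrt_cst_int excess_int).
rewrite (RintegralD measurableT corr_sqrt_int c_int).
rewrite (RintegralD measurableT correlation_integrable sqrt_int).
rewrite (RintegralZl _ measurableT sqrt_square_correlation_integrable).
rewrite (RintegralZl _ measurableT replaced_excess_integrable).
rewrite (prob_Rintegral_cst (iid n P \x P)%E) Rintegral_replaced_correlation add0r.
by rewrite -(law_Rintegral (law_snd (iid n P) P)).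
Qed.

Lemma fingerprint_le (i : 'I_n) :
  \int[iid n P]_x score_correlation x (tnth x i) <=
  2 * delta * t0 +
  2 * eps * Num.sqrt (\sum_jl (\int[iid n P]_x score_second_moment jl x) *
    \int[P]_x (tau jl.1 x * tau jl.2 x)) +
  2 * \int[P]_x excess x.
Proof.
apply: le_trans (Rintegral_score_correlation_le i) _.
rewrite Rintegral_replaced_correlation_boundE lerD2r addrC lerD2l ler_wpM2l ?mulr_ge0//.
apply: le_trans (prob_Rintegral_sqrt_le
  (fun z => score_square_correlation_ge0 z.1 z.2) square_correlation_integrable) _.
by rewrite (Rintegral_product_sumM (iid n P) sigma2_measurable sigma2_bounded
  (fun jl => tau2_int jl.1 jl.2)).
Qed.

End fingerprint.

(** * Exponentially tilted families over a box *)

Lemma measurable_invr (R : realType) : measurable_fun setT (@GRing.inv R).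
Proof.
have -> : [set: R] = [set 0] `|` ~` [set 0] by rewrite setUv.
have m0 : measurable (~` [set (0 : R)]) by exact: measurableC.
apply/measurable_funU => //; split; first exact: measurable_fun_set1.
apply: open_continuous_measurable_fun.
  by apply: closed_openC; exact: closed_eq.
by move=> x /set_mem/= /eqP x0; exact: inv_continuous.
Qed.

Section box_around.
Context (R : realType) (k : nat).
Implicit Types (m r a : 'I_k -> R) (eta : euclid R k).

Definition box_around m r : set (euclid R k) :=
  [set eta | forall j, `|tnth eta j - m j| <= r j].

Definition box_side m r j : set (measurableTypeR R) :=
  `[m j - r j, m j + r j]%classic.

Lemma measurable_box_side m r j : measurable (box_side m r j).
Proof. exact: measurable_itv. Qed.

Lemma box_aroundE m r :
  box_around m r = [set eta | forall j, box_side m r j (tnth eta j)].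
Proof.
by apply/seteqP; split => eta etaj j; have := etaj j;
  rewrite /box_side /= in_itv/= ler_distl.
Qed.

Lemma measurable_box_around m r : measurable (box_around m r).
Proof.
by rewrite box_aroundE; apply: measurable_entrywise => j; exact: measurable_box_side.
Qed.

Lemma sub_box_around m a r : (forall j, a j <= r j) ->
  box_around m a `<=` box_around m r.
Proof. by move=> ar eta aeta j; exact: le_trans (aeta j) (ar j). Qed.

Lemma box_around_replace m r eta j (u : R) :
  (forall l, l != j -> `|tnth eta l - m l| <= r l) ->
  box_around m r (replace eta j u) <-> `|u - m j| <= r j.
Proof.
move=> etal; split=> [/(_ j)|uj l]; first by rewrite tnth_replace_same.
by rewrite tnth_replace; case: eqVneq => [->//|lj]; exact: etal.
Qed.

Definition box_corner m r (f : {ffun 'I_k -> bool}) : euclid R k :=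
  [tuple m j + (if f j then r j else - r j) | j < k].

Lemma box_around_corner m r f : (forall j, 0 <= r j) ->
  box_around m r (box_corner m r f).
Proof.
move=> r0 j; rewrite tnth_mktuple addrAC subrr add0r.
by case: ifP => _; rewrite ?normrN ger0_norm.
Qed.

Definition box_reflection m eta : euclid R k := [tuple 2 * m j - tnth eta j | j < k].

Lemma box_around_reflection m r eta :
  box_around m r eta -> box_around m r (box_reflection m eta).
Proof.
move=> reta j; rewrite tnth_mktuple -normrN opprB.
by have -> : m j - (2 * m j - tnth eta j) = tnth eta j - m j by ring.
Qed.

End box_around.

Section tilted_family.
Context (R : realType) (d : measure_display) (X : measurableType d) (k : nat).
Variables (nu : probability X R) (T : 'I_k -> X -> R) (m r : 'I_k -> R).

Definition tilt_weight (eta : euclid R k) (x : X) : R :=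
  expR (\sum_(j < k) (tnth eta j - m j) * T j x).

Definition tilt_mass (eta : euclid R k) : R := \int[nu]_x tilt_weight eta x.

Definition tilt_mean (f : X -> R) (eta : euclid R k) : R :=
  (\int[nu]_x (f x * tilt_weight eta x)) / tilt_mass eta.

Definition tilt_cov (g : X -> R) (j : 'I_k) (eta : euclid R k) : R :=
  tilt_mean (fun x => g x * T j x) eta - tilt_mean g eta * tilt_mean (T j) eta.

(* A statistic whose parameter interval is a point need not be integrable;
   [tilted_degenerate] asks that it be dropped from the family. *)
Record tilted_family (P : euclid R k -> probability X R) : Prop := TiltedFamily {
  tilted_measurable : forall j, measurable_fun setT (T j);
  tilted_radius_ge0 : forall j, 0 <= r j;
  tilted_degenerate : forall j, r j = 0 -> forall x, T j x = 0;
  tilted_integrable : forall eta, box_around m r eta ->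
    nu.-integrable setT (EFin \o tilt_weight eta);
  tilted_density : forall eta, box_around m r eta ->
    has_density (P eta) nu (fun x => tilt_weight eta x / tilt_mass eta) }.

Lemma tilt_weight_gt0 eta x : 0 < tilt_weight eta x.
Proof. exact: expR_gt0. Qed.

Lemma tilt_weight_ge0 eta x : 0 <= tilt_weight eta x.
Proof. exact: expR_ge0. Qed.

Lemma tilt_weightE eta x :
  tilt_weight eta x = \prod_(j < k) expR ((tnth eta j - m j) * T j x).
Proof. by rewrite /tilt_weight expR_sum. Qed.

Lemma tilt_weight_reflection eta x :
  tilt_weight eta x * tilt_weight (box_reflection m eta) x = 1.
Proof.
rewrite /tilt_weight -expRD -big_split/= big1 ?expR0// => j _.
by rewrite tnth_mktuple; ring.
Qed.

Lemma tilt_mass_ge0 eta : 0 <= tilt_mass eta.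
Proof. by apply: Rintegral_ge0 => x _; exact: tilt_weight_ge0. Qed.

Section measurability.
Hypothesis mT : forall j, measurable_fun setT (T j).

Lemma measurable_tilt_weight2 : measurable_fun setT
  (fun z : euclid R k * X => tilt_weight z.1 z.2).
Proof.
apply: (measurableT_comp (@measurable_expR R)).
apply: measurable_sum => j; apply: measurable_funM; last exact: measurableT_comp.
apply: measurable_funB => //.
exact: (measurableT_comp (measurable_tnth j) measurable_fst).
Qed.

Lemma measurable_tilt_weight eta : measurable_fun setT (tilt_weight eta).
Proof. exact: (measurableT_comp measurable_tilt_weight2 (pair1_measurable eta)). Qed.

Lemma measurable_tilt_mass : measurable_fun setT tilt_mass.
Proof. exact: (measurable_Rintegral_param nu measurable_tilt_weight2). Qed.

Lemma measurable_tilt_mean (f : X -> R) : measurable_fun setT f ->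
  measurable_fun setT (tilt_mean f).
Proof.
move=> mf; apply: measurable_funM; last first.
  exact: (measurableT_comp (@measurable_invr R) measurable_tilt_mass).
apply: (measurable_Rintegral_param nu (f := fun z => f z.2 * tilt_weight z.1 z.2)).
by apply: measurable_funM; [exact: measurableT_comp|exact: measurable_tilt_weight2].
Qed.

Lemma measurable_tilt_cov (g : X -> R) j : measurable_fun setT g ->
  measurable_fun setT (tilt_cov g j).
Proof.
move=> mg; apply: measurable_funB.
  by apply: measurable_tilt_mean; exact: measurable_funM.
by apply: measurable_funM; exact: measurable_tilt_mean.
Qed.

End measurability.

Variable P : euclid R k -> probability X R.
Hypothesis PT : tilted_family P.

Let mT := tilted_measurable PT.
Let r_ge0 := tilted_radius_ge0 PT.
Let weight_integrable := tilted_integrable PT.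

Lemma tilt_mass_gt0 eta : box_around m r eta -> 0 < tilt_mass eta.
Proof.
move=> reta; rewrite lt_neqAle tilt_mass_ge0 andbT; apply/eqP => mass0.
have [_ _ /(_ (cst 1%E))] := tilted_density PT reta.
rewrite integral_prob_cst => /(_ (measurable_cst _) (fun=> lee01)).
rewrite -mass0; under eq_integral do rewrite invr0 mulr0 mule0.
by rewrite integral0 => /eqP; rewrite onee_eq0.
Qed.

Section inside_the_box.
Variable eta : euclid R k.
Hypothesis reta : box_around m r eta.

Lemma tilted_family_integrable (f : X -> R) : measurable_fun setT f ->
  nu.-integrable setT (EFin \o (fun x => f x * tilt_weight eta x)) ->
  (P eta).-integrable setT (EFin \o f).
Proof.
move=> mf fi; apply/(density_integrable (tilted_density PT reta)) => //.
apply: (eq_integrable measurableT) (integrableZR (tilt_mass eta)^-1 fi) => // x _ /=.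
by rewrite mulrC mulrA.
Qed.

Lemma tilt_meanE (f : X -> R) : measurable_fun setT f ->
  nu.-integrable setT (EFin \o (fun x => f x * tilt_weight eta x)) ->
  tilt_mean f eta = \int[P eta]_x f x.
Proof.
move=> mf fi; rewrite (density_Rintegral (tilted_density PT reta))//.
by rewrite /tilt_mean -RintegralZr//; apply: eq_Rintegral => x _; rewrite mulrA.
Qed.

Lemma bounded_tilt_integrable (g : X -> R) (c : R) : measurable_fun setT g ->
  (forall x, `|g x| <= c) ->
  nu.-integrable setT (EFin \o (fun x => g x * tilt_weight eta x)).
Proof. by move=> mg gc; exact: integrableMR_bounded gc (weight_integrable reta). Qed.

Lemma tilt_mean_bounded (g : X -> R) (c : R) : measurable_fun setT g ->
  (forall x, `|g x| <= c) -> `|tilt_mean g eta| <= c.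
Proof.
move=> mg gc; rewrite tilt_meanE//; last exact: bounded_tilt_integrable gc.
exact: (prob_bounded_Rintegral (P eta) mg gc).
Qed.

End inside_the_box.

Definition cosh_bound (x : X) : R := \prod_(j < k) twocosh (r j) (T j x).

Lemma cosh_boundE x :
  cosh_bound x = \sum_(f : {ffun 'I_k -> bool}) tilt_weight (box_corner m r f) x.
Proof.
rewrite /cosh_bound; under eq_bigr => j _.
  have -> : twocosh (r j) (T j x) =
      \sum_(b : bool) expR ((if b then r j else - r j) * T j x).
    by rewrite big_bool.
  over.
rewrite bigA_distr_bigA/=; apply: eq_bigr => f _.
rewrite tilt_weightE; apply: eq_bigr => j _.
by rewrite tnth_mktuple addrAC subrr add0r.
Qed.

Lemma cosh_bound_integrable : nu.-integrable setT (EFin \o cosh_bound).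
Proof.
rewrite (_ : cosh_bound = fun x =>
  \sum_(f : {ffun 'I_k -> bool}) tilt_weight (box_corner m r f) x); last first.
  by apply/funext => x; exact: cosh_boundE.
apply: integrable_sumR => // f; apply: weight_integrable.
exact: box_around_corner.
Qed.

Lemma tilt_weight_le_cosh_bound eta x : box_around m r eta ->
  tilt_weight eta x <= cosh_bound x.
Proof.
move=> reta; rewrite tilt_weightE; apply: ler_prod => j _.
by rewrite expR_ge0/= expR_le_twocosh.
Qed.

Definition cosh_mass : R := \int[nu]_x cosh_bound x.

Lemma tilt_mass_le eta : box_around m r eta -> tilt_mass eta <= cosh_mass.
Proof.
move=> reta; apply: le_Rintegral => //; first exact: weight_integrable.
  exact: cosh_bound_integrable.
by move=> x _; exact: tilt_weight_le_cosh_bound.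
Qed.

Lemma cosh_mass_gt0 : 0 < cosh_mass.
Proof.
have corner := box_around_corner m [ffun=> true] r_ge0.
exact: lt_le_trans (tilt_mass_gt0 corner) (tilt_mass_le corner).
Qed.

(* The weights at [eta] and at its reflection in the centre of the box multiply
   to 1, so AM-GM bounds the two masses from below jointly. *)
Lemma tilt_mass_ge eta : box_around m r eta -> cosh_mass^-1 <= tilt_mass eta.
Proof.
move=> reta; pose eta' := box_reflection m eta.
have reta' : box_around m r eta' by exact: box_around_reflection.
have c0 := cosh_mass_gt0; set c := cosh_mass in c0 *.
have weight_int := integrableZR c (weight_integrable reta).
have reflected_weight_int := integrableZR c^-1 (weight_integrable reta').
have sum_ge2 : 2 <= c * tilt_mass eta + c^-1 * tilt_mass eta'.
  rewrite /tilt_mass -RintegralZl//; last exact: weight_integrable.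
  rewrite -RintegralZl//; last exact: weight_integrable.
  rewrite -RintegralD// -[leLHS](prob_Rintegral_cst nu).
  apply: le_Rintegral => //; first exact: prob_integrable_cst.
    exact: integrableDR.
  move=> x _; have := tilt_weight_reflection eta x; have := tilt_weight_gt0 eta x.
  rewrite -/eta'; move: (tilt_weight eta x) (tilt_weight eta' x) => a b a0 ab.
  rewrite -(ler_pM2l (mulr_gt0 c0 a0)).
  have -> : c * a * (c * a + c^-1 * b) = (c * a) ^+ 2 + (a * b) * (c / c) by ring.
  rewrite ab mulfV ?gt_eqF// mul1r.
  have := sqr_ge0 (c * a - 1); lra.
have mass'_le1 : c^-1 * tilt_mass eta' <= 1.
  by rewrite -(ler_pM2l c0) mulVKf ?gt_eqF// mulr1 tilt_mass_le.
rewrite -(ler_pM2l c0) mulfV ?gt_eqF//; lra.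
Qed.

Lemma tilt_weight_dominated (y c : R) eta j x : box_around m r eta ->
  0 <= y -> 0 <= c ->
  y * expR ((tnth eta j - m j) * T j x) <= c * twocosh (r j) (T j x) ->
  y * tilt_weight eta x <= c * cosh_bound x.
Proof.
move=> reta y0 c0 yc.
rewrite tilt_weightE /cosh_bound (bigD1 j)//= [X in c * X](bigD1 j)//= !mulrA.
apply: ler_pM => //.
- by rewrite mulr_ge0// expR_ge0.
- by apply: prodr_ge0 => l _; rewrite expR_ge0.
- by apply: ler_prod => l _; rewrite expR_ge0/= expR_le_twocosh.
Qed.

Lemma tilt_mean_dominated (f : X -> R) (c : R) eta : measurable_fun setT f ->
  box_around m r eta ->
  (forall x, `|f x| * tilt_weight eta x <= c * cosh_bound x) ->
  `|tilt_mean f eta| <= c * cosh_mass * cosh_mass.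
Proof.
move=> mf reta fc; have bound_int := integrableZR c cosh_bound_integrable.
have norm_fwE x : `|f x * tilt_weight eta x| = `|f x| * tilt_weight eta x.
  by rewrite normrM (ger0_norm (tilt_weight_ge0 _ _)).
have fw_int : nu.-integrable setT (EFin \o (fun x => f x * tilt_weight eta x)).
  apply: le_integrableR bound_int => [|x]; last by rewrite norm_fwE.
  by apply: measurable_funM => //; exact: measurable_tilt_weight.
rewrite /tilt_mean normrM; apply: ler_pM => //.
  apply: le_trans (le_normr_Rintegral measurableT fw_int) _.
  rewrite -RintegralZl//; last exact: cosh_bound_integrable.
  apply: le_Rintegral => //; first exact: integrable_norm fw_int.
  by move=> x _; rewrite norm_fwE.
rewrite gtr0_norm ?invr_gt0 ?tilt_mass_gt0// -[leRHS]invrK.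
by rewrite lef_pV2 ?posrE ?tilt_mass_gt0 ?invr_gt0 ?cosh_mass_gt0// tilt_mass_ge.
Qed.

Section inner_box.
Variable a : 'I_k -> R.
Hypotheses (ar : forall j, a j <= r j) (a_lt : forall j, r j != 0 -> a j < r j).

Lemma stat_tilt_weight_le eta j x : box_around m a eta ->
  `|T j x| * tilt_weight eta x <= (r j - a j)^-1 * cosh_bound x.
Proof.
move=> aeta; apply: (tilt_weight_dominated (j := j)) => //.
- exact: sub_box_around aeta.
- by rewrite invr_ge0 subr_ge0.
have [r0|r0] := eqVneq (r j) 0; last first.
  by rewrite mulrC [leRHS]mulrC mulrC norm_expR_le_twocosh ?a_lt.
rewrite (tilted_degenerate PT) // normr0 mul0r.
by rewrite mulr_ge0 ?twocosh_ge0 ?invr_ge0 ?subr_ge0.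
Qed.

Lemma sqr_stat_tilt_weight_le eta j x : box_around m a eta ->
  T j x ^+ 2 * tilt_weight eta x <= (2 / (r j - a j)) ^+ 2 * 2 * cosh_bound x.
Proof.
move=> aeta; apply: (tilt_weight_dominated (j := j)); rewrite ?sqr_ge0//.
- exact: sub_box_around aeta.
- by rewrite mulr_ge0 ?sqr_ge0.
have [r0|r0] := eqVneq (r j) 0; last first.
  by rewrite -[leRHS]mulrA sqr_expR_le_twocosh ?a_lt.
rewrite (tilted_degenerate PT)// expr0n mul0r.
by rewrite mulr_ge0 ?twocosh_ge0// mulr_ge0 ?sqr_ge0.
Qed.

Lemma stat_tilt_integrable eta j : box_around m a eta ->
  nu.-integrable setT (EFin \o (fun x => T j x * tilt_weight eta x)).
Proof.
move=> aeta.
apply: le_integrableR (integrableZR (r j - a j)^-1 cosh_bound_integrable) => [|x].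
  by apply: measurable_funM => //; exact: measurable_tilt_weight.
by rewrite normrM (ger0_norm (tilt_weight_ge0 _ _)) stat_tilt_weight_le.
Qed.

Lemma statM_tilt_integrable eta j l : box_around m a eta ->
  nu.-integrable setT (EFin \o (fun x => T j x * T l x * tilt_weight eta x)).
Proof.
move=> aeta; pose c i : R := (2 / (r i - a i)) ^+ 2 * 2.
apply: le_integrableR (integrableZR (c j + c l) cosh_bound_integrable) => [|x].
  apply: measurable_funM; first exact: measurable_funM.
  exact: measurable_tilt_weight.
rewrite normrM (ger0_norm (tilt_weight_ge0 _ _)) mulrDl.
have sq i := sqr_stat_tilt_weight_le i x aeta.
apply: le_trans (lerD (sq j) (sq l)).
rewrite -mulrDl ler_wpM2r ?tilt_weight_ge0// normrM.
rewrite -(real_normK (num_real (T j x))) -(real_normK (num_real (T l x))).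
have := sqr_ge0 (`|T j x| - `|T l x|).
have : 0 <= `|T j x| * `|T l x| by rewrite mulr_ge0.
lra.
Qed.

Lemma tilted_stat_integrable eta j : box_around m a eta ->
  (P eta).-integrable setT (EFin \o T j).
Proof.
move=> aeta; apply: tilted_family_integrable (stat_tilt_integrable j aeta) => //.
exact: sub_box_around aeta.
Qed.

Lemma tilted_statM_integrable eta j l : box_around m a eta ->
  (P eta).-integrable setT (EFin \o (fun x => T j x * T l x)).
Proof.
move=> aeta; apply: tilted_family_integrable (statM_tilt_integrable j l aeta).
  exact: sub_box_around aeta.
exact: measurable_funM.
Qed.

Lemma tilt_mean_stat eta j : box_around m a eta ->
  tilt_mean (T j) eta = \int[P eta]_x T j x.
Proof.
move=> aeta; apply: tilt_meanE => //; first exact: sub_box_around aeta.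
exact: stat_tilt_integrable.
Qed.

Lemma tilt_covE (g : X -> R) (c : R) j eta : measurable_fun setT g ->
  (forall x, `|g x| <= c) -> box_around m a eta ->
  tilt_cov g j eta =
  \int[P eta]_x (g x * T j x) - (\int[P eta]_x g x) * \int[P eta]_x T j x.
Proof.
move=> mg gc aeta; have reta := sub_box_around ar aeta.
have gTw_int : nu.-integrable setT
    (EFin \o (fun x => g x * T j x * tilt_weight eta x)).
  have := integrableMR_bounded mg gc (stat_tilt_integrable j aeta).
  by apply: eq_integrable => // x _ /=; rewrite mulrA.
rewrite /tilt_cov (tilt_meanE reta (measurable_funM mg (mT j)) gTw_int).
by rewrite (tilt_meanE reta mg (bounded_tilt_integrable reta mg gc)) tilt_mean_stat.
Qed.

Lemma tilt_cov_bounded (g : X -> R) (c : R) j : measurable_fun setT g ->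
  (forall x, `|g x| <= c) ->
  exists B : R, forall eta, box_around m a eta -> `|tilt_cov g j eta| <= B.
Proof.
move=> mg gc; pose b := (r j - a j)^-1.
exists (c * b * cosh_mass * cosh_mass + c * (b * cosh_mass * cosh_mass)) => eta aeta.
have reta := sub_box_around ar aeta.
apply: le_trans (ler_normB _ _) _; apply: lerD.
  apply: tilt_mean_dominated => // [|x]; first exact: measurable_funM.
  rewrite normrM -!mulrA; apply: ler_pM => //; last exact: stat_tilt_weight_le.
  by rewrite mulr_ge0// tilt_weight_ge0.
rewrite normrM; apply: ler_pM => //; first exact: tilt_mean_bounded.
by apply: tilt_mean_dominated => // x; exact: stat_tilt_weight_le.
Qed.

Section slice.
Variables (j : 'I_k) (eta : euclid R k).
Hypothesis etal : forall l, l != j -> `|tnth eta l - m l| <= r l.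

Definition slice_weight (x : X) : R :=
  expR (\sum_(l < k | l != j) (tnth eta l - m l) * T l x).

Lemma tilt_weight_replace (u : R) x : tilt_weight (replace eta j u) x =
  slice_weight x * expR ((u - m j) * T j x).
Proof.
rewrite /tilt_weight (bigD1 j)//= tnth_replace_same expRD mulrC; congr (expR _ * _).
by apply: eq_bigr => l lj; rewrite tnth_replace (negbTE lj).
Qed.

Lemma measurable_slice_weight : measurable_fun setT slice_weight.
Proof.
apply: (measurableT_comp (@measurable_expR R)); under eq_fun do rewrite big_mkcond.
by apply: measurable_sum => l; case: (l != j) => //; exact: measurable_funM.
Qed.

Lemma slice_weight_exp_integrable : exp_integrable nu (T j) (r j) slice_weight.
Proof.
split; first exact: measurable_slice_weight.
have upper_face : box_around m r (replace eta j (m j + r j)).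
  by apply/(box_around_replace _ etal); rewrite addrAC subrr add0r ger0_norm.
have lower_face : box_around m r (replace eta j (m j - r j)).
  by apply/(box_around_replace _ etal); rewrite addrAC subrr add0r normrN ger0_norm.
apply: (eq_integrable measurableT)
  (integrableDR (weight_integrable upper_face) (weight_integrable lower_face)) => // x _ /=.
rewrite !tilt_weight_replace /twocosh mulrDr; congr (_ * expR _ + _ * expR _)%:E.
  by congr (_ * _); ring.
by congr (_ * _); ring.
Qed.

Lemma Rintegral_slice (f : X -> R) (u : R) :
  \int[nu]_x (f x * tilt_weight (replace eta j u) x) =
  tilt_integral nu (T j) (m j) (fun x => f x * slice_weight x) u.
Proof. by apply: eq_Rintegral => x _; rewrite tilt_weight_replace mulrA. Qed.

Lemma tilt_mass_slice (u : R) : tilt_mass (replace eta j u) =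
  tilt_integral nu (T j) (m j) slice_weight u.
Proof. by apply: eq_Rintegral => x _; rewrite tilt_weight_replace. Qed.

Lemma tilt_mean_slice (f : X -> R) (u : R) : tilt_mean f (replace eta j u) =
  tilt_average nu (T j) (m j) slice_weight f u.
Proof. by rewrite /tilt_mean Rintegral_slice tilt_mass_slice. Qed.

Lemma tilt_cov_by_parts (g : X -> R) (c : R) : measurable_fun setT g ->
  (forall x, `|g x| <= c) -> 0 < a j ->
  \int[lebesgue_measure]_(u in `[m j - a j, m j + a j])
    ((r j ^+ 2 - (u - m j) ^+ 2) * tilt_cov g j (replace eta j u)) =
  (r j ^+ 2 - a j ^+ 2) * (tilt_mean g (replace eta j (m j + a j)) -
                           tilt_mean g (replace eta j (m j - a j))) +
  \int[lebesgue_measure]_(u in `[m j - a j, m j + a j])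
    (2 * (u - m j) * tilt_mean g (replace eta j u)).
Proof.
move=> mg gc a0; have rj : r j != 0 by rewrite gt_eqF// (lt_le_trans a0).
have mass_gt0 u : `|u - m j| < r j -> 0 < tilt_integral nu (T j) (m j) slice_weight u.
  move=> ur; rewrite -tilt_mass_slice; apply: tilt_mass_gt0.
  by apply/(box_around_replace _ etal); exact: ltW.
have := tilt_covariance_by_parts (mT j) a0 (a_lt rj) mg gc
  slice_weight_exp_integrable mass_gt0.
rewrite -!tilt_mean_slice => by_parts; apply: etrans (etrans _ by_parts) _.
  by apply: eq_Rintegral => u _; rewrite /tilt_cov !tilt_mean_slice.
by congr (_ + _); apply: eq_Rintegral => u _; rewrite tilt_mean_slice.
Qed.

End slice.
End inner_box.
End tilted_family.

Section iid_tilted_family.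
Context (R : realType) (d : measure_display) (X : measurableType d) (k n : nat).
Variables (nu : probability X R) (T : 'I_k -> X -> R) (m r : 'I_k -> R).
Variable P : euclid R k -> probability X R.
Hypothesis PT : tilted_family nu T m r P.

Definition sum_stat (j : 'I_k) (x : n.-tuple X) : R := \sum_(i < n) T j (tnth x i).

Lemma measurable_sum_stat j : measurable_fun setT (sum_stat j).
Proof.
apply: measurable_sum => i.
exact: (measurableT_comp (tilted_measurable PT j) (measurable_tnth i)).
Qed.

Lemma tilt_weight_sum_stat eta (x : n.-tuple X) :
  tilt_weight sum_stat m eta x = \prod_(i < n) tilt_weight T m eta (tnth x i).
Proof.
rewrite /tilt_weight -expR_sum exchange_big/=; congr expR.
by apply: eq_bigr => j _; rewrite -mulr_sumr.
Qed.

Lemma iid_tilted_family :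
  tilted_family (iid n nu) sum_stat m r (fun eta => iid n (P eta)).
Proof.
have reweighted eta : box_around m r eta ->
    (iid n nu).-integrable setT (EFin \o tilt_weight sum_stat m eta) /\
    has_density (iid n (P eta)) (iid n nu)
      (fun x => tilt_weight sum_stat m eta x / tilt_mass (iid n nu) sum_stat m eta).
  move=> reta; set Z := tilt_mass nu T m eta.
  have Z0 : Z ^+ n != 0 by rewrite expf_neq0// gt_eqF// (tilt_mass_gt0 PT).
  pose q (x : n.-tuple X) := \prod_(i < n) (tilt_weight T m eta (tnth x i) / Z).
  have Pq : has_density (iid n (P eta)) (iid n nu) q.
    exact: (product_prob_density (fun i : 'I_n => tilted_density PT reta)).
  have weightE x : tilt_weight sum_stat m eta x = Z ^+ n * q x.
    rewrite tilt_weight_sum_stat /q big_split/= prodr_const card_ord exprVn.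
    by rewrite mulrCA mulfV ?mulr1.
  have qi := density_total_integrable Pq.
  have massE : tilt_mass (iid n nu) sum_stat m eta = Z ^+ n.
    rewrite /tilt_mass; under eq_Rintegral do rewrite weightE.
    by rewrite RintegralZl// (density_total Pq) mulr1.
  split.
    by apply: (eq_integrable measurableT) (integrableZR (Z ^+ n) qi) => // x _;
      rewrite /= weightE.
  rewrite massE (_ : (fun x => _) = q)//; apply/funext => x.
  by rewrite weightE mulrC mulKf.
split=> [||j r0 x|eta /reweighted[]//|eta /reweighted[]//].
- exact: measurable_sum_stat.
- exact: tilted_radius_ge0 PT.
- by rewrite /sum_stat big1// => i _; exact: (tilted_degenerate PT r0).
Qed.

End iid_tilted_family.

(** * Averaging over a uniform parameter *)

Section uniform_interval.
Context (R : realType).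
Implicit Types (a b c r : R).
Local Notation mu := (@lebesgue_measure R).

Lemma uniform_itv_degenerate a b : b <= a ->
  uniform_itv a b = \d_(a : measurableTypeR R) :> probability _ _.
Proof. by rewrite /uniform_itv; case: pselect => // ab; rewrite leNgt ab. Qed.

Lemma ge0_integral_uniform_itv a b (f : measurableTypeR R -> \bar R) : a < b ->
  measurable_fun setT f -> (forall x, 0 <= f x)%E ->
  (\int[uniform_itv a b]_x f x = (b - a)^-1%:E * \int[mu]_(x in `[a, b]) f x)%E.
Proof.
move=> ab mf f0; rewrite /uniform_itv; case: pselect => // {}ab.
exact: integral_uniform.
Qed.

Lemma bounded_integrable_itv a b c (f : measurableTypeR R -> R) :
  measurable_fun setT f -> (forall x, a <= x <= b -> `|f x| <= c) ->
  mu.-integrable `[a, b] (EFin \o f).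
Proof.
move=> mf fc; apply: (bounded_integrableR (c := c)) => //.
- rewrite [X in (X < _)%E](_ : _ = mu `[a, b]%classic)//.
  by rewrite lebesgue_measure_itv/=; case: ifPn => // _; rewrite -EFinB ltry.
- exact: measurable_funTS.
Qed.

Lemma uniform_itv_density a b : a < b ->
  has_density (uniform_itv a b) mu
    (fun x => (b - a)^-1 * \1_(`[a, b]%classic : set (measurableTypeR R)) x).
Proof.
move=> ab; have ba0 : 0 <= (b - a)^-1 by rewrite invr_ge0 subr_ge0 ltW.
split=> [|x|f mf f0]; last 1 first.
- rewrite ge0_integral_uniform_itv// -ge0_integralZl//; last exact: measurable_funTS.
  rewrite integral_mkcond; apply: eq_integral => x _.
  by rewrite patchE indicE; case: ifPn => _; rewrite ?mulr1 ?mulr0 ?mule0// muleC.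
- exact: measurable_funM.
- by rewrite mulr_ge0.
Qed.

Lemma Rintegral_uniform_itv a b c (f : measurableTypeR R -> R) : a < b ->
  measurable_fun setT f -> (forall x, a <= x <= b -> `|f x| <= c) ->
  \int[uniform_itv a b]_x f x = (b - a)^-1 * \int[mu]_(x in `[a, b]) f x.
Proof.
move=> ab mf fc; rewrite (density_Rintegral (uniform_itv_density ab))//.
rewrite -RintegralZl//; last exact: bounded_integrable_itv mf fc.
rewrite [RHS]Rintegral_mkcond; apply: eq_Rintegral => x _.
by rewrite patchE indicE; case: ifPn => _; rewrite ?mulr1 ?mulr0// mulrC.
Qed.

Lemma uniform_itv_setC_inner c r a : 0 <= a -> a <= r ->
  uniform_itv (c - r) (c + r) (~` (`[c - a, c + a]%classic : set (measurableTypeR R))) =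
  ((r - a) / r)%:E.
Proof.
move=> a0 ar.
have mI : measurable (`[c - a, c + a]%classic : set (measurableTypeR R)).
  exact: measurable_itv.
have [r0|r0] := leP r 0.
  have rE : r = 0 by apply/le_anti; rewrite r0 (le_trans a0).
  rewrite rE invr0 mulr0 subr0 addr0 uniform_itv_degenerate// /= diracE memNset//.
  by apply; rewrite /= in_itv/= gerBl lerDl a0.
have crr : c - r < c + r by lra.
rewrite probability_setC//; set U := uniform_itv _ _.
have -> : U `[c - a, c + a]%classic = (a / r)%:E.
  transitivity (\int[U]_x (\1_`[c - a, c + a] x)%:E)%E.
    by rewrite integral_indic// setIT.
  rewrite ge0_integral_uniform_itv//; last first.
    by apply/measurable_EFinP; exact: measurable_indic.
  rewrite integral_indic//.
  have -> : (`[c - a, c + a] `&` `[c - r, c + r])%classic = `[c - a, c + a]%classic :> set R.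
    by apply/setIidPl => x /=; rewrite !in_itv/= => /andP[x1 x2]; apply/andP; split; lra.
  rewrite [X in (_ * X)%E](_ : _ = mu `[c - a, c + a]%classic)//.
  rewrite lebesgue_measure_itv/= lte_fin; case: ltP => [_|caa].
    by rewrite -EFinB -EFinM; congr EFin; field; lra.
  by have -> : a = 0 by [lra]; rewrite mul0r mule0.
by rewrite -EFinB mulrBl mulfV// gt_eqF.
Qed.

Lemma uniform_itv_conull c r : 0 <= r ->
  uniform_itv (c - r) (c + r) (~` (`[c - r, c + r]%classic : set (measurableTypeR R))) = 0%E.
Proof. by move=> r0; rewrite uniform_itv_setC_inner// subrr mul0r. Qed.

Lemma is_derive_cube c (u : R) :
  is_derive u (1 : R) (fun v : R => (v - c) ^+ 3 / 3) ((u - c) ^+ 2).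
Proof.
have -> : (fun v => (v - c) ^+ 3 / 3) =
    3^-1 \*: ((id - cst c) * (id - cst c) * (id - cst c)).
  apply/funext => w; transitivity (3^-1 * ((w - c) * (w - c) * (w - c))); last by [].
  by field.
by apply: is_derive_eq; rewrite /GRing.scale/= !fctE; field.
Qed.

Lemma uniform_itv_variance c r : 0 <= r ->
  (\int[uniform_itv (c - r) (c + r)]_u ((u - c) ^+ 2)%:E = (r ^+ 2 / 3)%:E)%E.
Proof.
have msq : measurable_fun setT (fun u : measurableTypeR R => ((u - c) ^+ 2)%:E).
  by apply/measurable_EFinP; apply: measurable_funX; exact: measurable_funB.
rewrite le_eqVlt => /orP[/eqP <-|r0].
  rewrite subr0 addr0 uniform_itv_degenerate// integral_dirac//.
  by rewrite diracT mul1e subrr expr0n mul0r.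
have crr : c - r < c + r by lra.
rewrite ge0_integral_uniform_itv//; last by move=> u; rewrite lee_fin sqr_ge0.
pose F (u : R) := (u - c) ^+ 3 / 3.
have cF (u : R) : {for u, continuous F}.
  apply: differentiable_continuous; apply/derivable1_diffP.
  by have [] := is_derive_cube c u.
rewrite (continuous_FTC2 (F := F))//.
- by rewrite -EFinB -EFinM; congr EFin; rewrite /F; field; lra.
- apply: continuous_subspaceT => u.
  apply: (@continuous_comp _ _ _ (fun v : R => v - c) (fun v : R => v ^+ 2)).
    by apply: cvgB; [exact: cvg_id|exact: cvg_cst].
  exact: exprn_continuous.
- split.
  + by move=> u _; have [] := is_derive_cube c u.
  + by apply: cvg_at_right_filter; exact: cF.
  + by apply: cvg_at_left_filter; exact: cF.
- by move=> u _; rewrite derive1E; have [_] := is_derive_cube c u.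
Qed.

End uniform_interval.

Section uniform_around.
Context (R : realType) (k : nat).
Variables (m r a : 'I_k -> R).
Hypotheses (a_ge0 : forall j, 0 <= a j) (ar : forall j, a j <= r j).

Definition uniform_side (j : 'I_k) : probability (measurableTypeR R) R :=
  uniform_itv (m j - r j) (m j + r j).

Definition uniform_around : probability (euclid R k) R := product_prob uniform_side.

Let r_ge0 j : 0 <= r j. Proof. exact: le_trans (ar j). Qed.

Definition shrink_defect : R := \sum_j (r j - a j) / r j.

Lemma uniform_around_setC_le :
  (uniform_around (~` box_around m a) <= shrink_defect%:E)%E.
Proof.
rewrite box_aroundE.
apply: le_trans (product_prob_setC_le uniform_side (measurable_box_side m a)) _.
by under eq_bigr do rewrite uniform_itv_setC_inner//; rewrite sumEFin.
Qed.

Lemma uniform_around_variance_ge (j : 'I_k) :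
  r j ^+ 2 / 3 - r j ^+ 2 * shrink_defect <=
  \int[uniform_around]_(eta in box_around m a) (tnth eta j - m j) ^+ 2.
Proof.
set A := box_around m a; set B := box_around m r.
pose f (eta : euclid R k) : R := (tnth eta j - m j) ^+ 2.
have mf : measurable_fun setT f.
  by apply: measurable_funX; apply: measurable_funB => //; exact: measurable_tnth.
have mfE D : measurable_fun D (EFin \o f) by apply: measurable_funTS; exact/measurable_EFinP.
have f_ge0 eta : (0 <= (f eta)%:E)%E by rewrite lee_fin sqr_ge0.
have f_le eta : B eta -> f eta <= r j ^+ 2.
  by move=> /(_ j) Beta; rewrite /f -(real_normK (num_real _)) ler_pXn2r ?nnegrE.
have mA : measurable A by exact: measurable_box_around.
have mB : measurable B by exact: measurable_box_around.
have mBA : measurable (B `\` A) by exact: measurableD.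
have AB : A `<=` B by exact: sub_box_around.
have B_conull : uniform_around (~` B) = 0%E.
  rewrite /B box_aroundE.
  apply: (product_prob_conull (measurable_box_side m r)) => l.
  exact: uniform_itv_conull.
have f_int : uniform_around.-integrable A (EFin \o f).
  apply: (bounded_integrableR (c := r j ^+ 2)) => //; first exact: prob_lty.
    exact: measurable_funTS.
  by move=> eta Aeta; rewrite ger0_norm ?sqr_ge0// f_le//; exact: AB.
rewrite lerBlDr -lee_fin EFinD /Rintegral fineK; last exact: integrable_fin_num f_int.
rewrite -(uniform_itv_variance (m j) (r_ge0 j)).
rewrite (law_ge0_integral (law_tnth uniform_side j)); last 2 first.
- by apply/measurable_EFinP; apply: measurable_funX; exact: measurable_funB.
- by move=> u; rewrite lee_fin sqr_ge0.
have mCB : measurable (~` B) by exact: measurableC.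
rewrite (ge0_negligible_integral mCB measurableT (mfE _) (fun x _ => f_ge0 x) B_conull).
rewrite setTD setCK -(setDUK AB) ge0_integral_setU//; last 2 first.
- by move=> eta _; exact: f_ge0.
- by apply/disj_setPRL => eta [].
apply: leeD2l; rewrite EFinM.
apply: (@le_trans _ _ (\int[uniform_around]_(eta in B `\` A) (r j ^+ 2)%:E)%E).
  by apply: ge0_le_integral_subset => // eta [Beta _]; rewrite lee_fin ?sqr_ge0 ?f_le.
rewrite integral_cst//; apply: lee_wpmul2l; first by rewrite lee_fin sqr_ge0.
apply: le_trans uniform_around_setC_le; apply: le_measure; rewrite ?inE//.
exact: measurableC.
Qed.

End uniform_around.

Section box_by_parts.
Context (R : realType) (d : measure_display) (X : measurableType d) (k : nat).
Variables (nu : probability X R) (T : 'I_k -> X -> R) (m r a : 'I_k -> R).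
Variable P : euclid R k -> probability X R.
Hypotheses (PT : tilted_family nu T m r P) (a_ge0 : forall j, 0 <= a j)
  (ar : forall j, a j <= r j) (a_in : forall j, r j != 0 -> 0 < a j < r j).
Variables (g : X -> R) (j : 'I_k).
Hypotheses (mg : measurable_fun setT g) (g_le : forall x, `|g x| <= r j).

Let mT := tilted_measurable PT.
Let r_ge0 := tilted_radius_ge0 PT.
Let a_lt l : r l != 0 -> a l < r l. Proof. by move=> /a_in/andP[]. Qed.
Let A := box_around m a.
Let mA : measurable A := measurable_box_around m a.
Let AB : A `<=` box_around m r := sub_box_around ar.

(* Vanishes on the two faces orthogonal to the [j]th axis, which makes the
   boundary terms of the integration by parts small. *)
Definition face_weight (i : 'I_k) (eta : euclid R k) : R :=
  r i ^+ 2 - (tnth eta i - m i) ^+ 2.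

Lemma measurable_face_weight i : measurable_fun setT (face_weight i).
Proof.
apply: measurable_funB => //; apply: measurable_funX; apply: measurable_funB => //.
exact: measurable_tnth.
Qed.

Lemma face_weight_itv i eta : box_around m r eta -> 0 <= face_weight i eta <= r i ^+ 2.
Proof.
move=> /(_ i); rewrite -(ler_pXn2r (n := 2))// ?nnegrE// real_normK ?num_real//.
by rewrite /face_weight subr_ge0 => ->/=; rewrite gerBl sqr_ge0.
Qed.

Lemma face_weight_degenerate i eta : r i = 0 -> box_around m r eta ->
  face_weight i eta = 0.
Proof.
move=> r0 /face_weight_itv -/(_ i); rewrite r0 expr0n => w0.
by apply/le_anti; rewrite andbC.
Qed.

Definition weighted_cov (eta : euclid R k) : R :=
  face_weight j eta * tilt_cov nu T m g j eta.

Definition centered_mean (eta : euclid R k) : R :=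
  2 * (tnth eta j - m j) * tilt_mean nu T m g eta.

Lemma measurable_weighted_cov : measurable_fun setT weighted_cov.
Proof.
apply: measurable_funM; first exact: measurable_face_weight.
exact: measurable_tilt_cov.
Qed.

Lemma measurable_centered_mean : measurable_fun setT centered_mean.
Proof.
apply: measurable_funM; last exact: measurable_tilt_mean.
by apply: measurable_funM => //; apply: measurable_funB => //; exact: measurable_tnth.
Qed.

Lemma weighted_cov_bounded : exists B, forall eta, A eta -> `|weighted_cov eta| <= B.
Proof.
have [B cov_le] := tilt_cov_bounded PT ar a_lt j mg g_le.
exists (r j ^+ 2 * B) => eta Aeta; rewrite normrM; apply: ler_pM => //; last exact: cov_le.
by have /andP[w0 w1] := face_weight_itv j (AB Aeta); rewrite ger0_norm.
Qed.

Lemma centered_mean_bounded eta : box_around m r eta ->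
  `|centered_mean eta| <= 2 * r j ^+ 2.
Proof.
move=> reta; have mean_le := tilt_mean_bounded PT reta mg g_le.
rewrite /centered_mean normrM [X in X * _]normrM (ger0_norm (x := 2))// -mulrA expr2.
by rewrite ler_pM2l//; apply: ler_pM.
Qed.

Let U := uniform_around m r.

Lemma weighted_cov_integrable : U.-integrable A (EFin \o weighted_cov).
Proof.
have [B cov_le] := weighted_cov_bounded.
apply: (bounded_integrableR (c := B)) => //; first exact: prob_lty.
exact: measurable_funTS measurable_weighted_cov.
Qed.

Lemma centered_mean_integrable : U.-integrable A (EFin \o centered_mean).
Proof.
apply: (bounded_integrableR (c := 2 * r j ^+ 2)) => //; first exact: prob_lty.
  exact: measurable_funTS measurable_centered_mean.
by move=> eta Aeta; apply: centered_mean_bounded; exact: AB.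
Qed.

Let gap eta : R := centered_mean eta - weighted_cov eta.

Let mgap : measurable_fun setT gap.
Proof.
by apply: measurable_funB;
  [exact: measurable_centered_mean|exact: measurable_weighted_cov].
Qed.

Let mgapA : measurable_fun setT (gap \_ A).
Proof. by apply/(measurable_restrictT _ mA); exact: measurable_funTS. Qed.

Let gap_bounded : exists B, forall eta, A eta -> `|gap eta| <= B.
Proof.
have [B cov_le] := weighted_cov_bounded; exists (2 * r j ^+ 2 + B) => eta Aeta.
apply: le_trans (ler_normB _ _) _; apply: lerD; last exact: cov_le.
by apply: centered_mean_bounded; exact: AB.
Qed.

Section slice.
Variable eta : euclid R k.
Hypothesis etal : forall l, l != j -> `|tnth eta l - m l| <= a l.

Let mslice f : measurable_fun setT f ->
  measurable_fun setT (fun u : measurableTypeR R => f (replace eta j u) : R).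
Proof.
by move=> mf; apply: measurableT_comp => //; exact: measurable_replace_entry.
Qed.

Let slice_in (u : R) : m j - a j <= u <= m j + a j -> A (replace eta j u).
Proof. by rewrite -ler_distl => ua; apply/(box_around_replace _ etal). Qed.

Lemma slice_gap_le : r j != 0 ->
  \int[lebesgue_measure]_(u in `[m j - a j, m j + a j]) gap (replace eta j u) <=
  (r j ^+ 2 - a j ^+ 2) * (2 * r j).
Proof.
move=> rj; have /andP[aj _] := a_in rj.
have [B cov_le] := weighted_cov_bounded.
have cov_int : (@lebesgue_measure R).-integrable `[m j - a j, m j + a j]
    (EFin \o (fun u => weighted_cov (replace eta j u))).
  apply: (bounded_integrable_itv (c := B)) => [|u /slice_in/cov_le//].
  exact: mslice measurable_weighted_cov.
have mean_int : (@lebesgue_measure R).-integrable `[m j - a j, m j + a j]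
    (EFin \o (fun u => centered_mean (replace eta j u))).
  apply: (bounded_integrable_itv (c := 2 * r j ^+ 2)) => [|u /slice_in Au].
    exact: mslice measurable_centered_mean.
  by apply: centered_mean_bounded; exact: AB.
have etalr l : l != j -> `|tnth eta l - m l| <= r l.
  by move=> /etal/le_trans; apply; exact: ar.
have mean_le u : m j - a j <= u <= m j + a j ->
    `|tilt_mean nu T m g (replace eta j u)| <= r j.
  by move=> /slice_in/AB reta; exact: (tilt_mean_bounded PT reta mg g_le).
have := tilt_cov_by_parts PT ar a_lt etalr mg g_le aj.
rewrite RintegralB//.
have -> : \int[lebesgue_measure]_(u in `[m j - a j, m j + a j])
    ((r j ^+ 2 - (u - m j) ^+ 2) * tilt_cov nu T m g j (replace eta j u)) =
    \int[lebesgue_measure]_(u in `[m j - a j, m j + a j]) weighted_cov (replace eta j u).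
  by apply: eq_Rintegral => u _; rewrite /weighted_cov /face_weight tnth_replace_same.
have -> : \int[lebesgue_measure]_(u in `[m j - a j, m j + a j])
    (2 * (u - m j) * tilt_mean nu T m g (replace eta j u)) =
    \int[lebesgue_measure]_(u in `[m j - a j, m j + a j]) centered_mean (replace eta j u).
  by apply: eq_Rintegral => u _; rewrite /centered_mean tnth_replace_same.
have endr : `|tilt_mean nu T m g (replace eta j (m j + a j))| <= r j.
  by apply: mean_le; lra.
have endl : `|tilt_mean nu T m g (replace eta j (m j - a j))| <= r j.
  by apply: mean_le; lra.
move=> ->; move: (\int[_]_(u in _) centered_mean _) endr endl => z.
move: (tilt_mean nu T m g (replace eta j (m j + a j)))
  (tilt_mean nu T m g (replace eta j (m j - a j))) => x y xr yr.
rewrite opprD addrCA subrr addr0 -mulrN opprB ler_wpM2l//.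
  by rewrite subr_ge0 ler_pXn2r// nnegrE.
rewrite (le_trans (ler_norm _))// (le_trans (ler_normB _ _))//.
by rewrite mulr2n mulrDl mul1r lerD.
Qed.

Lemma uniform_slice_gap_le :
  \int[uniform_side m r j]_u (gap \_ A) (replace eta j u) <= r j ^+ 2 - a j ^+ 2.
Proof.
have [rj|rj] := eqVneq (r j) 0.
  have aj : a j = 0 by apply/le_anti; rewrite a_ge0 andbT -rj.
  rewrite rj aj subrr; under eq_Rintegral => u _.
    rewrite (_ : (gap \_ A) _ = 0); first over.
    rewrite patchE; case: ifPn => // /set_mem Au; have /(_ j) := AB Au.
    rewrite rj normr_le0 /gap /centered_mean => /eqP ->.
    by rewrite /weighted_cov (face_weight_degenerate rj (AB Au)) mulr0 !mul0r subrr.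
  by rewrite prob_Rintegral_cst.
have [B gap_le] := gap_bounded.
have sliceE u : (gap \_ A) (replace eta j u) =
    ((fun u => gap (replace eta j u)) \_ (box_side m a j)) u.
  rewrite !patchE (_ : (_ \in A) = (u \in box_side m a j))//.
  by apply/idP/idP; rewrite !inE /box_side/= in_itv/= -ler_distl
    => /(box_around_replace _ etal).
have rj0 : 0 < r j by rewrite lt_neqAle eq_sym rj r_ge0.
have aj0 := a_ge0 j; have arj := ar j.
rewrite (Rintegral_uniform_itv (c := B)); last 3 first.
- by lra.
- exact: mslice.
- move=> u _; rewrite patchE; case: ifPn => [/set_mem/gap_le//|_].
  by rewrite normr0 (le_trans (normr_ge0 _) (gap_le _ (slice_in (u := m j) _)))//; lra.
under eq_Rintegral do rewrite sliceE.
rewrite -Rintegral_mkcondr (_ : _ `&` _ = box_side m a j); last first.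
  apply/setIidPr => u; rewrite /box_side/= !in_itv/= => /andP[au ua].
  by apply/andP; split; lra.
rewrite mulrC ler_pdivrMr; last by lra.
apply: le_trans (slice_gap_le rj) _.
by rewrite le_eqVlt; apply/orP; left; apply/eqP; ring.
Qed.

End slice.

Lemma box_by_parts :
  \int[U]_(eta in A) centered_mean eta - (r j ^+ 2 - a j ^+ 2) <=
  \int[U]_(eta in A) weighted_cov eta.
Proof.
have [B gap_le] := gap_bounded.
have gapA_le eta : `|(gap \_ A) eta| <= `|B|.
  rewrite patchE; case: ifPn => [/set_mem Aeta|_]; last by rewrite normr0.
  exact: le_trans (gap_le _ Aeta) (ler_norm _).
have ra0 : 0 <= r j ^+ 2 - a j ^+ 2 by rewrite subr_ge0 ler_pXn2r// nnegrE.
rewrite lerBlDr -lerBlDl -RintegralB//; last 2 first.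
- exact: centered_mean_integrable.
- exact: weighted_cov_integrable.
rewrite -/(gap _) Rintegral_mkcond (Rintegral_replace (uniform_side m r) j mgapA gapA_le).
rewrite -[leRHS](prob_Rintegral_cst U); apply: le_Rintegral => //.
- apply: (prob_bounded_integrable _ (c := `|B|)) => [|eta].
    apply: (measurable_Rintegral_param (uniform_side m r j)
      (f := fun z : euclid R k * measurableTypeR R => (gap \_ A) (replace z.1 j z.2))).
    by apply: measurableT_comp => //; exact: measurable_replace.
  apply: prob_bounded_Rintegral => [|u]; last exact: gapA_le.
  by apply: measurableT_comp => //; exact: measurable_replace_entry.
- exact: prob_integrable_cst.
move=> eta _.
have [etal|netal] := pselect (forall l, l != j -> `|tnth eta l - m l| <= a l).
  exact: uniform_slice_gap_le.
under eq_Rintegral => u _.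
  rewrite (_ : (gap \_ A) _ = 0); first over.
  rewrite patchE memNset// => Au; apply: netal => l lj.
  by have := Au l; rewrite tnth_replace (negbTE lj).
by rewrite prob_Rintegral_cst.
Qed.

End box_by_parts.

(** * Private mechanisms on a tilted family *)

Lemma sum_norm_le_sqrt (R : rcfType) (I : finType) (a : I -> R) :
  \sum_j `|a j| <= Num.sqrt #|I|%:R * Num.sqrt (\sum_j a j ^+ 2).
Proof.
have sq0 : 0 <= \sum_j a j ^+ 2 by apply: sumr_ge0 => j _; exact: sqr_ge0.
have s0 : 0 <= \sum_j `|a j| by apply: sumr_ge0.
rewrite -sqrtrM ?ler0n// -(ger0_norm s0) -sqrtr_sqr ler_wsqrtr//.
rewrite expr2 big_distrlr/=.
apply: (@le_trans _ _ (\sum_j \sum_l (a j ^+ 2 / 2 + a l ^+ 2 / 2))).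
  apply: ler_sum => j _; apply: ler_sum => l _.
  rewrite -(real_normK (num_real (a j))) -(real_normK (num_real (a l))).
  have := sqr_ge0 (`|a j| - `|a l|); lra.
rewrite (eq_bigr (fun j => #|I|%:R * (a j ^+ 2 / 2) + \sum_l a l ^+ 2 / 2)) => [|j _].
  by rewrite big_split/= -mulr_sumr sumr_const -mulr_natl -!mulr_suml; lra.
by rewrite big_split/= sumr_const mulr_natl.
Qed.

Section private_tilted_family.
Context (R : realType) (d : measure_display) (X : measurableType d) (k n : nat).
Variables (nu : probability X R) (T : 'I_k -> X -> R) (m r : 'I_k -> R).
Variable P : euclid R k -> probability X R.
Hypothesis PT : tilted_family nu T m r P.
Variables (S : set X) (M : R.-pker (n.-tuple X) ~> (euclid R k)) (eps delta : R).
Hypotheses (mS : measurable S)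
  (P_S : forall eta, box_around m r eta -> P eta (~` S) = 0%E)
  (eps_ge0 : 0 <= eps) (eps_le1 : eps <= 1) (delta_ge0 : 0 <= delta)
  (M_dp : dp eps delta S M).
Variables (t0 b : R).
Hypotheses (t0_ge0 : 0 <= t0) (b_ge : forall j, 2 * r j ^+ 3 <= b).

Let mT := tilted_measurable PT.
Let r_ge0 := tilted_radius_ge0 PT.

(* The output of [M] is confined to the box only on datasets in [S]; clipping
   makes it bounded everywhere. *)
Definition clip j (y : euclid R k) : R := Num.max (- r j) (Num.min (r j) (tnth y j)).

Lemma measurable_clip j : measurable_fun setT (clip j).
Proof.
by apply: measurable_maxr => //; apply: measurable_minr => //; exact: measurable_tnth.
Qed.

Lemma clip_bounded j y : `|clip j y| <= r j.
Proof.
rewrite ler_norml /clip le_max lexx/= ge_max ge_min lexx/= andbT.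
by have := r_ge0 j; lra.
Qed.

Lemma clip_id j y : `|tnth y j| <= r j -> clip j y = tnth y j.
Proof.
by rewrite ler_norml /clip => /andP[y1 y2]; rewrite (min_idPr y2) (max_idPr y1).
Qed.

Definition clipped_mean j : n.-tuple X -> R := kernel_mean M (clip j).

Let mclipped j : measurable_fun setT (clipped_mean j).
Proof. exact: measurable_kernel_mean (measurable_clip j). Qed.

Let clipped_le j x : `|clipped_mean j x| <= r j.
Proof. exact: kernel_mean_bounded (measurable_clip j) (clip_bounded j) x. Qed.

Definition score (eta : euclid R k) j (y : euclid R k) : R :=
  face_weight m r j eta * (clip j y - (tnth eta j - m j)).

Definition clipped_sq_error (eta : euclid R k) j (y : euclid R k) : R :=
  (clip j y - (tnth eta j - m j)) ^+ 2.

Definition centered_stat (eta : euclid R k) j (x : X) : R :=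
  T j x - tilt_mean nu T m (T j) eta.

Definition deviation (eta : euclid R k) (x : X) : R :=
  b * Num.sqrt k%:R * Num.sqrt (\sum_(j < k) centered_stat eta j x ^+ 2).

Definition excess_deviation (eta : euclid R k) (x : X) : R :=
  Num.max (deviation eta x - t0) 0.

Definition mean_score_form (eta : euclid R k) : R := \sum_jl
  (\int[iid n (P eta)]_x score_second_moment M (score eta) jl x) *
  \int[P eta]_x (centered_stat eta jl.1 x * centered_stat eta jl.2 x).

Definition total_weighted_cov (eta : euclid R k) : R :=
  \sum_(j < k) weighted_cov (iid n nu) (sum_stat (n := n) T) m r (clipped_mean j) j eta.

Lemma measurable_score eta j : measurable_fun setT (score eta j).
Proof.
by apply: measurable_funM => //; apply: measurable_funB => //; exact: measurable_clip.
Qed.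

Lemma clip_error_le eta j y : box_around m r eta ->
  `|clip j y - (tnth eta j - m j)| <= r j + r j.
Proof.
move=> reta; apply: le_trans (ler_normB _ _) _.
by apply: lerD; [exact: clip_bounded|exact: reta].
Qed.

Lemma score_bounded eta j y : box_around m r eta -> `|score eta j y| <= b.
Proof.
move=> reta; apply: le_trans (b_ge j).
have /andP[w0 w1] := face_weight_itv PT j reta.
rewrite /score normrM (ger0_norm w0).
have -> : 2 * r j ^+ 3 = r j ^+ 2 * (r j + r j) by ring.
by apply: ler_pM => //; exact: clip_error_le.
Qed.

Lemma measurable_clipped_sq_error eta j : measurable_fun setT (clipped_sq_error eta j).
Proof.
by apply: measurable_funX; apply: measurable_funB => //; exact: measurable_clip.
Qed.

Lemma clipped_sq_error_bounded eta j y : box_around m r eta ->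
  `|clipped_sq_error eta j y| <= (r j + r j) ^+ 2.
Proof.
move=> reta; rewrite normrX ler_pXn2r ?nnegrE ?addr_ge0//.
exact: clip_error_le.
Qed.

Lemma measurable_centered_stat eta j : measurable_fun setT (centered_stat eta j).
Proof. exact: measurable_funB. Qed.

Lemma measurable_deviation eta : measurable_fun setT (deviation eta).
Proof.
apply: measurable_funM => //; apply: (measurableT_comp (@measurable_sqrt R)).
by apply: measurable_sum => j; apply: measurable_funX; exact: measurable_centered_stat.
Qed.

Lemma score_stat_le eta x y : box_around m r eta ->
  `|\sum_(j < k) score eta j y * centered_stat eta j x| <= deviation eta x.
Proof.
move=> reta; apply: le_trans (ler_norm_sum _ _ _) _.
apply: (@le_trans _ _ (b * \sum_(j < k) `|centered_stat eta j x|)).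
  rewrite mulr_sumr; apply: ler_sum => j _; rewrite normrM ler_wpM2r//.
  exact: score_bounded.
rewrite /deviation -mulrA; case: (posnP k) => [k0|k0]; last first.
  have b0 : 0 <= b by rewrite (le_trans _ (b_ge (Ordinal k0)))// mulr_ge0// exprn_ge0.
  by rewrite ler_wpM2l// -[k in k%:R]card_ord sum_norm_le_sqrt.
have -> : k%:R = 0 :> R by rewrite k0.
rewrite sqrtr0 mul0r mulr0 big1 ?mulr0// => j _.
by have := ltn_ord j; rewrite [X in (_ < X)%N]k0.
Qed.

Variable a : 'I_k -> R.
Hypotheses (a_ge0 : forall j, 0 <= a j) (ar : forall j, a j <= r j)
  (a_in : forall j, r j != 0 -> 0 < a j < r j).
Let A := box_around m a.
Let a_lt l : r l != 0 -> a l < r l. Proof. by move=> /a_in/andP[]. Qed.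

Section interior_parameter.
Variable eta : euclid R k.
Hypothesis aeta : A eta.

Let reta : box_around m r eta := sub_box_around ar aeta.
Let Pn := iid n (P eta).
Let PnT := iid_tilted_family n PT.

Lemma centered_stat_integrable j :
  (P eta).-integrable setT (EFin \o centered_stat eta j).
Proof.
apply: integrableBR (tilted_stat_integrable PT ar a_lt j aeta) _.
exact: prob_integrable_cst.
Qed.

Lemma centered_statE j x :
  centered_stat eta j x = T j x - \int[P eta]_x T j x.
Proof. by rewrite /centered_stat (tilt_mean_stat PT ar a_lt). Qed.

Lemma centered_stat_mean j : \int[P eta]_x centered_stat eta j x = 0.
Proof.
under eq_Rintegral do rewrite centered_statE.
rewrite RintegralB//; last exact: prob_integrable_cst.
  by rewrite prob_Rintegral_cst subrr.
exact: (tilted_stat_integrable PT ar a_lt).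
Qed.

Lemma centered_statM_integrable j l : (P eta).-integrable setT
  (EFin \o (fun x => centered_stat eta j x * centered_stat eta l x)).
Proof.
set u := tilt_mean nu T m (T j) eta; set v := tilt_mean nu T m (T l) eta.
have TT := tilted_statM_integrable PT ar a_lt j l aeta.
have Ti i := tilted_stat_integrable PT ar a_lt i aeta.
have := integrableDR (integrableDR TT (integrableZR (- v) (Ti j)))
  (integrableDR (integrableZR (- u) (Ti l)) (prob_integrable_cst (P eta) (u * v))).
apply: eq_integrable => // x _ /=; congr EFin.
by rewrite /centered_stat -/u -/v; ring.
Qed.

Lemma deviation_integrable : (P eta).-integrable setT (EFin \o deviation eta).
Proof.
apply: integrableZR; apply: prob_integrable_sqrt => [x|].
  by apply: sumr_ge0 => j _; exact: sqr_ge0.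
apply: integrable_sumR => // j; under eq_fun do rewrite expr2.
exact: centered_statM_integrable.
Qed.

Lemma entry_integrable (i : 'I_n) (f : X -> R) : measurable_fun setT f ->
  (P eta).-integrable setT (EFin \o f) ->
  Pn.-integrable setT (EFin \o (fun x => f (tnth x i))).
Proof. by move=> mf fi; exact/(law_integrable (law_tnth (fun=> P eta) i) mf). Qed.

Lemma score_entry_integrable (i : 'I_n) j : Pn.-integrable setT
  (EFin \o (fun x => kernel_mean M (score eta j) x * centered_stat eta j (tnth x i))).
Proof.
apply: (integrableMR_bounded (c := b)) => [|x|].
- by apply: measurable_kernel_mean; exact: measurable_score.
- by apply: kernel_mean_bounded => [|y]; [exact: measurable_score|exact: score_bounded].
- by apply: entry_integrable; [exact: measurable_centered_stat
    |exact: centered_stat_integrable].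
Qed.

Lemma kernel_mean_score j x : kernel_mean M (score eta j) x =
  face_weight m r j eta * (clipped_mean j x - (tnth eta j - m j)).
Proof.
have clip_int : (kernel_prob M x).-integrable setT (EFin \o clip j).
  exact: prob_bounded_integrable (measurable_clip j) (clip_bounded j).
have c_int := prob_integrable_cst (kernel_prob M x) (tnth eta j - m j).
rewrite /kernel_mean /score RintegralZl//; last exact: (integrableBR clip_int c_int).
by rewrite (RintegralB measurableT clip_int c_int) prob_Rintegral_cst.
Qed.

Lemma weighted_cov_fingerprint j :
  weighted_cov (iid n nu) (sum_stat (n := n) T) m r (clipped_mean j) j eta =
  \sum_(i < n) \int[Pn]_x
    (kernel_mean M (score eta j) x * centered_stat eta j (tnth x i)).
Proof.
set g := clipped_mean j; set c := tnth eta j - m j.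
have g_int : Pn.-integrable setT (EFin \o g).
  exact: prob_bounded_integrable (clipped_le j).
have T_int (i : 'I_n) : Pn.-integrable setT (EFin \o (fun x => T j (tnth x i))).
  by apply: entry_integrable => //; exact: (tilted_stat_integrable PT ar a_lt).
have gT_int (i : 'I_n) : Pn.-integrable setT (EFin \o (fun x => g x * T j (tnth x i))).
  exact: integrableMR_bounded (clipped_le j) (T_int i).
rewrite /weighted_cov (tilt_covE PnT ar a_lt j (mclipped j) (clipped_le j) aeta).
have -> : \int[Pn]_x (g x * sum_stat T j x) =
    \sum_(i < n) \int[Pn]_x (g x * T j (tnth x i)).
  by rewrite -Rintegral_sum//; apply: eq_Rintegral => x _; rewrite /sum_stat mulr_sumr.
rewrite /sum_stat Rintegral_sum// mulr_sumr -sumrB mulr_sumr.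
apply: eq_bigr => i _; rewrite -(Rintegral_centered_mul c g_int (T_int i) (gT_int i)).
rewrite -RintegralZl//.
  apply: eq_Rintegral => x _; rewrite kernel_mean_score centered_statE mulrA.
  by rewrite (law_Rintegral (law_tnth (fun=> P eta) i)).
apply: (integrableMR_bounded (c := r j + r j)) => [|x|].
- by apply: measurable_funB => //; exact: mclipped.
- by apply: le_trans (ler_normB _ _) _; apply: lerD; [exact: clipped_le|exact: reta].
- exact: integrableBR (T_int i) (prob_integrable_cst Pn _).
Qed.

Lemma total_weighted_cov_le : total_weighted_cov eta <=
  n%:R * (2 * delta * t0 + 2 * eps * Num.sqrt (mean_score_form eta) +
          2 * \int[P eta]_x excess_deviation eta x).
Proof.
rewrite /total_weighted_cov; under eq_bigr do rewrite weighted_cov_fingerprint.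
rewrite exchange_big/= -[X in _ <= X%:R * _]card_ord mulr_natl -sumr_const.
apply: ler_sum => i _; rewrite -Rintegral_sum//; last first.
  by move=> j; exact: score_entry_integrable.
exact: (fingerprint_le mS eps_ge0 eps_le1 delta_ge0 t0_ge0 M_dp (P_S reta)
  (measurable_score eta) (fun j y => score_bounded j y reta)
  centered_stat_integrable centered_statM_integrable centered_stat_mean
  (measurable_deviation eta) deviation_integrable
  (fun x y => score_stat_le x y reta) i).
Qed.

End interior_parameter.

Variable acc : R.
Hypotheses (acc_ge0 : 0 <= acc) (accuracy : forall eta, box_around m r eta ->
  \sum_(j < k) \int[iid n (P eta)]_x kernel_mean M (clipped_sq_error eta j) x <= acc).

Let PnT := iid_tilted_family n PT.

Lemma clipped_sq_error_ge eta j : box_around m r eta ->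
  (tnth eta j - m j) ^+ 2 -
    centered_mean (iid n nu) (sum_stat (n := n) T) m (clipped_mean j) j eta <=
  \int[iid n (P eta)]_x kernel_mean M (clipped_sq_error eta j) x.
Proof.
move=> reta; set c := tnth eta j - m j.
have clip_int x : (kernel_prob M x).-integrable setT (EFin \o clip j).
  exact: prob_bounded_integrable (measurable_clip j) (clip_bounded j).
have mean_int : (iid n (P eta)).-integrable setT (EFin \o clipped_mean j).
  exact: prob_bounded_integrable (clipped_le j).
have msq := measurable_clipped_sq_error eta j.
have sq_le y : `|clipped_sq_error eta j y| <= (r j + r j) ^+ 2.
  exact: clipped_sq_error_bounded.
rewrite /centered_mean (tilt_meanE PnT reta (mclipped j)); last first.
  exact: (bounded_tilt_integrable PnT reta (mclipped j) (clipped_le j)).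
rewrite -mulNr -(prob_Rintegral_affine (c ^+ 2) _ mean_int); apply: le_Rintegral => //.
- exact: integrableDR (prob_integrable_cst _ _) (integrableZR _ mean_int).
- exact: (kernel_mean_integrable M msq sq_le (iid n (P eta))).
move=> x _; rewrite -(prob_Rintegral_affine (c ^+ 2) _ (clip_int x)).
apply: le_Rintegral => //.
- exact: integrableDR (prob_integrable_cst _ _) (integrableZR _ (clip_int x)).
- exact: prob_bounded_integrable msq sq_le.
move=> y _; rewrite /clipped_sq_error -/c -subr_ge0.
have -> : (clip j y - c) ^+ 2 - (c ^+ 2 + - (2 * c) * clip j y) = clip j y ^+ 2 by ring.
exact: sqr_ge0.
Qed.

Lemma accuracy_correlation eta : box_around m r eta ->
  \sum_(j < k) (tnth eta j - m j) ^+ 2 - acc <= \sum_(j < k)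
    centered_mean (iid n nu) (sum_stat (n := n) T) m (clipped_mean j) j eta.
Proof.
move=> reta; rewrite lerBlDr -lerBlDl -sumrB; apply: le_trans (accuracy reta).
by apply: ler_sum => j _; exact: clipped_sq_error_ge.
Qed.

Let U := uniform_around m r.
Let mA : measurable A := measurable_box_around m a.

Definition shrink_error : R := \sum_(j < k)
  (r j ^+ 2 * shrink_defect r a + (r j ^+ 2 - a j ^+ 2)).

Let sq_integrable j :
  U.-integrable A (EFin \o (fun eta : euclid R k => (tnth eta j - m j) ^+ 2)).
Proof.
apply: (bounded_integrableR (c := r j ^+ 2)) => // [||eta Aeta]; first exact: prob_lty.
  apply: measurable_funTS; apply: measurable_funX; apply: measurable_funB => //.
  exact: measurable_tnth.
have := sub_box_around ar Aeta j => reta.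
by rewrite normrX ler_pXn2r ?nnegrE.
Qed.

Let centered_mean_int j := centered_mean_integrable PnT ar (mclipped j) (clipped_le j).

Let weighted_cov_int j :=
  weighted_cov_integrable PnT ar a_in (mclipped j) (clipped_le j).

Lemma total_weighted_cov_ge :
  \sum_(j < k) r j ^+ 2 / 3 - acc - shrink_error <=
  \int[U]_(eta in A) total_weighted_cov eta.
Proof.
pose C j := centered_mean (iid n nu) (sum_stat (n := n) T) m (clipped_mean j) j.
rewrite /total_weighted_cov Rintegral_sum//.
apply: (@le_trans _ _
  (\sum_(j < k) (\int[U]_(eta in A) C j eta - (r j ^+ 2 - a j ^+ 2)))); last first.
  by apply: ler_sum => j _;
    exact: (box_by_parts PnT a_ge0 ar a_in (mclipped j) (clipped_le j)).
rewrite /shrink_error big_split/= opprD addrA [leRHS]sumrB lerD2r -Rintegral_sum//.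
have acc_int : U.-integrable A (EFin \o cst acc).
  exact: finite_measure_integrable_cst.
have sq_int := integrable_sumR mA sq_integrable.
apply: (@le_trans _ _ (\int[U]_(eta in A)
    (\sum_(j < k) (tnth eta j - m j) ^+ 2 - acc))); last first.
  apply: le_Rintegral => //; [|exact: integrable_sumR|].
    exact: (integrableB mA sq_int acc_int).
  by move=> eta Aeta; apply: accuracy_correlation; exact: sub_box_around Aeta.
rewrite (RintegralB mA sq_int acc_int) Rintegral_sum// Rintegral_cst// addrAC -sumrB; apply: lerB.
  by apply: ler_sum => j _; exact: uniform_around_variance_ge.
rewrite ler_piMr// -lee_fin fineK ?probability_le1//.
exact: fin_num_measure.
Qed.

Definition mean_excess (eta : euclid R k) : R :=
  \int[nu]_x (excess_deviation eta x * (tilt_weight T m eta x / tilt_mass nu T m eta)).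

Lemma excess_deviation_ge0 eta x : 0 <= excess_deviation eta x.
Proof. by rewrite le_max lexx orbT. Qed.

Lemma mean_excess_ge0 eta : 0 <= mean_excess eta.
Proof.
apply: Rintegral_ge0 => x _; rewrite mulr_ge0 ?excess_deviation_ge0//.
by rewrite divr_ge0 ?tilt_mass_ge0 ?tilt_weight_ge0.
Qed.

Lemma measurable_excess_deviation2 :
  measurable_fun setT (fun z : euclid R k * X => excess_deviation z.1 z.2).
Proof.
apply: measurable_maxr => //; apply: measurable_funB => //.
apply: measurable_funM => //; apply: (measurableT_comp (@measurable_sqrt R)).
apply: measurable_sum => j; apply: measurable_funX; apply: measurable_funB.
  exact: (measurableT_comp (mT j) measurable_snd).
exact: (measurableT_comp (measurable_tilt_mean nu m mT (mT j)) measurable_fst).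
Qed.

Lemma mean_excessE eta : box_around m r eta ->
  \int[P eta]_x excess_deviation eta x = mean_excess eta.
Proof.
move=> reta; rewrite (density_Rintegral (tilted_density PT reta))//.
exact: (measurableT_comp measurable_excess_deviation2 (pair1_measurable eta)).
Qed.

Lemma measurable_mean_excess : measurable_fun setT mean_excess.
Proof.
apply: (measurable_Rintegral_param nu (f := fun z : euclid R k * X =>
  excess_deviation z.1 z.2 * (tilt_weight T m z.1 z.2 / tilt_mass nu T m z.1))).
apply: measurable_funM; first exact: measurable_excess_deviation2.
apply: measurable_funM; first exact: measurable_tilt_weight2.
apply: (measurableT_comp (@measurable_invr R)).
exact: (measurableT_comp (measurable_tilt_mass nu m mT) measurable_fst).
Qed.

Definition additive_cost (eta : euclid R k) : R :=
  n%:R * (2 * delta * t0) + n%:R * 2 * mean_excess eta.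

Let noise_ge0 : 0 <= n%:R * (2 * delta * t0).
Proof. by rewrite !mulr_ge0. Qed.

Let excess_factor_ge0 : 0 <= n%:R * 2 :> R.
Proof. by rewrite mulr_ge0. Qed.

Lemma additive_cost_ge0 eta : 0 <= additive_cost eta.
Proof. by rewrite addr_ge0// mulr_ge0// mean_excess_ge0. Qed.

Lemma measurable_additive_cost : measurable_fun setT additive_cost.
Proof.
by apply: measurable_funD => //; apply: measurable_funM => //;
  exact: measurable_mean_excess.
Qed.

Lemma total_weighted_cov_le_cost eta : A eta -> total_weighted_cov eta <=
  additive_cost eta + n%:R * (2 * eps) * Num.sqrt (mean_score_form eta).
Proof.
move=> Aeta; apply: le_trans (total_weighted_cov_le Aeta) _.
by rewrite (mean_excessE (sub_box_around ar Aeta)) /additive_cost; lra.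
Qed.

Section comparison.
Variables (D : set (euclid R k)) (q e : euclid R k -> \bar R).
Hypotheses (AD : A `<=` D) (q0 : forall eta, (0 <= q eta)%E)
  (e0 : forall eta, (0 <= e eta)%E)
  (qA : forall eta, A eta -> ((Num.sqrt (mean_score_form eta))%:E <= q eta)%E)
  (eA : forall eta, A eta -> ((\int[P eta]_x excess_deviation eta x)%:E <= e eta)%E).

Lemma integral_total_weighted_cov_le : ((\int[U]_(eta in A) total_weighted_cov eta)%:E <=
  \int[U]_(eta in A) (additive_cost eta)%:E +
  (n%:R * (2 * eps))%:E * \int[U]_(eta in D) q eta)%E.
Proof.
have neps : 0 <= n%:R * (2 * eps) by rewrite !mulr_ge0.
have mF : measurable_fun setT total_weighted_cov.
  apply: measurable_sum => j.
  exact: (measurable_weighted_cov PnT j (mclipped j)).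
have F_int : U.-integrable A (EFin \o total_weighted_cov) by exact: integrable_sumR.
have F_le eta : A eta -> ((total_weighted_cov eta)%:E <=
    (additive_cost eta)%:E + (n%:R * (2 * eps))%:E * q eta)%E.
  move=> Aeta; have := total_weighted_cov_le_cost Aeta; rewrite -lee_fin => /le_trans; apply.
  by rewrite EFinD EFinM leeD2l// lee_wpmul2l ?lee_fin ?qA.
rewrite /Rintegral fineK; last exact: integrable_fin_num F_int.
apply: le_trans (ge0_le_integralD_nonmeasurable U neps mA (measurable_funTS mF)
  (measurable_funTS measurable_additive_cost) (fun eta _ => additive_cost_ge0 eta)
  (fun eta _ => q0 eta) F_le) _.
by rewrite leeD2l// lee_wpmul2l ?lee_fin//; exact: ge0_le_integral_subset.
Qed.

Lemma integral_additive_cost_le : (\int[U]_(eta in A) (additive_cost eta)%:E <=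
  (n%:R * (2 * delta * t0))%:E + (n%:R * 2)%:E * \int[U]_(eta in D) e eta)%E.
Proof.
have := prob_integral_affine_le U mA measurable_mean_excess mean_excess_ge0
  noise_ge0 excess_factor_ge0.
move=> /le_trans; apply; rewrite leeD2l// lee_wpmul2l ?lee_fin//.
apply: ge0_le_integral_subset => // eta Aeta; first by rewrite lee_fin mean_excess_ge0.
by rewrite -(mean_excessE (sub_box_around ar Aeta)) eA.
Qed.

(* [q] and [e] need not be measurable in the parameter; [mean_excess] is. *)
Lemma private_tilted_family_bound :
  ((\sum_(j < k) r j ^+ 2 / 3 - acc - shrink_error)%:E <=
   n%:R%:E * ((2 * delta * t0)%:E + (2 * eps)%:E * \int[U]_(eta in D) q eta
     + 2%:E * \int[U]_(eta in D) e eta))%E.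
Proof.
have qD0 : (0 <= (2 * eps)%:E * \int[U]_(eta in D) q eta)%E.
  by rewrite mule_ge0 ?integral_ge0// lee_fin mulr_ge0.
have eD0 : (0 <= 2%:E * \int[U]_(eta in D) e eta)%E by rewrite mule_ge0 ?integral_ge0.
have d0 : (0 <= (2 * delta * t0)%:E)%E by rewrite lee_fin !mulr_ge0.
rewrite (ge0_muleDr _ (adde_ge0 d0 qD0) eD0) (ge0_muleDr _ d0 qD0).
rewrite !muleA -!EFinM addeAC.
apply: (@le_trans _ _ (\int[U]_(eta in A) total_weighted_cov eta)%:E).
  by rewrite lee_fin; exact: total_weighted_cov_ge.
apply: le_trans integral_total_weighted_cov_le _.
by rewrite leeD2r// integral_additive_cost_le.
Qed.

End comparison.

End private_tilted_family.

Lemma shrink_error_scale_le (R : realType) (k : nat) (r : 'I_k -> R) (tau : R) :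
  (forall j, 0 <= r j) -> 0 <= tau -> tau <= 1 ->
  shrink_error r (fun j => (1 - tau) * r j) <= tau * ((k%:R + 2) * \sum_(j < k) r j ^+ 2).
Proof.
move=> r0 tau0 tau1; have defect_le : shrink_defect r (fun j => (1 - tau) * r j) <= tau * k%:R.
  rewrite mulr_natr -[X in _ *+ X]card_ord -sumr_const; apply: ler_sum => j _.
  have [->|rj] := eqVneq (r j) 0; first by rewrite invr0 mulr0.
  by rewrite -{1}[r j]mul1r -mulrBl opprB addrCA subrr addr0 mulfK.
rewrite mulrA mulr_sumr; apply: ler_sum => j _.
have := ler_wpM2l (sqr_ge0 (r j)) defect_le.
have := mulr_ge0 (sqr_ge0 tau) (sqr_ge0 (r j)).
by rewrite !expr2; nra.
Qed.

(** * Exponential families *)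

Section expfam_tilted_family.
Context (R : realType) (d k : nat).
Variables (K : family_kind) (S : set (euclid R d))
  (h : euclid R d -> R) (T : euclid R d -> euclid R k).
Hypotheses (mS : measurable S) (h_ge0 : forall x, S x -> 0 <= h x)
  (mh : measurable_fun S h) (mT : measurable_fun S T).
Variable p : euclid R k -> probability (euclid R d) R.
Hypothesis p_expfam : is_expfam K S h T p.
Variables (eta1 eta2 : euclid R k).
Hypotheses (eta12 : forall j, tnth eta1 j <= tnth eta2 j)
  (box_nat : box eta1 eta2 `<=` natural_range K S h T).

Definition centre (j : 'I_k) : R := midpoint eta1 eta2 j ord0.

Definition radius (j : 'I_k) : R := range_vec eta1 eta2 j ord0 / 2.

Definition box_centre : euclid R k := [tuple centre j | j < k].

Definition stat_in (j : 'I_k) (x : euclid R d) : R :=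
  if x \in S then tnth (T x) j else 0.

Definition active_stat (j : 'I_k) (x : euclid R d) : R :=
  if radius j == 0 then 0 else stat_in j x.

Definition density_in (eta : euclid R k) (x : euclid R d) : R :=
  if x \in S then expfam_density K S h T eta x else 0.

Lemma centreE j : centre j = (tnth eta1 j + tnth eta2 j) / 2.
Proof. by rewrite /centre /midpoint !mxE mulrC. Qed.

Lemma radiusE j : radius j = (tnth eta2 j - tnth eta1 j) / 2.
Proof. by rewrite /radius /range_vec !mxE. Qed.

Lemma radius_ge0 j : 0 <= radius j.
Proof. by rewrite radiusE divr_ge0// subr_ge0. Qed.

Lemma box_around_centre : box_around centre radius = box eta1 eta2.
Proof.
by apply/seteqP; split=> eta etaj j; have := etaj j; rewrite /= ler_distl centreE radiusE;
  move=> /andP[? ?]; apply/andP; split; lra.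
Qed.

Lemma box_centre_in : box eta1 eta2 box_centre.
Proof.
rewrite -box_around_centre => j.
by rewrite tnth_mktuple subrr normr0 radius_ge0.
Qed.

Lemma uniform_around_centre : uniform_around centre radius = uniform_box eta1 eta2.
Proof.
rewrite /uniform_around /uniform_box; congr product_prob; apply/funext => j.
by rewrite /uniform_side centreE radiusE; congr uniform_itv; field.
Qed.

Lemma measurable_restrict_in (f : euclid R d -> R) : measurable_fun S f ->
  measurable_fun setT (fun x => if x \in S then f x else 0).
Proof. by move=> mf; have /(measurable_restrictT _ mS) := mf. Qed.

Lemma measurable_stat_in j : measurable_fun setT (stat_in j).
Proof.
apply: measurable_restrict_in.
exact: (measurableT_comp (measurable_tnth j) mT).
Qed.

Lemma measurable_active_stat j : measurable_fun setT (active_stat j).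
Proof.
rewrite /active_stat; case: (radius j == 0); first exact: measurable_cst.
exact: measurable_stat_in.
Qed.

Lemma active_stat_degenerate j : radius j = 0 -> forall x, active_stat j x = 0.
Proof. by move=> r0 x; rewrite /active_stat r0 eqxx. Qed.

Lemma active_statE j x : radius j != 0 -> active_stat j x = stat_in j x.
Proof. by rewrite /active_stat => /negbTE ->. Qed.

Lemma dot_vecE (u v : euclid R k) :
  dot (vec u) (vec v) = \sum_(j < k) tnth u j * tnth v j.
Proof. by rewrite /dot mxE; apply: eq_bigr => j _; rewrite !mxE. Qed.

Lemma expfam_has_density eta : box eta1 eta2 eta ->
  has_density (p eta) (base_measure R d K) (density_in eta).
Proof.
move=> beta.
have mdensity : measurable_fun setT (density_in eta).
  apply: measurable_restrict_in; apply: measurable_funM => //.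
  apply: (measurableT_comp (@measurable_expR R)); apply: measurable_funB => //.
  under eq_fun do rewrite dot_vecE.
  apply: measurable_sum => j; apply: measurable_funM => //.
  exact: (measurableT_comp (measurable_tnth j) mT).
have density0 x : 0 <= density_in eta x.
  rewrite /density_in; case: ifPn => // /set_mem Sx.
  by rewrite /expfam_density mulr_ge0 ?expR_ge0 ?h_ge0.
split=> // f mf f0; apply: ge0_integral_density => // B mB.
apply: etrans (p_expfam (box_nat beta) mB) _.
rewrite [LHS]integral_mkcond [RHS]integral_mkcond; congr (integral _ _).
apply/funext => x; rewrite /patch /density_in in_setI.
by case: (x \in S); case: (x \in B).
Qed.

Definition partition_ratio (eta : euclid R k) : R :=
  expR (fine (log_partition K S h T box_centre) - fine (log_partition K S h T eta)).

Lemma density_inE eta x : box_around centre radius eta ->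
  density_in eta x =
  tilt_weight active_stat centre eta x * partition_ratio eta * density_in box_centre x.
Proof.
move=> reta; rewrite /density_in.
case: (boolP (x \in S)) => [Sx|_]; last by rewrite mulr0.
have dotE : dot (vec eta) (vec (T x)) = dot (vec box_centre) (vec (T x)) +
    \sum_(j < k) (tnth eta j - centre j) * active_stat j x.
  rewrite !dot_vecE -big_split/=; apply: eq_bigr => j _.
  rewrite tnth_mktuple; have [r0|r0] := eqVneq (radius j) 0.
    rewrite active_stat_degenerate//.
    by have := reta j; rewrite r0 normr_le0 subr_eq0 => /eqP ->; ring.
  by rewrite active_statE// /stat_in Sx; ring.
rewrite /expfam_density dotE /partition_ratio /tilt_weight.
generalize (log_partition K S h T) => Z.
move: (fine (Z eta)) (fine (Z box_centre)) (dot (vec box_centre) (vec (T x))) => u v w.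
move: (\sum_(j < k) _) => s.
have -> : w + s - u = s + (v - u) + (w - v) by ring.
by rewrite (expRD (s + (v - u)) (w - v)) (expRD s (v - u)) mulrCA.
Qed.

Lemma expfam_tilted_family :
  tilted_family (p box_centre) active_stat centre radius p.
Proof.
have reweighted eta : box_around centre radius eta ->
    (p box_centre).-integrable setT (EFin \o tilt_weight active_stat centre eta) /\
    has_density (p eta) (p box_centre) (fun x => tilt_weight active_stat centre eta x /
      tilt_mass (p box_centre) active_stat centre eta).
  move=> reta; have beta : box eta1 eta2 eta by rewrite -box_around_centre.
  have c0 : 0 < partition_ratio eta by exact: expR_gt0.
  set c := partition_ratio eta in c0; set w := tilt_weight active_stat centre eta.
  have mw : measurable_fun setT w := measurable_tilt_weight centre measurable_active_stat eta.
  have pw : has_density (p eta) (p box_centre) (fun x => w x * c).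
    apply: (density_ratio _ _ (expfam_has_density box_centre_in)).
    - exact: measurable_funM.
    - by move=> x; rewrite mulr_ge0 ?tilt_weight_ge0 ?ltW.
    - rewrite (_ : (fun x => _) = density_in eta); first exact: expfam_has_density.
      by apply/funext => x; rewrite (density_inE _ reta).
  have w_int : (p box_centre).-integrable setT (EFin \o w).
    have := integrableZR c^-1 (density_total_integrable pw).
    by apply: eq_integrable => // x _; rewrite /= mulrCA mulVf ?mulr1 ?gt_eqF.
  split=> //; rewrite (_ : tilt_mass _ _ _ _ = c^-1) ?invrK//.
  have := density_total pw; rewrite RintegralZr// => wc1.
  by apply: (mulIf (lt0r_neq0 c0)); rewrite mulVf ?gt_eqF.
split=> [j|j|j|eta /reweighted[]//|eta /reweighted[]//].
- exact: measurable_active_stat.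
- exact: radius_ge0.
- exact: active_stat_degenerate.
Qed.

Lemma expfam_conull eta : box_around centre radius eta -> p eta (~` S) = 0%E.
Proof.
rewrite box_around_centre => /box_nat neta.
apply: etrans (p_expfam neta (measurableC mS)) _.
by rewrite setICr integral_set0.
Qed.

Lemma sum_radius_sq :
  \sum_(j < k) radius j ^+ 2 / 3 = norm2 (range_vec eta1 eta2) ^+ 2 / 12.
Proof.
rewrite /norm2 sqr_sqrtr; last by apply: sumr_ge0 => j _; exact: sqr_ge0.
by rewrite mulr_suml; apply: eq_bigr => j _; rewrite /radius; field.
Qed.

Lemma radius_cube_le j : 2 * radius j ^+ 3 <= normoo (range_vec eta1 eta2) ^+ 3 / 4.
Proof.
have -> : 2 * radius j ^+ 3 = range_vec eta1 eta2 j ord0 ^+ 3 / 4 by rewrite /radius; field.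
have range0 : 0 <= range_vec eta1 eta2 j ord0.
  by have := radius_ge0 j; rewrite /radius; lra.
have range_le : range_vec eta1 eta2 j ord0 <= normoo (range_vec eta1 eta2).
  rewrite -(ger0_norm range0).
  exact: (le_bigmax 0 (fun l => `|range_vec eta1 eta2 l ord0|) j).
by rewrite ler_wpM2r// ler_pXn2r ?nnegrE// (le_trans range0).
Qed.

End expfam_tilted_family.

Section fingerprint_terms.
Context (R : realType) (d k n : nat).
Variables (K : family_kind) (S : set (euclid R d))
  (h : euclid R d -> R) (T : euclid R d -> euclid R k).
Hypotheses (mS : measurable S) (h_ge0 : forall x, S x -> 0 <= h x)
  (mh : measurable_fun S h) (mT : measurable_fun S T).
Variable p : euclid R k -> probability (euclid R d) R.
Hypothesis p_expfam : is_expfam K S h T p.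
Variables (eta1 eta2 : euclid R k).
Hypotheses (eta12 : forall j, tnth eta1 j <= tnth eta2 j)
  (box_nat : box eta1 eta2 `<=` natural_range K S h T).
Variable M : R.-pker (n.-tuple (euclid R d)) ~> (euclid R k).
Hypothesis M_box : forall x, datasets S x -> M x (centered_box eta1 eta2) = 1%E.

Let m := centre eta1 eta2.
Let r := radius eta1 eta2.
Let nu := p (box_centre eta1 eta2).
Let Ta := active_stat S T eta1 eta2.
Let PT : tilted_family nu Ta m r p :=
  expfam_tilted_family mS h_ge0 mh mT p_expfam eta12 box_nat.
Let r_ge0 : forall j, 0 <= r j := radius_ge0 eta12.

Let P_S eta : box_around m r eta -> p eta (~` S) = 0%E.
Proof. exact: (expfam_conull mS p_expfam box_nat). Qed.

Lemma measurable_centered_box : measurable (centered_box eta1 eta2).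
Proof.
rewrite (_ : centered_box eta1 eta2 = box_around (fun=> 0) r).
  exact: measurable_box_around.
by apply/seteqP; split => y yj j; have := yj j; rewrite /= subr0 ler_norml.
Qed.

Lemma clip_centered_box y j : centered_box eta1 eta2 y -> clip r j y = tnth y j.
Proof. by move=> yj; apply: clip_id; rewrite ler_norml; exact: yj. Qed.

Lemma mean_sq_errorE eta : box_around m r eta ->
  mean_sq_error eta1 eta2 p M eta = (\sum_(j < k) \int[iid n (p eta)]_x
    kernel_mean M (clipped_sq_error m r eta j) x)%:E.
Proof.
move=> reta.
have normE (y : euclid R k) : norm2 (vec y - (vec eta - midpoint eta1 eta2)) ^+ 2 =
    \sum_(j < k) (tnth y j - (tnth eta j - m j)) ^+ 2.
  rewrite /norm2 sqr_sqrtr; last by apply: sumr_ge0 => j _; exact: sqr_ge0.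
  by apply: eq_bigr => j _; rewrite !mxE /m /centre !mxE.
rewrite /mean_sq_error; under eq_integral do under eq_integral do rewrite normE.
apply: (integral_kernel_sum_conull (phi := id) (D := datasets S)
  (E := centered_box eta1 eta2) (c := fun j => (r j + r j) ^+ 2)) => //.
- exact: measurable_datasets.
- by apply: iid_datasets_conull => //; exact: P_S.
- exact: measurable_centered_box.
- move=> j; apply: measurable_funX; apply: measurable_funB => //.
  exact: measurable_tnth.
- by move=> j; exact: measurable_clipped_sq_error.
- by move=> j y; exact: (clipped_sq_error_bounded PT).
- by move=> j y yj; rewrite /clipped_sq_error clip_centered_box.
Qed.

Let b := normoo (range_vec eta1 eta2) ^+ 3 / 4.

Section inner_parameter.
Variable a : 'I_k -> R.
Hypotheses (ar : forall j, a j <= r j) (a_lt : forall j, r j != 0 -> a j < r j).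
Variable eta : euclid R k.
Hypothesis aeta : box_around m a eta.

Let reta : box_around m r eta := sub_box_around ar aeta.
Let centered := centered_stat nu Ta m eta.

Let mcentered j : measurable_fun setT (centered j).
Proof. exact: (measurable_centered_stat PT). Qed.

Lemma mean_statE j : r j != 0 ->
  mean_stat S T (p eta) j ord0 = tilt_mean nu Ta m (Ta j) eta.
Proof.
move=> rj; rewrite mxE (tilt_mean_stat PT ar a_lt j aeta) Rintegral_mkcond.
by apply: eq_Rintegral => x _; rewrite patchE /Ta active_statE.
Qed.

Lemma centered_vecE j x : r j != 0 -> S x ->
  (vec (T x) - mean_stat S T (p eta)) j ord0 = centered j x.
Proof.
move=> rj Sx; rewrite /centered /centered_stat -mean_statE// /Ta active_statE//.
by rewrite /stat_in mem_set// !mxE.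
Qed.

Lemma cov_statE j l : r j != 0 -> r l != 0 ->
  cov_stat S T (p eta) j l = \int[p eta]_x (centered j x * centered l x).
Proof.
move=> rj rl; rewrite mxE Rintegral_mkcond /Rintegral; congr fine.
have covE x : S x -> ((vec (T x) - mean_stat S T (p eta)) *m
    (vec (T x) - mean_stat S T (p eta))^T) j l = centered j x * centered l x.
  by move=> Sx; rewrite mxE big_ord1 [X in _ * X]mxE !centered_vecE.
have mcc : measurable_fun setT (fun x => centered j x * centered l x).
  exact: measurable_funM.
apply: (eq_integral_conull mS (P_S reta)).
- apply/measurable_EFinP; apply: eq_measurable_fun (measurable_restrict_in mS
    (measurable_funTS mcc)) => x _.
  by rewrite patchE; case: ifPn => // /set_mem/covE ->.
- exact/measurable_EFinP.
- by move=> x Sx; rewrite patchE mem_set// covE.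
Qed.

Lemma svecE j y : svec eta1 eta2 eta y j ord0 =
  face_weight m r j eta * (tnth y j - (tnth eta j - m j)).
Proof.
rewrite mxE /face_weight; congr ((_ - _) * _).
by rewrite /r /radius exprMn exprVn; congr (_ / _); ring.
Qed.

Lemma svec_quad_formE y : ((svec eta1 eta2 eta y)^T *m cov_stat S T (p eta) *m
    svec eta1 eta2 eta y) ord0 ord0 =
  \sum_jl svec eta1 eta2 eta y jl.1 ord0 * svec eta1 eta2 eta y jl.2 ord0 *
    \int[p eta]_x (centered jl.1 x * centered jl.2 x).
Proof.
rewrite mxE -(pair_bigA _ (fun j l => svec eta1 eta2 eta y j ord0 *
  svec eta1 eta2 eta y l ord0 * \int[p eta]_x (centered j x * centered l x)))/=.
rewrite exchange_big/=; apply: eq_bigr => l _; rewrite mxE big_distrl/=.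
apply: eq_bigr => j _; rewrite [X in X * _ * _]mxE !svecE.
have [rj|rj] := eqVneq (r j) 0; first by rewrite (face_weight_degenerate PT rj)// !mul0r.
have [rl|rl] := eqVneq (r l) 0.
  by rewrite (face_weight_degenerate PT rl)// !mul0r !mulr0 mul0r.
by rewrite cov_statE//; ring.
Qed.

Lemma quad_form_meanE i :
  quad_form_mean eta1 eta2 S T p M i eta = (mean_score_form nu Ta m r p M eta)%:E.
Proof.
pose s := score m r eta.
pose cov jl : R := \int[p eta]_x (centered jl.1 x * centered jl.2 x).
have ms j : measurable_fun setT (s j) by exact: measurable_score.
have s_le j y : `|s j y| <= b by exact: (score_bounded PT (radius_cube_le eta12)).
have mss jl : measurable_fun setT (fun y => s jl.1 y * s jl.2 y) by exact: measurable_funM.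
have ss_le jl y : `|s jl.1 y * s jl.2 y| <= b * b by rewrite normrM; exact: ler_pM.
have mD := measurable_datasets (n := n) mS.
have D0 := iid_datasets_conull n mS (P_S reta).
rewrite /quad_form_mean.
under eq_integral do under eq_integral do rewrite svec_quad_formE.
rewrite (integral_kernel_sum_conull (phi := fun z => replace z.1 i z.2)
  (D := datasets S `*` S) (E := centered_box eta1 eta2)
  (g := fun jl y => s jl.1 y * s jl.2 y * cov jl) (c := fun jl => b * b * `|cov jl|)).
- rewrite /mean_score_form; congr EFin; apply: eq_bigr => jl _.
  rewrite -(law_Rintegral (law_replace (fun=> p eta) i)); last first.
    by apply: measurable_kernel_mean; exact: measurable_funM.
  rewrite -RintegralZr//; last exact: (kernel_mean_integrable M (mss jl) (ss_le jl)).
  apply: eq_Rintegral => x _; rewrite /kernel_mean RintegralZr//.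
  exact: prob_bounded_integrable (mss jl) (ss_le jl).
- exact: measurable_replace.
- exact: measurableX.
- by apply: product_conull => //; exact: P_S.
- exact: measurable_centered_box.
- by move=> [x z] [/= Sx Sz]; apply: M_box; exact: datasets_replace.
- move=> jl; apply: measurable_funM => //; under eq_fun do rewrite !svecE.
  by apply: measurable_funM; apply: measurable_funM => //; apply: measurable_funB => //;
    exact: measurable_tnth.
- by move=> jl; exact: measurable_funM.
- by move=> jl y; rewrite normrM ler_wpM2r.
- by move=> jl y yE; rewrite /s /score !svecE !clip_centered_box.
Qed.

Lemma centered_norm_le x : S x ->
  Num.sqrt (\sum_(j < k) centered j x ^+ 2) <=
  norm2 (vec (T x) - mean_stat S T (p eta)).
Proof.
move=> Sx; rewrite /norm2 ler_wsqrtr//; apply: ler_sum => j _.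
have [r0|rj] := eqVneq (r j) 0; last by rewrite centered_vecE.
rewrite /centered /centered_stat (_ : Ta j = cst 0); last first.
  by apply/funext => y; exact: active_stat_degenerate.
rewrite /tilt_mean; under eq_Rintegral do rewrite mul0r.
by rewrite Rintegral_cst// !mul0r subrr expr0n sqr_ge0.
Qed.

Lemma measurable_tail_set (i : 'I_n) (c : R) : measurable
  [set x : n.-tuple (euclid R d) | datasets S x /\
    c < norm2 (vec (T (tnth x i)) - mean_stat S T (p eta))].
Proof.
pose N x : R :=
  Num.sqrt (\sum_(j < k) (stat_in S T j x - mean_stat S T (p eta) j ord0) ^+ 2).
have mN : measurable_fun setT (fun x : n.-tuple (euclid R d) => N (tnth x i)).
  apply: (measurableT_comp _ (measurable_tnth i)).
  apply: (measurableT_comp (@measurable_sqrt R)); apply: measurable_sum => j.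
  by apply: measurable_funX; apply: measurable_funB => //; exact: measurable_stat_in.
have NE (x : n.-tuple (euclid R d)) : datasets S x ->
    norm2 (vec (T (tnth x i)) - mean_stat S T (p eta)) = N (tnth x i).
  move=> Sx; congr Num.sqrt; apply: eq_bigr => j _; congr (_ ^+ 2).
  by rewrite !mxE /stat_in mem_set//; exact: Sx.
rewrite [X in measurable X](_ : _ = datasets S `&`
    [set x : n.-tuple (euclid R d) | c < N (tnth x i)]).
  by apply: measurableI; [exact: measurable_datasets|exact: measurable_superlevel].
by apply/seteqP; split=> x /= [Sx]; rewrite NE.
Qed.

Lemma deviation_tail_le (i : 'I_n) (t : R) : 0 < t ->
  (p eta [set x | (t < deviation nu Ta m b eta x)%R] <=
   tail_prob eta1 eta2 S T p i eta t)%E.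
Proof.
move=> t_gt0; have mdev : measurable_fun setT (deviation nu Ta m b eta).
  exact: (measurable_deviation PT).
have mlevel := measurable_superlevel t mdev.
rewrite (law_preimage (law_tnth (fun=> p eta) i) mlevel) /tail_prob; set E := [set x | _ /\ _].
have mCD := measurableC (measurable_datasets (n := n) mS).
have mE : measurable E by exact: measurable_tail_set.
apply: (@le_trans _ _ (iid n (p eta) (E `|` ~` datasets S))).
  apply: le_measure; rewrite ?inE//; last 2 first.
  - exact: measurableU.
  - move=> x /= dev_gt; have [Sx|] := pselect (datasets S x); last by right.
    left; split => //; set q := _ * Num.sqrt _.
    apply: lt_le_trans (centered_norm_le (Sx i)); move: dev_gt; rewrite /deviation.
    set N := Num.sqrt (\sum_(j < k) _); have -> : b * Num.sqrt k%:R = q / 4.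
      by rewrite /b /q; ring.
    move=> tq; have N0 : 0 <= N by exact: sqrtr_ge0.
    have q0 : 0 < q.
      rewrite ltNge; apply/negP => q0; have : q * N <= 0 by exact: mulr_le0_ge0.
      by lra.
    by rewrite ltr_pdivrMr// mulrC; lra.
  - by rewrite -[X in measurable X]setTI; exact: (measurable_tnth i).
rewrite (le_trans (measureU2 _ _ _))//.
by rewrite [X in (_ + X)%E](iid_datasets_conull n mS (P_S reta)) adde0.
Qed.

Lemma excess_le_tail (i : 'I_n) (t0 : R) : 0 < t0 ->
  ((\int[p eta]_x excess_deviation nu Ta m t0 b eta x)%:E <=
   \int[@lebesgue_measure R]_(t in `]t0, +oo[) tail_prob eta1 eta2 S T p i eta t)%E.
Proof.
move=> t0_gt0; have mdev : measurable_fun setT (deviation nu Ta m b eta).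
  exact: (measurable_deviation PT).
rewrite /Rintegral; set I := (X in (fine X)%:E).
apply: (@le_trans _ _ I).
  have : (0 <= I)%E by apply: integral_ge0 => x _; rewrite lee_fin le_max lexx orbT.
  by case: I => [z| |]//= _; rewrite leey.
apply: le_trans (integral_excess_le (p eta) mdev (ltW t0_gt0)) _.
apply: ge0_le_integral_subset => // t /=; rewrite in_itv/= andbT => t0t.
by apply: deviation_tail_le; exact: lt_trans t0t.
Qed.

End inner_parameter.

Variables (eps delta alpha : R).
Hypotheses (eps_ge0 : 0 <= eps) (eps_le1 : eps <= 1) (delta_ge0 : 0 <= delta)
  (M_dp : dp eps delta S M)
  (M_acc : forall eta, box eta1 eta2 eta ->
    (mean_sq_error eta1 eta2 p M eta <= (alpha ^+ 2)%:E)%E)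
  (alpha_le : alpha ^+ 2 <= norm2 (range_vec eta1 eta2) ^+ 2 / 24).

Lemma expfam_fingerprint_bound (i : 'I_n) (t0 tau : R) : 0 < t0 -> 0 < tau < 1 ->
  ((norm2 (range_vec eta1 eta2) ^+ 2 / 24 -
      tau * ((k%:R + 2) * \sum_(j < k) r j ^+ 2))%:E <=
   n%:R%:E *
   ((2 * delta * t0)%:E
    + (2 * eps)%:E * \int[uniform_box eta1 eta2]_(eta in box eta1 eta2)
        sqrte (quad_form_mean eta1 eta2 S T p M i eta)
    + 2%:E * \int[uniform_box eta1 eta2]_(eta in box eta1 eta2)
        \int[@lebesgue_measure R]_(t in `]t0, +oo[)
          tail_prob eta1 eta2 S T p i eta t))%E.
Proof.
move=> t0_gt0 /andP[tau_gt0 tau_lt1]; pose a j := (1 - tau) * r j.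
have tau1 : 0 < 1 - tau by rewrite subr_gt0.
have a_ge0 j : 0 <= a j by rewrite mulr_ge0// ltW.
have ar j : a j <= r j by rewrite ler_piMl// gerBl ltW.
have a_in j : r j != 0 -> 0 < a j < r j.
  move=> rj; have r_gt0 : 0 < r j by rewrite lt0r rj r_ge0.
  by rewrite mulr_gt0//= gtr_pMl// gtrBl.
have a_lt j : r j != 0 -> a j < r j by move=> /a_in/andP[].
have clipped_accuracy eta : box_around m r eta -> \sum_(j < k)
    \int[iid n (p eta)]_x kernel_mean M (clipped_sq_error m r eta j) x <= alpha ^+ 2.
  move=> reta; rewrite -lee_fin -mean_sq_errorE//; apply: M_acc.
  by rewrite -box_around_centre.
have := private_tilted_family_bound PT mS P_S eps_ge0 eps_le1 delta_ge0 M_dp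
  (ltW t0_gt0) (radius_cube_le eta12) a_ge0 ar a_in (sqr_ge0 alpha) clipped_accuracy
  (D := box eta1 eta2)
  (q := fun eta => sqrte (quad_form_mean eta1 eta2 S T p M i eta))
  (e := fun eta => (\int[@lebesgue_measure R]_(t in `]t0, +oo[)
    tail_prob eta1 eta2 S T p i eta t)%E).
rewrite uniform_around_centre sum_radius_sq -/b => bound.
apply: le_trans (bound _ _ _ _ _).
- rewrite lee_fin lerB//; last exact: shrink_error_scale_le (ltW tau_gt0) (ltW tau_lt1).
  by have := alpha_le; lra.
- by rewrite -box_around_centre; exact: sub_box_around.
- by move=> eta; exact: sqrte_ge0.
- by move=> eta; apply: integral_ge0.
- by move=> eta aeta; rewrite (quad_form_meanE ar a_lt aeta).
- by move=> eta aeta; exact: (excess_le_tail ar a_lt aeta).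
Qed.

End fingerprint_terms.

Lemma lee_subM_itv01 (R : realFieldType) (x c : R) (y : \bar R) : 0 <= c ->
  (forall tau, 0 < tau < 1 -> ((x - tau * c)%:E <= y)%E) -> (x%:E <= y)%E.
Proof.
move=> c0 xy; apply/lee_addgt0Pr => e e0.
have ec0 : 0 < e + c + 1 by rewrite ltr_wpDl// addr_ge0// ltW.
have tau01 : 0 < e / (e + c + 1) < 1.
  by rewrite divr_gt0//= ltr_pdivrMr// mul1r -addrA ltrDl ltr_wpDl.
apply: le_trans (leeD2r e%:E (xy _ tau01)); rewrite -EFinD lee_fin.
rewrite -addrA lerDl addrC subr_ge0 mulrAC ler_pdivrMr// ler_pM2l//.
by rewrite -addrA addrCA lerDl addr_ge0// ltW.
Qed.

Theorem theorem3p5 (R : realType) (d k n : nat) (n_gt0 : (0 < n)%N)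
    (K : family_kind) (S : set (euclid R d))
    (h : euclid R d -> R) (T : euclid R d -> euclid R k)
    (mS : measurable S)
    (h_ge0 : forall x, S x -> 0 <= h x)
    (mh : measurable_fun S h)
    (mT : measurable_fun S T)
    (p : euclid R k -> probability (euclid R d) R)
    (p_expfam : is_expfam K S h T p)
    (eta1 eta2 : euclid R k)
    (eta1_nat : natural_range K S h T eta1)
    (eta2_nat : natural_range K S h T eta2)
    (eta12 : forall j, tnth eta1 j <= tnth eta2 j)
    (box_nat : box eta1 eta2 `<=` natural_range K S h T)
    (M : R.-pker (n.-tuple (euclid R d)) ~> (euclid R k))
    (M_box : forall x, datasets S x -> M x (centered_box eta1 eta2) = 1%E)
    (eps delta alpha : R)
    (eps_ge0 : 0 <= eps) (eps_le1 : eps <= 1) (delta_ge0 : 0 <= delta)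
    (M_dp : dp eps delta S M)
    (M_acc : forall eta, box eta1 eta2 eta ->
      (mean_sq_error eta1 eta2 p M eta <= (alpha ^+ 2)%:E)%E)
    (alpha_le : alpha ^+ 2 <= norm2 (range_vec eta1 eta2) ^+ 2 / 24) :
  forall t0 : R, 0 < t0 -> exists i : 'I_n,
    ((norm2 (range_vec eta1 eta2) ^+ 2 / 24)%:E <=
      n%:R%:E *
      ((2 * delta * t0)%:E
       + (2 * eps)%:E *
         \int[uniform_box eta1 eta2]_(eta in box eta1 eta2)
           sqrte (quad_form_mean eta1 eta2 S T p M i eta)
       + 2%:E *
         \int[uniform_box eta1 eta2]_(eta in box eta1 eta2)
           \int[@lebesgue_measure R]_(t in `]t0, +oo[)
             tail_prob eta1 eta2 S T p i eta t))%E.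
Proof.
move=> t0 t0_gt0; exists (Ordinal n_gt0).
apply: (lee_subM_itv01 (c := (k%:R + 2) * \sum_(j < k) radius eta1 eta2 j ^+ 2)).
  by rewrite mulr_ge0 ?sumr_ge0// => j _; exact: sqr_ge0.
move=> tau; exact: (expfam_fingerprint_bound mS h_ge0 mh mT p_expfam eta12 box_nat M_box
  eps_ge0 eps_le1 delta_ge0 M_dp M_acc alpha_le).
Qed.
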